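(* Let $G=(V,E,\omega)$ be an undirected $n$-vertex graph with edge weights in $[1,W]$, and let $k,f\ge1$ be integers. There exists a randomized $f$-fault-tolerant compact routing scheme such that, given a message $M$ at the source vertex $s$ and the routing label of the destination $t$, in the presence of a set $F$ of at most $f$ faulty edges (unknown to $s$), it routes $M$ from $s$ to $t$ in a distributed manner over a path of length at most $32k(|F|+1)^2\cdot\mathrm{dist}_{G\setminus F}(s,t)$ (with high probability, whenever $s,t$ are connected in $G\setminus F$). The total size of all routing tables is $\widetilde{O}(f\cdot n^{1+1/k}\log(nW))$ bits, the message header has $\widetilde{O}(f^2)$ bits, and the label of each vertex has $O(\log(nW)\log n)$ bits.
   Context: A fault-tolerant routing scheme assigns each vertex $u$ a label and a routing table $R(u)$; the routing algorithm at a vertex $u$ holding the message determines, from the header, the destination's label and $R(u)$, the port of the next edge, and may edit the header. The set $F$ of failed edges is not known in advance; a failed edge is revealed only when the message reaches one of its endpoints. The stretch is the ratio between the weighted length of the traversed route and $\mathrm{dist}_{G\setminus F}(s,t)$. $\widetilde{O}$ hides polylogarithmic factors in $n$; ''with high probability'' means with probability at least $1-1/n^c$ for a desired constant $c$, for each fixed $s,t,F$. *)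

(* Defs.v *)
From HB Require Import structures.
From mathcomp Require Import all_boot all_order all_algebra.
From mathcomp Require Import all_classical all_reals all_analysis.

Set Implicit Arguments.
Unset Strict Implicit.
Unset Printing Implicit Defensive.

Import Order.TTheory GRing.Theory Num.Theory.
Import numFieldNormedType.Exports.

Local Open Scope ring_scope.

(* 1 + log2 x rather than log2 x: equivalent up to a constant factor for
   x >= 2, and the size bounds do not degenerate to 0 bits when n = 1. *)
Definition lg (R : realType) (x : R) : R := 1 + ln x / ln 2.

Section Graphs.
Variables (R : realType) (V : finType).

(* Finite simple undirected graph; [wt u v] is meaningful only on edges. *)
Record wgraph := WGraph {
  adj : rel V;
  adj_sym : symmetric adj;
  adj_irr : irreflexive adj;
  wt : V -> V -> R;
  wt_sym : forall u v, wt u v = wt v u }.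

Definition weights_between (G : wgraph) (a b : R) : Prop :=
  forall u v, adj G u v -> a <= wt G u v <= b.

Definition edges (G : wgraph) : {set {set V}} :=
  [set A : {set V} | [exists u, exists v, adj G u v && (A == [set u; v]%SET)]]%SET.

Definition deg (G : wgraph) (u : V) : nat := #|[pred v | adj G u v]|.

(* Fixed-port model: [port u] is an arbitrary bijection from the neighbours of
   [u] onto {0, ..., deg u - 1}. *)
Definition port_numbering (G : wgraph) (port : V -> V -> nat) : Prop :=
  forall u, (forall v, adj G u v -> (port u v < deg G u)%N) /\
            (forall v v', adj G u v -> adj G u v' -> port u v = port u v' -> v = v').

(* Adjacency in G \ F. *)
Definition adjF (G : wgraph) (F : {set {set V}}) : rel V :=
  fun u v => adj G u v && ([set u; v]%SET \notin F).

(* Weighted length of the walk [u :: p]. *)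
Fixpoint walk_length (G : wgraph) (u : V) (p : seq V) : R :=
  if p is v :: p' then wt G u v + walk_length G v p' else 0.

(* dist_{G \ F}(s, t); it is +oo when [s] and [t] are disconnected in G \ F. *)
Definition dist (G : wgraph) (F : {set {set V}}) (s t : V) : \bar R :=
  ereal_inf [set (walk_length G s p)%:E
            | p in [set p : seq V | path (adjF G F) s p /\ last s p = t]]%classic.

End Graphs.

Definition bits := seq bool.

Inductive action : Type :=
  | Deliver
  | Forward of nat & bits. (* outgoing port, new header *)

(* The code run at every vertex: table of the current vertex, label of the
   destination, current header, increasing list of the failed ports of the
   current vertex. It has no other access to the graph or to the faults. *)
Definition local_algorithm := bits -> bits -> bits -> seq nat -> action.

Section Execution.
Variables (R : realType) (V : finType) (G : wgraph R V) (port : V -> V -> nat).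
Variables (alg : local_algorithm) (table : V -> bits).
Variables (F : {set {set V}}) (lt : bits). (* faults, label of the destination *)

Definition failed_ports (u : V) : seq nat :=
  [seq i <- iota 0 (deg G u) |
    [exists v, [&& adj G u v, port u v == i & [set u; v]%SET \in F]]].

Definition act (u : V) (h : bits) : action :=
  alg (table u) lt h (failed_ports u).

(* One hop; the message is lost if the chosen port does not exist or failed. *)
Definition hop (u : V) (h : bits) (v : V) (h' : bits) : Prop :=
  adjF G F u v /\ act u h = Forward (port u v) h'.

(* [routed u h p]: from [u] with header [h] the message traverses exactly the
   walk [u :: p] and is delivered at its last vertex. *)
Inductive routed : V -> bits -> seq V -> Prop :=
  | routed_deliver u h : act u h = Deliver -> routed u h [::]
  | routed_hop u h v h' p : hop u h v h' -> routed v h' p -> routed u h (v :: p).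

(* The message injected at [s] with an empty header reaches [u] with header [h]. *)
Inductive occurs (s : V) : V -> bits -> Prop :=
  | occurs_start : occurs s s [::]
  | occurs_hop u h v h' : occurs s u h -> hop u h v h' -> occurs s v h'.

End Execution.

(* Success event for fixed s, t, F; [routed] is deterministic, so the walk is
   the unique one traversed by the message. *)
Definition routes_within (R : realType) (V : finType) (G : wgraph R V)
    (port : V -> V -> nat) (alg : local_algorithm) (label table : V -> bits)
    (F : {set {set V}}) (s t : V) (stretch : R) : Prop :=
  exists p : seq V,
    [/\ routed G port alg table F (label t) s [::] p,
        last s p = t &
        ((walk_length G s p)%:E <= stretch%:E * dist G F s t)%E].

(* Probability of [E] under the uniform distribution on [Omega]. *)
Definition prob (R : realType) (Omega : finType) (E : Omega -> Prop) : R :=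
  #|[set omega : Omega | `[< E omega >]]%SET|%:R / #|Omega|%:R.

(* Main.v *)
Require Import Defs.
From Stdlib Require Import BinPos Pnat.
From mathcomp Require Import all_boot all_order all_algebra.
From mathcomp Require Import all_classical all_reals all_analysis.
From mathcomp Require Import zify ring lra.
From mathcomp Require Import seq fintype fingraph finset.

Set Implicit Arguments.
Unset Strict Implicit.
Unset Printing Implicit Defensive.

Import Order.TTheory GRing.Theory Num.Theory.
Import numFieldNormedType.Exports.

(** The scheme is deterministic.  For each relevant power of two [rho] take an
    Awerbuch-Peleg sparse cover of average degree [n^(1/k)] whose clusters have
    radius at most [2 k rho] and contain every ball of radius [rho].  In each
    cluster take a shortest path tree and a sparse certificate, namely [f + 1]
    successive maximal forests of the remaining edges of weight at most [rho]: it
    preserves connectivity under [f] faults and has only [O(f)] edges per vertex.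
    Since only the total size of the tables matters, every vertex [z] can store all
    certificate edges at the vertices of its part of a centroid decomposition of
    the tree.  The known faults cut the tree into pieces, and each piece contains a
    vertex, its first centroid, that knows every certificate edge leaving the piece.

    Routing tries the home clusters of [t] by increasing scale.  In a cluster the
    message performs a depth-first search over the pieces: it enters a piece, walks
    to its centroid, learns one exit towards each adjacent piece, and tries the
    exits.  On meeting a new fault it restarts the search where it stands; if the
    search is exhausted it searches for [s] in the same way and moves on to the next
    scale.  With [j] known faults one search costs at most [3 j + 1] tree paths of
    length at most [4 k rho] plus [2 j] certificate edges; summing over the at most
    [|F| + 2] searches of each scale and over the scales gives [32 k (|F| + 1)^2]. *)

(** * Depth-first numbered trees *)

(** The obstacle is that a vertex sees only its table, the header and its own failed ports.
    Numbering a tree depth first turns a failed tree edge into an interval, so the faults in the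
    header decide by comparisons of numbers whether two vertices lie in the same piece. The return
    to [s] is needed because a home cluster of [t] at a later scale can be guaranteed to contain
    [s], but not the vertex where a search ended. Termination and length come from one potential
    with a charge [tau] per elementary step: [tau = 1] bounds the number of steps, [tau = 0] the
    length. Scales are restricted to exponents near the logarithm of some edge weight, so that their
    number is polynomial in [n] whatever [W] is and a scale fits into the header. If [rho] is the
    least power of two above the distance [d], then [rho <= 2 d] and the earlier radii add up to at
    most [rho]; all scales together cost at most [16 k (|F| + 1)^2 rho], whence the 32. *)

Definition in_range (q : nat * nat) x := q.1 <= x < q.1 + q.2.

Definition same_piece (tf : seq (nat * nat)) x y :=
  all (fun q => in_range q x == in_range q y) tf.

Lemma same_pieceP tf x y :
  reflect (forall q, q \in tf -> in_range q x = in_range q y) (same_piece tf x y).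
Proof.
by apply: (iffP allP) => H q /H => [/eqP|->].
Qed.

Lemma same_piece_refl tf x : same_piece tf x x.
Proof. by apply/same_pieceP. Qed.

Lemma same_piece_sym tf x y : same_piece tf x y = same_piece tf y x.
Proof. by apply/same_pieceP/same_pieceP => H q /H. Qed.

Lemma same_piece_trans tf y x z :
  same_piece tf x y -> same_piece tf y z -> same_piece tf x z.
Proof.
by move=> /same_pieceP H /same_pieceP K; apply/same_pieceP => q Hq; rewrite H ?K.
Qed.

Lemma same_piecel tf x y z : same_piece tf x y -> same_piece tf x z = same_piece tf y z.
Proof.
move=> H; apply/idP/idP; apply: same_piece_trans => //.
by rewrite same_piece_sym.
Qed.

(* The subtree of [c] is the interval [c, c + sz c); the value [par 0] is junk. *)
Record dfs_tree (N : nat) (par sz : nat -> nat) : Prop := DfsTree {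
  dfs_pos : 0 < N;
  dfs_root : sz 0 = N;
  dfs_par : forall c, 0 < c < N -> par c < c;
  dfs_size : forall c, c < N -> 0 < sz c <= N - c;
  dfs_edge : forall c d, 0 < c < N -> d < N -> d != c ->
    in_range (d, sz d) c = in_range (d, sz d) (par c) }.

Section TreeTheory.
Variables (N : nat) (par sz : nat -> nat).
Hypothesis T : dfs_tree N par sz.

Definition below c x := in_range (c, sz c) x.

Lemma below_refl x : x < N -> below x x.
Proof. by move=> /(dfs_size T); rewrite /below /in_range /=; lia. Qed.

Lemma below_root x : x < N -> below 0 x.
Proof. by rewrite /below /in_range /= (dfs_root T). Qed.

Lemma below_le c x : below c x -> c <= x.
Proof. by rewrite /below /in_range /=; lia. Qed.

Lemma below_par c : 0 < c < N -> below c (par c) = false.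
Proof. by move=> /(dfs_par T); rewrite /below /in_range /=; lia. Qed.

Lemma par_lt c : 0 < c < N -> par c < N.
Proof. by move=> H; have := dfs_par T H; lia. Qed.

Lemma below_edge c d : 0 < c < N -> d < N -> d != c -> below d c = below d (par c).
Proof. exact: (dfs_edge T). Qed.

Lemma below_child c : 0 < c < N -> below (par c) c.
Proof.
move=> H; have pc := dfs_par T H; have pN := par_lt H.
by rewrite below_edge ?below_refl //; lia.
Qed.

(** Nesting of intervals is not among the axioms of [dfs_tree]. It follows by climbing from [x]
    towards [d]: by [dfs_edge], membership in an interval can change only on the edge above its own
    root. *)
Lemma below_trans c d x : c < N -> x < N -> below c d -> below d x -> below c x.
Proof.
move=> cN; elim/ltn_ind: x => x IH xN cd dx.
have dN : d < N by have := below_le dx; lia.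
case: (eqVneq x d) => [-> //|xd].
have x0 : 0 < x < N by have := below_le dx; lia.
rewrite below_edge // in dx; last by rewrite eq_sym.
case: (eqVneq c x) => [E|cx].
  by have := below_le dx; have := below_le cd; have := dfs_par T x0; lia.
by rewrite below_edge // IH ?par_lt ?dfs_par //; exact: dfs_par T _ _.
Qed.

Lemma laminar c d x : below c x -> below d x -> c <= d -> below c d.
Proof. by rewrite /below /in_range /=; lia. Qed.

Lemma exists_child c x : c < N -> x < N -> below c x -> x != c ->
  exists d, [/\ 0 < d < N, par d = c & below d x].
Proof.
move=> cN; elim/ltn_ind: x => x IH xN cx xc.
have x0 : 0 < x < N by have := below_le cx; lia.
rewrite below_edge // in cx; last by rewrite eq_sym.
case: (eqVneq (par x) c) => [E|pc]; first by exists x; rewrite below_refl.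
have [d [d0 dc dx]] := IH _ (dfs_par T x0) (par_lt x0) cx pc.
have dN : d < N by lia.
case: (eqVneq d x) => [E|ndx]; first by rewrite E below_par in dx.
by exists d; split=> //; rewrite below_edge.
Qed.

Lemma child_uniq c d x : 0 < c < N -> 0 < d < N -> par c = par d -> x < N ->
  below c x -> below d x -> c = d.
Proof.
have W a b : 0 < a < N -> 0 < b < N -> par a = par b -> x < N ->
    below a x -> below b x -> a <= b -> a = b.
  move=> Ha Hb E xN ax bx ab.
  case: (eqVneq a b) => // nab.
  have := laminar ax bx ab; rewrite below_edge //; last by lia.
  by rewrite -E below_par.
move=> Hc Hd E xN cx dx; case: (leqP c d) => H; first exact: W.
by apply/esym/W => //; lia.
Qed.

Definition tree_faults (tf : seq (nat * nat)) :=
  forall q, q \in tf -> 0 < q.1 < N /\ q.2 = sz q.1.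

Lemma tree_faultsP tf q x : tree_faults tf -> q \in tf -> in_range q x = below q.1 x.
Proof. by move=> H /H [_]; case: q => c s /= ->. Qed.

(** Connectedness in the tree: an edge separating two members lies on the path between them, so both
    its ends must be members. *)
Definition convex (P : pred nat) := forall v w c, P v -> P w -> 0 < c < N ->
  below c v -> ~~ below c w -> P c /\ P (par c).

(** [v] and [w] agree on every fault but not on the edge above [c], so that edge is no fault.
    Nesting then forces every fault to treat [c] as it treats [v], and crossing the intact edge to
    [par c] changes nothing. *)
Lemma same_piece_convex tf x : tree_faults tf -> x < N ->
  convex (fun y => (y < N) && same_piece tf x y).
Proof.
move=> TF xN v w c /andP [vN xv] /andP [wN xw] c0 cv ncw.
have vw : same_piece tf v w by rewrite -(same_piecel _ xv).
have cN : c < N by lia.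
have Pc e : e \in tf -> below e.1 c = below e.1 v /\ e.1 != c.
  move=> He; have [e0 _] := TF _ He; have eN : e.1 < N by lia.
  have evw : below e.1 v = below e.1 w.
    by rewrite -!(tree_faultsP _ TF He); move/same_pieceP: vw => ->.
  have ec : e.1 != c.
    by apply/eqP => E; rewrite E cv in evw; rewrite -evw in ncw.
  split=> //; case ev: (below e.1 v).
    case: (leqP e.1 c) => H; first exact: laminar ev cv H.
    have ce : below c e.1 by apply: laminar cv ev _; lia.
    rewrite ev in evw; case/negP: ncw; apply: below_trans ce _ => //.
  by apply/negP => ec'; rewrite (below_trans eN vN ec' cv) in ev.
have sc : same_piece tf x c.
  rewrite (same_piecel _ xv); apply/same_pieceP => q Hq.
  by rewrite !(tree_faultsP _ TF Hq) (Pc _ Hq).1.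
rewrite cN sc par_lt //; split=> //=.
apply: same_piece_trans sc _; apply/same_pieceP => q Hq.
rewrite !(tree_faultsP _ TF Hq) below_edge ?(Pc _ Hq).2 //.
by have := (TF _ Hq).1; lia.
Qed.

Lemma same_piece_par tf c : tree_faults tf -> 0 < c < N -> (c, sz c) \notin tf ->
  same_piece tf c (par c).
Proof.
move=> TF c0 Hc; apply/same_pieceP => q Hq; rewrite !(tree_faultsP _ TF Hq).
have [q0 Eq] := TF _ Hq; apply: below_edge => //; first by lia.
by apply/eqP => E; move: Hc; rewrite -E -Eq -surjective_pairing Hq.
Qed.

Lemma convex_split P z : convex P -> (forall v, P v -> v < N) -> z < N -> ~~ P z ->
  (forall v, P v -> ~~ below z v) \/
  exists d, [/\ 0 < d < N, par d = z & forall v, P v -> below d v].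
Proof.
move=> CP PN zN Pz.
have [[v [Pv zv]]|H] := pselect (exists v, P v /\ below z v); last first.
  by left=> v Pv; apply/negP => zv; apply: H; exists v.
right.
have zw w : P w -> below z w.
  move=> Pw; apply/negPn/negP => nzw.
  have z0 : 0 < z < N.
    case: (posnP z) => [z0|_]; last by rewrite zN.
    by rewrite z0 below_root ?PN in nzw.
  by have [] := CP _ _ _ Pv Pw z0 zv nzw; rewrite (negPf Pz).
have vz : v != z by apply: contra Pz => /eqP <-.
have [d [d0 dz dv]] := exists_child zN (PN _ Pv) zv vz.
exists d; split=> // w Pw; apply/negPn/negP => ndw.
by have [_] := CP _ _ _ Pv Pw d0 dv ndw; rewrite dz (negPf Pz).
Qed.

(** * Balanced separators and the centroid decomposition *)

Definition cnt (S : pred nat) := count S (iota 0 N).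

Lemma cnt_sub (S S' : pred nat) : (forall v, v < N -> S v -> S' v) -> cnt S <= cnt S'.
Proof.
move=> H; rewrite /cnt -!size_filter; apply: uniq_leq_size.
  by rewrite filter_uniq ?iota_uniq.
by move=> v; rewrite !mem_filter mem_iota => /andP [Sv] vN; rewrite H //; lia.
Qed.

Lemma cnt0 S v : cnt S = 0 -> v < N -> ~~ S v.
Proof.
move/eqP; rewrite eqn0Ngt -has_count => /hasPn H vN.
by apply: H; rewrite mem_iota; lia.
Qed.

Lemma cntID S P : cnt S = cnt (fun v => S v && P v) + cnt (fun v => S v && ~~ P v).
Proof.
rewrite /cnt -(size_filter S) -(count_predC P) !count_filter /=.
by congr addn; apply: eq_count => v /=; rewrite andbC.
Qed.

(** Take the largest number [z] whose subtree holds more than half of [S]. Children have larger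
    numbers, so none of their subtrees does, and less than half lies outside the subtree of [z]. *)
Lemma exists_centroid S : 0 < cnt S -> exists z, [/\ z < N,
  forall d, 0 < d < N -> par d = z -> (cnt (fun v => S v && below d v)).*2 <= cnt S &
  (cnt (fun v => S v && ~~ below z v)).*2 <= cnt S].
Proof.
move=> S0.
pose Q z := (z < N) && (cnt S < (cnt (fun v => S v && below z v)).*2).
have Q0 : exists z, Q z.
  exists 0; rewrite /Q (dfs_pos T) /=.
  suff : cnt S <= cnt (fun v => S v && below 0 v) by lia.
  by apply: cnt_sub => v vN ->; rewrite below_root.
have Qb z : Q z -> z <= N by case/andP; lia.
case: (ex_maxnP Q0 Qb) => z /andP [zN Qz] zmax.
exists z; split=> //; last by have := cntID S (below z); lia.
move=> d d0 dz; case: leqP => // Hd.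
have := zmax d; rewrite /Q Hd andbT => /(_ ltac:(lia)).
by have := dfs_par T d0; lia.
Qed.

(* Centroid decomposition: [anc v] lists the centroids of the nested parts
   containing [v]; the first of them lying in a subtree [P] is the same for all
   vertices of [P]. *)
Lemma exists_hubs : exists anc : nat -> seq nat,
  [/\ forall v, size (anc v) <= (trunc_log 2 N).+1,
      forall v z, z \in anc v -> z < N &
      forall P x, convex P -> (forall v, P v -> v < N) -> P x ->
        let z := head 0 (filter P (anc x)) in P z /\ forall v, P v -> z \in anc v].
Proof.
suff K m : forall S, cnt S < 2 ^ m -> exists anc : nat -> seq nat,
  [/\ forall v, size (anc v) <= m, forall v z, z \in anc v -> z < N &
      forall P x, convex P -> (forall v, P v -> (v < N) && S v) -> P x ->
        let z := head 0 (filter P (anc x)) in P z /\ forall v, P v -> z \in anc v].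
  have [|anc [H1 H2 H3]] := K (trunc_log 2 N).+1 predT.
    by rewrite /cnt count_predT size_iota; have := trunc_log_ltn N (isT : 1 < 2).
  by exists anc; split=> // P x CP PN Px; apply: H3 => // v /PN ->.
elim: m => [|m IH] S HS.
  have S0 : cnt S = 0 by move: HS; rewrite expn0; lia.
  exists (fun=> [::]); split=> // P x _ PS /PS /andP [xN].
  by rewrite (negPf (cnt0 S0 xN)).
case: (posnP (cnt S)) => [S0|S0].
  exists (fun=> [::]); split=> // P x _ PS /PS /andP [xN].
  by rewrite (negPf (cnt0 S0 xN)).
have [z [zN zin zout]] := exists_centroid S0.
pose kid d := (0 < d < N) && (par d == z).
(* One family indexed by numbers covers all parts: a child of [z] names its subtree, every other
   index names what lies outside the subtree of [z]. *)
pose part d v := S v && (if kid d then below d v else ~~ below z v).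
have small d : cnt (part d) < 2 ^ m.
  move: HS; rewrite expnS /part; case E: (kid d); last by lia.
  by case/andP: E => d0 /eqP dz; have := zin _ d0 dz; lia.
have [anc H] := choice (fun d => IH _ (small d)).
(* The default 0 is no child, as [kid] asks for [0 < d]; so a vertex under no child of [z] gets the
   index of the outside part. *)
pose kap v := head 0 [seq d <- iota 0 N | kid d && below d v].
have kapE d v : kid d -> v < N -> below d v -> kap v = d.
  move=> kd vN dv; rewrite /kap.
  have : d \in [seq d <- iota 0 N | kid d && below d v].
    by rewrite mem_filter kd dv mem_iota; case/andP: kd; lia.
  have : all (fun d => kid d && below d v) [seq d <- iota 0 N | kid d && below d v].
    exact: filter_all.
  case: [seq _ <- _ | _] => // e s /= /andP [/andP [ke ev] _] _.
  move: ke kd => /andP [e0 /eqP ez] /andP [d0 /eqP dz].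
  by apply: child_uniq ev dv => //; rewrite ez.
have kap0 v : v < N -> ~~ below z v -> ~~ kid (kap v).
  move=> vN nzv; rewrite /kap.
  case E: [seq _ <- _ | _] => [|e s] /=; first by rewrite /kid.
  have : e \in [seq d <- iota 0 N | kid d && below d v] by rewrite E mem_head.
  rewrite mem_filter => /andP [/andP [/andP [e0 /eqP ez] ev] _].
  case/negP: nzv; apply: below_trans ev => //.
  by rewrite -ez below_child.
exists (fun v => z :: anc (kap v) v); split.
- by move=> v /=; have [+ _ _] := H (kap v) => /(_ v).
- move=> v w; rewrite inE => /predU1P [-> //|].
  by have [_ + _] := H (kap v) => /(_ v w).
move=> P x CP PS Px.
have PN v : P v -> v < N by case/PS/andP.
rewrite /=; case Pz: (P z) => /=.
  by split=> // v _; rewrite mem_head.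
have [out|[d [d0 dz din]]] := convex_split CP PN zN (negbT Pz).
  have ko v : P v -> ~~ kid (kap v) by move=> Pv; apply: kap0; [exact: PN|exact: out].
  have eqk v : P v -> kap v = 0.
    move=> Pv; move: (ko _ Pv); rewrite /kap.
    case E: [seq _ <- _ | _] => [//|e s] /=.
    have : e \in [seq d <- iota 0 N | kid d && below d v] by rewrite E mem_head.
    by rewrite mem_filter => /andP [/andP [-> _] _].
  have [_ _ /(_ P x CP)] := H (kap x).
  case=> [v Pv||Hz Hv] //.
    rewrite /part eqk // PN //; case/PS/andP: (Pv) => _ ->.
    by rewrite (negPf (_ : ~~ kid 0)) ?out // /kid.
  by split=> // v Pv; rewrite inE (_ : kap v = kap x) ?Hv ?orbT // !eqk.
have kd : kid d by rewrite /kid d0 dz eqxx.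
have eqk v : P v -> kap v = d by move=> Pv; apply: kapE; rewrite ?PN ?din.
have [_ _ /(_ P x CP)] := H (kap x).
case=> [v Pv||Hz Hv] //.
  by rewrite /part eqk // kd din // PN //; case/PS/andP: Pv => _ ->.
by split=> // v Pv; rewrite inE (_ : kap v = kap x) ?Hv ?orbT // !eqk.
Qed.

Lemma bigmax_fst_witness (tf : seq (nat * nat)) (P : pred (nat * nat)) :
  \max_(q <- tf | P q) q.1 \in 0 :: [seq q.1 | q <- tf & P q].
Proof.
elim: tf => [|a l IH]; first by rewrite big_nil.
rewrite big_cons /=; case: ifP => // _; rewrite /= inE.
case: (leqP (\max_(q <- l | P q) q.1) a.1) => _; first by rewrite mem_head orbT.
by move: IH; rewrite !inE => /orP [->|->]; rewrite ?orbT.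
Qed.

(* The innermost fault containing a vertex determines its piece. *)
Lemma separated_size tf vis : tree_faults tf ->
  (forall v, v \in vis -> v < N) -> uniq vis ->
  {in vis &, forall x y, same_piece tf x y -> x = y} -> size vis <= (size tf).+1.
Proof.
move=> TF VN U S.
(* By nesting, the innermost fault around [v] is the one with the largest left end; 0 means that no
   fault contains [v]. Counting these values gives the bound. *)
pose inner v := \max_(q <- tf | in_range q v) q.1.
have innerP x y : x < N -> y < N -> inner x = inner y -> same_piece tf x y.
  have wit v : 0 < inner v -> exists2 q, q \in tf & in_range q v /\ q.1 = inner v.
    have := bigmax_fst_witness tf (in_range^~ v); rewrite -/(inner v) inE => /predU1P [->//|].
    move=> /mapP [q]; rewrite mem_filter => /andP [qv qtf] Eq _.
    by exists q; rewrite // Eq.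
  suff W x' y' : x' < N -> y' < N -> inner x' = inner y' ->
      forall q, q \in tf -> in_range q x' -> in_range q y'.
    move=> xN yN E; apply/same_pieceP => q Hq.
    by apply/idP/idP; [apply: W E _ _|apply: W (esym E) _ _].
  move=> xN yN E q Hq qx.
  have q0 := (TF _ Hq).1.
  have qle : q.1 <= inner x' by apply: (leq_bigmax_seq (F := fst)).
  have [|q' Hq' [qy' Eq']] := wit y'; first by rewrite -E; lia.
  have [|q'' Hq'' [qx'' Eq'']] := wit x'; first by lia.
  have Eqq : q''.1 = q'.1 by rewrite Eq'' Eq'.
  rewrite (tree_faultsP _ TF Hq') -Eqq in qy'.
  rewrite (tree_faultsP _ TF Hq'') in qx''.
  rewrite !(tree_faultsP _ TF Hq) in qx *.
  apply: below_trans qy' => //; first by lia.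
  by apply: laminar qx qx'' _; rewrite Eq''.
rewrite -(size_map inner) -(size_map fst tf) -/(size (0 :: map fst tf)).
apply: uniq_leq_size.
  rewrite map_inj_in_uniq // => x y xv yv E; apply: S => //.
  by apply: innerP => //; apply: VN.
move=> _ /mapP [v _ ->].
have := bigmax_fst_witness tf (in_range^~ v); rewrite -/(inner v) inE => /predU1P [->|].
  by rewrite mem_head.
move=> /mapP [q]; rewrite mem_filter => /andP [_ qtf] Eq.
by rewrite inE Eq map_f ?orbT.
Qed.

End TreeTheory.

(* A leaf attached to [p] receives the number [p.+1]; later numbers are shifted. *)
Lemma dfs_tree_insert N par sz p : dfs_tree N par sz -> p < N ->
  dfs_tree N.+1
    (fun k => if k == p.+1 then p else bump p.+1 (par (unbump p.+1 k)))
    (fun k => if k == p.+1 then 1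
              else sz (unbump p.+1 k) + in_range (unbump p.+1 k, sz (unbump p.+1 k)) p).
Proof.
move=> T pN.
have T1 := dfs_pos T; have T2 := dfs_root T; have T3 := dfs_par T.
have T4 := dfs_size T; have T5 := dfs_edge T.
have ub k : k != p.+1 -> k < N.+1 ->
    exists2 a, a < N & k = bump p.+1 a /\ unbump p.+1 k = a.
  move=> kp kN; exists (unbump p.+1 k); first by rewrite /unbump; lia.
  by split=> //; rewrite unbumpKcond (negPf kp).
have ubp a : (bump p.+1 a == p.+1) = false by apply/negbTE; rewrite eq_sym neq_bump.
(* An old interval grows by one exactly when it contains the parent of the new leaf; together with
   the shift of later numbers this leaves membership of old vertices unchanged. *)
have inb e x : e < N -> x < N ->
    in_range (bump p.+1 e, sz e + in_range (e, sz e) p) (bump p.+1 x)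
      = in_range (e, sz e) x.
  move=> eN xN; have := T4 e eN; rewrite /bump /in_range /=.
  by case: (leqP p.+1 e); case: (leqP p.+1 x); case: (leqP e p);
     case: (leqP (e + sz e) p) => /=; lia.
split=> //.
- have -> : unbump p.+1 0 = 0 by rewrite /unbump; lia.
  by rewrite /= /in_range /= T2; lia.
- move=> c; case: eqVneq => [-> //|cp] /andP [c0 cN].
  have [a aN [Ec ->]] := ub _ cp cN.
  have a0 : 0 < a < N by rewrite aN andbT lt0n; apply/eqP => a0; move: c0; rewrite Ec a0.
  by have := T3 a a0; rewrite Ec /bump; 
    case: (leqP p.+1 a); case: (leqP p.+1 (par a)) => /=; lia.
- move=> c cN; case: eqVneq => [->|cp]; first by lia.
  have [a aN [-> ->]] := ub _ cp cN.
  have := T4 a aN; rewrite /bump /in_range /=.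
  by case: (leqP p.+1 a); case: (leqP a p); case: (leqP (a + sz a) p) => /=; lia.
move=> c d /andP [c0 cN] dN dc.
case: (eqVneq c p.+1) => [Ec|cp].
  case: (eqVneq d p.+1) => [Ed|dp]; first by rewrite Ec Ed eqxx in dc.
  have [e eN [-> ->]] := ub _ dp dN; rewrite Ec.
  have := T4 e eN; rewrite /bump /in_range /=.
  by case: (leqP p.+1 e); case: (leqP e p); case: (leqP (e + sz e) p) => /=; lia.
have [a aN [Ec ->]] := ub _ cp cN.
have a0 : 0 < a < N by rewrite aN andbT lt0n; apply/eqP => a0; move: c0; rewrite Ec a0.
have paN : par a < N by have := T3 a a0; lia.
case: (eqVneq d p.+1) => [Ed|dp].
  rewrite Ec Ed /in_range /bump /=.
  by 
    case: (leqP p.+1 a); case: (leqP p.+1 (par a)) => /=; lia.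
have [e eN [Ed ->]] := ub _ dp dN; rewrite Ec Ed !inb //.
by apply: T5 => //; apply: contra dc => /eqP E; rewrite Ec Ed E.
Qed.

(** Vertices are inserted as leaves by increasing [d]. A parent has smaller [d] than its child, so
    it already has a number when the child is inserted. *)
Lemma exists_dfs_numbering (disp : Order.disp_t) (A : orderType disp) (V : finType)
    (Y : {set V}) (r : V) (d : V -> A) (Q : V -> V -> Prop) :
  r \in Y ->
  (forall y, y \in Y -> y != r -> exists2 p, p \in Y & Q p y /\ (d p < d y)%O) ->
  exists (par sz : nat -> nat) (vtx : nat -> V),
    [/\ dfs_tree #|Y| par sz,
        {in gtn #|Y| &, injective vtx},
        forall v, v \in Y <-> exists2 x, x < #|Y| & vtx x = v,
        vtx 0 = r &
        forall c, 0 < c < #|Y| -> Q (vtx (par c)) (vtx c)].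
Proof.
move=> rY HQ.
have Y0 : 0 < #|Y| by apply/card_gt0P; exists r.
suff K m : 0 < m <= #|Y| -> exists (par sz : nat -> nat) (vtx : nat -> V),
    [/\ dfs_tree m par sz, {in gtn m &, injective vtx},
        forall x, x < m -> vtx x \in Y, vtx 0 = r &
        forall c, 0 < c < m -> Q (vtx (par c)) (vtx c)].
  have [|par [sz [vtx [T I S R P]]]] := K #|Y|; first by rewrite Y0 leqnn.
  exists par, sz, vtx; split=> // v; split=> [vY|[x xN <-]]; last exact: S.
  have sub : {subset [seq vtx x | x <- iota 0 #|Y|] <= enum Y}.
    by move=> w /mapP [x]; rewrite mem_iota => xN ->; rewrite mem_enum S //; lia.
  have U : uniq [seq vtx x | x <- iota 0 #|Y|].
    rewrite map_inj_in_uniq ?iota_uniq // => x y; rewrite !mem_iota => xN yN.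
    by apply: I; rewrite inE; lia.
  have [|_ E] := uniq_min_size U sub; first by rewrite size_map size_iota -cardE.
  have : v \in enum Y by rewrite mem_enum.
  rewrite -E => /mapP [x]; rewrite mem_iota => xN ->.
  by exists x => //; lia.
elim: m => [//|m IH] Hm; have mY : m < #|Y| by case/andP: Hm.
case: (posnP m) => [E|m0].
  subst m; exists id, (fun=> 1), (fun=> r); split=> //.
  - by split=> // c; lia.
  - by move=> x y; rewrite !inE; lia.
  - by move=> c; lia.
have [|par [sz [vtx [T I S R P]]]] := IH; first by lia.
pose im : {set V} := [set v in [seq vtx x | x <- iota 0 m]].
have imP v : reflect (exists2 x, x < m & vtx x = v) (v \in im).
  rewrite inE; apply: (iffP mapP) => [[x]|[x xm <-]].
    by rewrite mem_iota => xm ->; exists x => //; lia.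
  by exists x => //; rewrite mem_iota; lia.
have [y0 y0Y] : exists y, y \in Y :\: im.
  apply/set0Pn; rewrite -card_gt0.
  have : #|im| <= m.
    rewrite cardsE (leq_trans (card_size _)) // size_map size_iota //.
  by have := cardsDS (A := Y) (B := im); have := cardsID im Y;
    have := subset_leq_card (subsetIr Y im); lia.
have [y yD ymin] := Order.TotalTheory.arg_minP (P := [in Y :\: im]) d y0Y.
move: (yD); rewrite /= in_setD => /andP [yim yY].
have yr : y != r.
  by apply: contra yim => /eqP ->; apply/imP; exists 0.
have [p pY [Qpy dpy]] := HQ y yY yr.
have /imP [q qm Eq] : p \in im.
  apply/negPn/negP => pim; have := ymin p; rewrite /= in_setD pim pY => /(_ isT).
  by rewrite leNgt dpy.
exists (fun k => if k == q.+1 then q else bump q.+1 (par (unbump q.+1 k))).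
exists (fun k => if k == q.+1 then 1
              else sz (unbump q.+1 k) + in_range (unbump q.+1 k, sz (unbump q.+1 k)) q).
exists (fun k => if k == q.+1 then y else vtx (unbump q.+1 k)).
have um k : k < m.+1 -> k != q.+1 -> unbump q.+1 k < m by rewrite /unbump; lia.
split.
- exact: dfs_tree_insert.
- move=> a b; rewrite !inE => am bm.
  case: eqVneq => [->|aq]; case: eqVneq => [->|bq] // E.
  + by case/negP: yim; apply/imP; exists (unbump q.+1 b); rewrite ?um.
  + by case/negP: yim; apply/imP; exists (unbump q.+1 a); rewrite ?um.
  have := I _ _ _ _ E; rewrite !inE !um // => /(_ isT isT) E'.
  by rewrite -(unbumpK (h := q.+1) (x := a)) ?inE // E' unbumpK // inE.
- by move=> x xm; case: eqVneq => // xq; apply/S/um.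
- by rewrite [0 == _]/=.
move=> c /andP [c0 cm]; case: (eqVneq c q.+1) => [Ec|cq].
  by rewrite (ltn_eqF (ltnSn q)) (_ : unbump q.+1 q = q) ?Eq // /unbump; lia.
rewrite (negbTE (_ : bump _ _ != _)) ?bumpK; last by rewrite eq_sym neq_bump.
by apply: P; rewrite um // /unbump; lia.
Qed.

(** * Sparse connectivity certificates *)

Section Certificate.
Variable V : finType.

Definition parent_edges (e : rel V) (p : V -> V) : rel V :=
  fun x y => e x y && ((y == p x) || (x == p y)).

Lemma parent_edges_sym e p : symmetric e -> symmetric (parent_edges e p).
Proof. by move=> es x y; rewrite /parent_edges es orbC. Qed.

(** Breadth-first search: [h] counts the hops from the canonical root of the component, and [p] is
    the predecessor on a shortest path. *)
Lemma exists_hop_parent (e : rel V) : symmetric e ->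
  exists (h : V -> nat) (p : V -> V), forall x, x = root e x \/
    [/\ e (p x) x, h (p x) < h x & root e (p x) = root e x].
Proof.
move=> es; have cs := sym_connect_sym es.
pose reach x n := `[< exists q, [/\ path e (root e x) q, last (root e x) q = x & size q = n] >].
have ex x : exists n, reach x n.
  have := connect_root e x; rewrite cs => /connectP [q pq lq].
  by exists (size q); apply/asboolP; exists q.
pose h x := ex_minn (ex x).
have key x : exists y, x = root e x \/
    [/\ e y x, h y < h x & root e y = root e x].
  rewrite {2}/h; case: ex_minnP => n /asboolP [q [pq lq sq]] _.
  case/lastP: q pq lq sq => [|q y]; first by move=> _ /= {1}<- _; exists x; left.
  rewrite rcons_path last_rcons size_rcons => /andP [pq ey] Ey <-.
  rewrite {}Ey in ey; move: ey; set z := last _ q => ezx.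
  exists z; right.
  have rz : root e z = root e x.
    by apply/eqP; rewrite root_connect // connect1.
  split=> //; rewrite ltnS /h; case: ex_minnP => m _; apply.
  by apply/asboolP; exists q; rewrite rz.
by have [p Hp] := choice key; exists h, p.
Qed.

Lemma exists_forest (e : rel V) : symmetric e ->
  exists p : V -> V, forall x y, e x y -> connect (parent_edges e p) x y.
Proof.
move=> es; have [h [p H]] := exists_hop_parent es.
exists p; have ps := parent_edges_sym p es.
have K n : forall x, h x <= n -> connect (parent_edges e p) x (root e x).
  elim: n => [|n IH] x hx; have [<-|[ex hp rx]] := H x; rewrite ?connect0 //.
    by move: hp; lia.
  apply: (@connect_trans _ _ (p x)); last by rewrite -rx; apply: IH; lia.
  by apply: connect1; rewrite /parent_edges es ex eqxx.
move=> x y exy.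
have -> : connect (parent_edges e p) x y = connect (parent_edges e p) (root e x) y.
  exact: (same_connect (sym_connect_sym ps) (K _ _ (leqnn _)) y).
have /eqP -> : root e x == root e y.
  by rewrite root_connect ?connect1 //; apply: sym_connect_sym.
by rewrite (sym_connect_sym ps) (K _ _ (leqnn _)).
Qed.

Lemma set2_eq (a b x y : V) : [set a; b] = [set x; y] ->
  (a = x /\ b = y) \/ (a = y /\ b = x).
Proof.
move=> E.
have ax : a \in [set x; y] by rewrite -E set21.
have bx : b \in [set x; y] by rewrite -E set22.
have xa : x \in [set a; b] by rewrite E set21.
have ya : y \in [set a; b] by rewrite E set22.
move: ax xa ya bx; rewrite !inE => /orP [] /eqP -> xa ya bx; [left|right]; split=> //.
  by case/orP: ya bx => /eqP ->; rewrite ?orbb => /eqP.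
by case/orP: xa bx => /eqP ->; rewrite ?orbb => /eqP.
Qed.

(* Nagamochi-Ibaraki: peel off [m] maximal forests; fewer than [m] faults leave
   one of them intact. *)
Lemma exists_certificate (Y : {set V}) m : forall e : rel V, symmetric e ->
  (forall x y, e x y -> x \in Y) -> exists ce : rel V,
  [/\ symmetric ce, subrel ce e,
      #|[set q : V * V | ce q.1 q.2]| <= m.*2 * #|Y| &
      forall F : {set {set V}}, #|F| < m -> forall x y, e x y -> [set x; y] \notin F ->
        connect (fun a b => ce a b && ([set a; b] \notin F)) x y].
Proof.
elim: m => [|m IH] e es eY.
  exists (fun _ _ => false); split=> //; first rewrite double0 mul0n leqn0 cards_eq0.
  by apply/eqP/setP => q; rewrite !inE.
have [p Hp] := exists_forest es; set e1 := parent_edges e p in Hp.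
have e1s : symmetric e1 by apply: parent_edges_sym.
pose e' x y := e x y && ~~ e1 x y.
have es' : symmetric e' by move=> x y; rewrite /e' es e1s.
have [|ce' [s' sub' card' con']] := IH e' es'; first by move=> x y /andP [/eY].
exists (fun x y => e1 x y || ce' x y); split.
- by move=> x y; rewrite e1s s'.
- by move=> x y /orP [/andP []|/sub' /andP []].
- have -> : [set q : V * V | e1 q.1 q.2 || ce' q.1 q.2]
      = [set q | e1 q.1 q.2] :|: [set q | ce' q.1 q.2].
    by apply/setP => q; rewrite !inE.
  have sub : [set q | e1 q.1 q.2] \subset
      [set (x, p x) | x in Y] :|: [set (p x, x) | x in Y].
    apply/subsetP => -[x y]; rewrite !inE /= => /andP [exy].
    have exy' : e y x by rewrite es.
    case/orP => /eqP E; apply/orP; [left|right]; apply/imsetP.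
      by exists x; [exact: eY exy|rewrite E].
    by exists y; [exact: eY exy'|rewrite -E].
  have A1 : #|[set (x, p x) | x in Y]| <= #|Y| := leq_imset_card _ _.
  have A2 : #|[set (p x, x) | x in Y]| <= #|Y| := leq_imset_card _ _.
  have A3 := leq_trans (subset_leq_card sub) (leq_card_setU _ _).
  apply: (leq_trans (leq_card_setU _ _)); rewrite doubleS !mulSn addnA.
  by apply: leq_add card'; apply: (leq_trans A3); apply: leq_add.
move=> F Fm x y exy nF.
case e1xy : (e1 x y); first by apply: connect1; rewrite e1xy.
have e'xy : e' x y by rewrite /e' exy e1xy.
(* A faulty edge of the first forest is one fault that the remaining forests need not survive, so
   the induction applies to [F] without it. If there is none, the first forest still joins [x] to
   [y]. *)
have [[a [b [eab abF]]]|none] := pselect (exists a b, e1 a b /\ [set a; b] \in F).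
  have : connect (fun a0 b0 => ce' a0 b0 && ([set a0; b0] \notin F :\ [set a; b])) x y.
    apply: con' => //; first by move: Fm; rewrite (cardsD1 [set a; b] F) abF.
    by rewrite in_setD1 (negPf nF) andbF.
  apply: connect_sub => u v /andP [cuv uvF]; apply: connect1; rewrite cuv orbT /=.
  move: uvF; rewrite in_setD1 negb_and negbK => /orP [/eqP E|//].
  have /andP [_] := sub' _ _ cuv.
  by case: (set2_eq E) => -[-> ->]; rewrite ?(e1s b a) eab.
have := Hp _ _ exy; apply: connect_sub => u v e1uv; apply: connect1; rewrite e1uv /=.
by apply/negP => uvF; apply: none; exists u, v.
Qed.

End Certificate.

(** * The local algorithm *)

(* An edge (a, b), then the port from a to b and the port from b to a. *)
Definition pedge := (nat * nat * nat * nat)%type.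
Definition tail_of (e : pedge) := e.1.1.1.
Definition head_of (e : pedge) := e.1.1.2.
Definition tail_port (e : pedge) := e.1.2.
Definition head_port (e : pedge) := e.2.
Definition reversed (e : pedge) : pedge :=
  (head_of e, tail_of e, head_port e, tail_port e).

(* What a vertex stores about one cluster; a child is stored as (number, subtree
   size, port), and [t_cert] lists the certificate edges (a, b) such that the
   vertex is a hub of a. *)
Record tree_table := TreeTable {
  t_num : nat;
  t_size : nat;
  t_up : nat;
  t_kids : seq (nat * nat * nat);
  t_hubs : seq nat;
  t_cert : seq pedge }.

(* [true] marks an edge to try, [false] an edge to backtrack along. *)
Definition item := (bool * pedge)%type.

Inductive job : Type :=
  | NewScale
  | Enter
  | GoHub of nat
  | GoTarget
  | Pop
  | Cross of item.

Record state := State {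
  scale : nat;
  source : nat;
  returning : bool;
  tfaults : seq (nat * nat);
  cfaults : seq (nat * nat);
  visited : seq nat;
  agenda : seq item;
  task : job }.

Definition scale_state i := State i 0 false [::] [::] [::] [::] NewScale.

Definition start_state x i src ret tf cf := State i src ret tf cf [:: x] [::] Enter.

Definition with_task st j :=
  State (scale st) (source st) (returning st) (tfaults st) (cfaults st)
    (visited st) (agenda st) j.

Inductive outcome : Type :=
  | Finish
  | Internal of state
  | Send of nat & state.

(** Besides the port, the result names the tree edge by the number and subtree size of its lower
    end: the very pair to record in [tfaults] if the port has failed. *)
Definition next_hop (r : tree_table) g : nat * nat * nat :=
  if in_range (t_num r, t_size r) g
  then head (0, 0, 0) [seq q <- t_kids r | in_range q.1 g]
  else (t_num r, t_size r, t_up r).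

Definition move_to (r : tree_table) (failed : seq nat) g st :=
  let: (q, p) := next_hop r g in
  if p \in failed
  then Internal (start_state (t_num r) (scale st) (source st) (returning st)
                   (q :: tfaults st) (cfaults st))
  else Send p st.

(** A single exit per adjacent piece bounds the exits by the number of pieces instead of the number
    of certificate edges; this keeps the agenda, hence the header, quadratic in the number of
    faults. *)
Fixpoint one_per_piece tf (l : seq pedge) :=
  if l is e :: l' then
    let l'' := one_per_piece tf l' in
    if has (fun e' => same_piece tf (head_of e) (head_of e')) l'' then l'' else e :: l''
  else [::].

Definition usable (cf : seq (nat * nat)) (a b : nat) :=
  ((a, b) \notin cf) && ((b, a) \notin cf).

Definition exits (r : tree_table) st : seq pedge :=
  one_per_piece (tfaults st)
    [seq e <- t_cert r | same_piece (tfaults st) (t_num r) (tail_of e)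
                         && usable (cfaults st) (tail_of e) (head_of e)].

Definition target_of tn st := if returning st then source st else tn.

(** The agenda is a stack. The exits of a piece are pushed above the [false] item leading back out
    of it, so the way back surfaces only after all of them are dealt with. A newly met fault
    discards the visited pieces and the agenda, but keeps the known faults. *)
Definition tree_step (r : tree_table) (tn : nat) (failed : seq nat) (st : state) : outcome :=
  let x := t_num r in
  let: State i src ret tf cf vis ag j := st in
  match j with
  | NewScale => Finish
  | Enter =>
      Internal (with_task st
        (if same_piece tf x (target_of tn st) then GoTarget
         else GoHub (head 0 (filter (same_piece tf x) (t_hubs r)))))
  | GoHub g =>
      if x == g
      then Internal (State i src ret tf cf vis ([seq (true, e) | e <- exits r st] ++ ag) Pop)
      else move_to r failed g st
  | GoTarget =>
      if x == target_of tn st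
      then if ret then Internal (scale_state i.+1) else Finish
      else move_to r failed (target_of tn st) st
  | Pop =>
      if ag is (k, e) :: ag' then
        if k && has (same_piece tf (head_of e)) vis
        then Internal (State i src ret tf cf vis ag' Pop)
        else Internal (State i src ret tf cf (if k then head_of e :: vis else vis) ag'
                         (Cross (k, e)))
      else if ret then Finish else Internal (start_state x i src true tf cf)
  | Cross (k, e) =>
      if x == tail_of e
      then if tail_port e \in failed
           then Internal (start_state x i src ret tf ((tail_of e, head_of e) :: cf))
           else Send (tail_port e)
                  (if k then State i src ret tf cf vis ((false, reversed e) :: ag) Enter
                   else with_task st Pop)
      else move_to r failed (tail_of e) st
  end.

Lemma one_per_piece_sub tf l : {subset one_per_piece tf l <= l}.
Proof.
elim: l => [//|e l IH] e' /=; case: ifP => _; first by move/IH; rewrite inE => ->; rewrite orbT.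
by rewrite !inE => /predU1P [->|/IH ->]; rewrite ?eqxx ?orbT.
Qed.

Lemma one_per_piece_cover tf l e : e \in l ->
  has (fun e' => same_piece tf (head_of e) (head_of e')) (one_per_piece tf l).
Proof.
elim: l => [//|e0 l IH]; rewrite inE => /predU1P [->|/IH H] /=.
  by case: ifP => //= _; rewrite same_piece_refl.
by case: ifP => //= _; rewrite H orbT.
Qed.

Lemma one_per_piece_separated tf l :
  uniq (map head_of (one_per_piece tf l)) /\
  {in map head_of (one_per_piece tf l) &, forall x y, same_piece tf x y -> x = y}.
Proof.
elim: l => [//|e l [U S]] /=; case: ifP => // /negbT /hasPn H.
have nin y : y \in map head_of (one_per_piece tf l) -> ~~ same_piece tf (head_of e) y.
  by move=> /mapP [e' He' ->]; apply: H.
split=> /=.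
  rewrite U andbT; apply/negP => /nin.
  by rewrite same_piece_refl.
move=> x y; rewrite !inE => /predU1P [->|xl] /predU1P [->|yl] //; last exact: S.
  by rewrite (negPf (nin _ yl)).
by rewrite same_piece_sym (negPf (nin _ xl)).
Qed.

(** Says that the stack can be executed from the piece of [x]: a tried exit eventually brings the
    message back to the piece it left, whereas a [false] item moves on to the piece of its head. *)
Fixpoint agenda_from tf x (ag : seq item) : bool :=
  if ag is (k, e) :: ag' then
    same_piece tf x (tail_of e) && agenda_from tf (if k then x else head_of e) ag'
  else true.

Lemma agenda_from_eq tf x y ag : same_piece tf x y ->
  agenda_from tf x ag = agenda_from tf y ag.
Proof.
elim: ag x y => [//|[k e] ag IH] x y xy /=.
by rewrite (same_piecel _ xy); case: k => //; rewrite (IH _ _ xy).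
Qed.

Lemma agenda_from_cat tf x (l : seq pedge) ag :
  (forall e, e \in l -> same_piece tf x (tail_of e)) ->
  agenda_from tf x ([seq (true, e) | e <- l] ++ ag) = agenda_from tf x ag.
Proof.
elim: l => [//|e l IH] H /=; rewrite H ?mem_head //=; apply: IH => e' He'.
by apply: H; rewrite inE He' orbT.
Qed.

Section Ports.
Variables (R : realType) (V : finType) (G : wgraph R V) (port : V -> V -> nat).
Hypothesis GP : port_numbering G port.

Lemma mem_failed_ports F u v : adj G u v ->
  (port u v \in failed_ports G port F u) = ([set u; v] \in F).
Proof.
move=> uv; have [lt inj] := GP u; rewrite mem_filter mem_iota /= add0n lt // andbT.
apply/existsP/idP => [[w /and3P [uw /eqP E]]|H]; last by exists v; rewrite uv eqxx.
by rewrite (inj _ _ uw uv E).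
Qed.

End Ports.

(** * Self-delimiting binary codes *)

Definition prefix_free T (enc : T -> seq bool) :=
  forall x y r r', enc x ++ r = enc y ++ r' -> x = y /\ r = r'.

Lemma prefix_free_inj T (enc : T -> seq bool) : prefix_free enc -> injective enc.
Proof. by move=> H x y E; have [] := H x y [::] [::]; rewrite ?cats0. Qed.

(** Each binary digit below the leading one is announced by [true], and [false] ends the number.
    This doubles the length but lets fields be concatenated without separators. *)
Fixpoint enc_pos (p : positive) : seq bool :=
  match p with
  | xH => [:: false]
  | xO p' => [:: true, false & enc_pos p']
  | xI p' => [:: true, true & enc_pos p']
  end.

Lemma enc_pos_prefix_free : prefix_free enc_pos.
Proof.
elim=> [p IH|p IH|] [q|q|] //= r r' [].
- by move/IH => [-> ->].
- by move/IH => [-> ->].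
- by move=> ->.
Qed.

Definition enc_nat n := enc_pos (Pos.of_succ_nat n).

Lemma enc_nat_prefix_free : prefix_free enc_nat.
Proof.
move=> x y r r' /enc_pos_prefix_free [E ->]; split=> //.
by have := f_equal Pos.to_nat E; rewrite !SuccNat2Pos.id_succ => -[].
Qed.

Lemma size_enc_nat n m : n < m -> size (enc_nat n) <= (trunc_log 2 m).*2.+1.
Proof.
move=> nm; have [k sk] : exists k, size (enc_nat n) = k.*2.+1 /\ 2 ^ k <= n.+1.
  rewrite /enc_nat -(SuccNat2Pos.id_succ n); move: (Pos.of_succ_nat n).
  elim=> [p [k [E H]]|p [k [E H]]|]; last by exists 0.
    by exists k.+1; rewrite /= E doubleS Pos2Nat.inj_xI expnS; split=> //; lia.
  by exists k.+1; rewrite /= E doubleS Pos2Nat.inj_xO expnS; split=> //; lia.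
case: sk => -> H; rewrite ltnS leq_double.
by apply: trunc_log_max => //; apply: leq_trans H nm.
Qed.

Definition enc_pair S T (f : S -> seq bool) (g : T -> seq bool) (q : S * T) := f q.1 ++ g q.2.

Lemma enc_pair_prefix_free S T (f : S -> seq bool) (g : T -> seq bool) :
  prefix_free f -> prefix_free g -> prefix_free (enc_pair f g).
Proof.
move=> Hf Hg [a b] [a' b'] r r'; rewrite /enc_pair /= -!catA => /Hf [-> /Hg [-> ->]].
by [].
Qed.

Fixpoint enc_seq T (f : T -> seq bool) (s : seq T) : seq bool :=
  if s is x :: s' then true :: f x ++ enc_seq f s' else [:: false].

Lemma enc_seq_prefix_free T (f : T -> seq bool) : prefix_free f -> prefix_free (enc_seq f).
Proof.
move=> Hf; elim=> [|x s IH] [|y s'] //= r r' []; first by move=> ->.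
by rewrite -!catA => /Hf [-> /IH [-> ->]].
Qed.

Lemma size_enc_seq T (f : T -> seq bool) s :
  size (enc_seq f s) = (\sum_(x <- s) (size (f x)).+1).+1.
Proof.
elim: s => [|x s IH] /=; first by rewrite big_nil.
by rewrite big_cons size_cat IH; lia.
Qed.

Lemma size_enc_seq_le (T : eqType) (f : T -> seq bool) (s : seq T) c :
  (forall x, x \in s -> size (f x) <= c) -> size (enc_seq f s) <= (size s * c.+1).+1.
Proof.
elim: s => [//|x s IH] H /=; rewrite size_cat mulSn.
have := H x (mem_head _ _); have := IH (fun y ys => H y (mem_behead (s := x :: s) ys)).
by lia.
Qed.

Definition enc_bool (b : bool) := [:: b].

Lemma enc_bool_prefix_free : prefix_free enc_bool.
Proof. by move=> x y r r' []. Qed.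

Lemma enc_map_prefix_free S T (h : S -> T) (f : T -> seq bool) :
  injective h -> prefix_free f -> prefix_free (f \o h).
Proof. by move=> Hh Hf x y r r' /Hf [/Hh -> ->]. Qed.

Definition enc_pair2 := enc_pair enc_nat enc_nat.
Definition enc_pair3 := enc_pair enc_pair2 enc_nat.
Definition enc_pedge := enc_pair enc_pair3 enc_nat.
Definition enc_item := enc_pair enc_bool enc_pedge.

Definition task_code (j : job) : nat * nat * item :=
  let it0 : item := (true, (0, 0, 0, 0)) in
  match j with
  | NewScale => (0, 0, it0)
  | Enter => (1, 0, it0)
  | GoHub g => (2, g, it0)
  | GoTarget => (3, 0, it0)
  | Pop => (4, 0, it0)
  | Cross it => (5, 0, it)
  end.

Lemma task_code_inj : injective task_code.
Proof.
pose dec (q : nat * nat * item) := match q.1.1 with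
  | 0 => NewScale | 1 => Enter | 2 => GoHub q.1.2 | 3 => GoTarget | 4 => Pop
  | _ => Cross q.2 end.
by apply: (can_inj (g := dec)); case.
Qed.

Definition state_code (st : state) :=
  (scale st, source st, returning st, tfaults st, cfaults st, visited st, agenda st,
   task_code (task st)).

Lemma state_code_inj : injective state_code.
Proof.
move=> st st' E; have /task_code_inj := congr1 snd E; move: (congr1 fst E).
by case: st {E} => i1 s1 r1 t1 c1 v1 a1 j1; case: st' => ? ? ? ? ? ? ? ? /=
  [-> -> -> -> -> -> ->] ->.
Qed.

Definition enc_state : state -> seq bool :=
  enc_pair (enc_pair (enc_pair (enc_pair (enc_pair (enc_pair (enc_pair
    enc_nat enc_nat) enc_bool) (enc_seq enc_pair2)) (enc_seq enc_pair2))
    (enc_seq enc_nat)) (enc_seq enc_item)) (enc_pair enc_pair2 enc_item) \o state_code.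

Lemma enc_pair2_prefix_free : prefix_free enc_pair2.
Proof. by do ![apply: enc_pair_prefix_free|apply: enc_nat_prefix_free]. Qed.

Lemma enc_pair3_prefix_free : prefix_free enc_pair3.
Proof. by do ![apply: enc_pair_prefix_free|apply: enc_nat_prefix_free]. Qed.

Lemma enc_pedge_prefix_free : prefix_free enc_pedge.
Proof. by do ![apply: enc_pair_prefix_free|apply: enc_nat_prefix_free]. Qed.

Lemma enc_item_prefix_free : prefix_free enc_item.
Proof. exact: enc_pair_prefix_free enc_bool_prefix_free enc_pedge_prefix_free. Qed.

Lemma enc_state_inj : injective enc_state.
Proof.
apply: prefix_free_inj; apply: enc_map_prefix_free; first exact: state_code_inj.
have P2 := enc_seq_prefix_free enc_pair2_prefix_free.
apply: enc_pair_prefix_free; last first.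
  exact: enc_pair_prefix_free enc_pair2_prefix_free enc_item_prefix_free.
apply: enc_pair_prefix_free; last exact: enc_seq_prefix_free enc_item_prefix_free.
apply: enc_pair_prefix_free; last exact: enc_seq_prefix_free enc_nat_prefix_free.
do 2 (apply: enc_pair_prefix_free => //).
apply: enc_pair_prefix_free; last exact: enc_bool_prefix_free.
exact: enc_pair_prefix_free enc_nat_prefix_free enc_nat_prefix_free.
Qed.

(** The source injects the empty header, which stands for the initial state, so no encoded state may
    coincide with it. *)
Lemma enc_state_neq0 st : enc_state st != [::].
Proof.
rewrite /enc_state /= /enc_pair /= /enc_nat.
by case: (Pos.of_succ_nat (scale st)).
Qed.

(* The identifier of the vertex and its tables, keyed by (scale, cluster). *)
Definition vertex_table := (nat * seq (nat * nat * tree_table))%type.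

(* The identifier of the vertex and, for each scale, its home cluster and its
   number in that cluster. *)
Definition vertex_label := (nat * seq (nat * nat))%type.

Definition table_code (r : tree_table) :=
  (t_num r, t_size r, t_up r, t_kids r, t_hubs r, t_cert r).

Lemma table_code_inj : injective table_code.
Proof. by move=> [? ? ? ? ? ?] [? ? ? ? ? ?] [-> -> -> -> -> ->]. Qed.

Definition enc_tree_table : tree_table -> seq bool :=
  enc_pair (enc_pair (enc_pair enc_pair3 (enc_seq enc_pair3)) (enc_seq enc_nat))
    (enc_seq enc_pedge) \o table_code.

Definition enc_table : vertex_table -> seq bool :=
  enc_pair enc_nat (enc_seq (enc_pair enc_pair2 enc_tree_table)).

Definition enc_label : vertex_label -> seq bool := enc_pair enc_nat (enc_seq enc_pair2).

Lemma enc_table_inj : injective enc_table.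
Proof.
apply: prefix_free_inj; apply: enc_pair_prefix_free; first exact: enc_nat_prefix_free.
apply: enc_seq_prefix_free; apply: enc_pair_prefix_free; first exact: enc_pair2_prefix_free.
apply: enc_map_prefix_free; first exact: table_code_inj.
apply: enc_pair_prefix_free; last exact: enc_seq_prefix_free enc_pedge_prefix_free.
apply: enc_pair_prefix_free; last exact: enc_seq_prefix_free enc_nat_prefix_free.
apply: enc_pair_prefix_free; first exact: enc_pair3_prefix_free.
exact: enc_seq_prefix_free enc_pair3_prefix_free.
Qed.

Lemma enc_label_inj : injective enc_label.
Proof.
apply: prefix_free_inj; apply: enc_pair_prefix_free; first exact: enc_nat_prefix_free.
exact: enc_seq_prefix_free enc_pair2_prefix_free.
Qed.

Definition lookup (tb : vertex_table) (key : nat * nat) : option tree_table :=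
  ohead [seq r.2 | r <- tb.2 & r.1 == key].

(** A new scale is always begun at the source, so the vertex at hand supplies the number of [s]. If
    it lies outside the home cluster of the destination, the scale is skipped. *)
Definition vertex_step (tb : vertex_table) (lb : vertex_label) (failed : seq nat)
    (st : state) : outcome :=
  let home := nth (0, 0) lb.2 (scale st) in
  let record := lookup tb (scale st, home.1) in
  if task st is NewScale then
    if tb.1 == lb.1 then Finish
    else if size lb.2 <= scale st then Finish
    else if record is Some r
      then Internal (start_state (t_num r) (scale st) (t_num r) false [::] [::])
      else Internal (scale_state (scale st).+1)
  else if record is Some r then tree_step r home.2 failed st else Finish.

(** A relation instead of a function, since termination of the internal moves comes only from the
    later potential argument. [action_of] picks the outcome, unique by [local_run_inj]. *)
Inductive local_run tb lb failed : state -> outcome -> Prop :=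
  | local_stop st : (forall st', vertex_step tb lb failed st <> Internal st') ->
      local_run tb lb failed st (vertex_step tb lb failed st)
  | local_step st st' o : vertex_step tb lb failed st = Internal st' ->
      local_run tb lb failed st' o -> local_run tb lb failed st o.

Lemma local_run_inj tb lb failed st o o' :
  local_run tb lb failed st o -> local_run tb lb failed st o' -> o = o'.
Proof.
elim=> {st o} [st H|st st' o E _ IH] R.
  by case: R H => // {}st st' o'' E _ /(_ st').
apply: IH; case: R E => [{}st H E|{}st st'' {}o' E' R E]; first by case: (H st').
by move: R; rewrite E in E'; case: E' => ->.
Qed.

Definition decode T (enc : T -> bits) (x0 : T) (b : bits) : T :=
  if pselect (exists x, enc x = b) is left H then sval (cid H) else x0.

Lemma decodeK T (enc : T -> bits) x0 : injective enc -> cancel enc (decode enc x0).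
Proof.
move=> Hi x; rewrite /decode; case: pselect => [H|[]]; last by exists x.
by case: cid => y /= /Hi.
Qed.

Definition action_of (P : outcome -> Prop) : action :=
  if pselect (exists o, P o) is left H
  then if sval (cid H) is Send p st then Forward p (enc_state st) else Deliver
  else Deliver.

Definition decode_state (h : bits) :=
  if h is [::] then scale_state 0 else decode enc_state (scale_state 0) h.

Lemma decode_stateK : cancel enc_state decode_state.
Proof.
move=> st; have := enc_state_neq0 st; rewrite /decode_state.
case E: (enc_state st) => [//|b l] _; rewrite -E.
exact: decodeK enc_state_inj _.
Qed.

Definition route : local_algorithm := fun tb lb h failed =>
  action_of (local_run (decode enc_table (0, [::]) tb) (decode enc_label (0, [::]) lb) failed
    (decode_state h)).

(** Double counting: each [q] contributes to at most as many positions [x] as [h q] has entries. It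
    is applied with parents, to count stored children, and with hubs, to count stored certificate
    edges. *)
Lemma sum_count_mem_le (T : Type) (s : seq T) (P : pred T) (h : T -> seq nat) N :
  \sum_(0 <= x < N) count (fun q => P q && (x \in h q)) s <= \sum_(q <- s | P q) size (h q).
Proof.
elim: s => [|q s IH] /=; first by rewrite big_nil big1_eq.
rewrite big_cons /= big_split /=; case: (P q) => /=; last by rewrite big1 ?add0n.
apply: leq_add IH; have -> : \sum_(0 <= x < N) (x \in h q) = count [in h q] (index_iota 0 N).
  by rewrite -sum1_count [RHS]big_mkcond; apply: eq_bigr => x _; case: (x \in _).
rewrite -size_filter; apply: uniq_leq_size; first by rewrite filter_uniq ?iota_uniq.
by move=> x; rewrite mem_filter => /andP [].
Qed.

Local Open Scope ring_scope.

(** * Sparse covers and clusters *)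

Section Walks.
Variables (R : realType) (V : finType) (G : wgraph R V) (W : R).
Hypothesis GW : weights_between G 1 W.

Local Notation wl := (walk_length G).

Lemma walk_length_cat x p q : wl x (p ++ q) = wl x p + wl (last x p) q.
Proof. by elim: p x => [|y p IH] x /=; rewrite ?add0r // IH addrA. Qed.

Lemma wt_ge1 x y : adj G x y -> 1 <= wt G x y.
Proof. by move/GW/andP => []. Qed.

Lemma walk_length_ge_size x p : path (adj G) x p -> (size p)%:R <= wl x p.
Proof.
elim: p x => [|y p IH] x //= /andP [xy /IH yp].
by rewrite -natr1 addrC lerD ?wt_ge1.
Qed.

Lemma walk_length_ge0 x p : path (adj G) x p -> 0 <= wl x p.
Proof. by move/walk_length_ge_size; apply: le_trans. Qed.

Lemma walk_length_rev x p : wl (last x p) (rev (belast x p)) = wl x p.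
Proof.
elim: p x => [|y p IH] x //=; rewrite rev_cons -cats1 walk_length_cat IH /= addr0.
rewrite addrC [wt G x y]wt_sym; congr (wt G _ _ + _).
by case: p {IH} => [|z p] //=; rewrite rev_cons last_rcons.
Qed.

Lemma adjF_adj (F : {set {set V}}) x p : path (adjF G F) x p -> path (adj G) x p.
Proof. by apply: sub_path => u v /andP []. Qed.

Lemma exists_uniq_walk (e : rel V) x p : subrel e (adj G) -> path e x p ->
  exists q, [/\ path e x q, last x q = last x p, uniq (x :: q) & wl x q <= wl x p].
Proof.
move=> eG; elim: p x => [|y p IH] x /=; first by exists [::].
case/andP => xy /IH [q [pq lq uq lwq]].
have [xq|nxq] := boolP (x \in y :: q); last first.
  exists (y :: q); split=> //=; rewrite ?xy ?pq ?lerD //.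
  by move: nxq uq => /= -> ->.
case/splitPl: xq pq lq uq lwq => a b lab.
rewrite cat_path last_cat lab => /andP [pa pb] lb uq.
rewrite walk_length_cat lab => lwq; exists b; split=> //.
  by move: uq; rewrite -cat_cons lastI lab cat_rcons cat_uniq => /and3P [].
have := walk_length_ge0 (sub_path eG pa).
by have := wt_ge1 (eG _ _ xy); lra.
Qed.

Definition within (e : rel V) (L : R) (x y : V) : bool :=
  `[< exists p, [/\ path e x p, last x p = y & wl x p <= L] >].

Lemma within_refl e L x : 0 <= L -> within e L x x.
Proof. by move=> L0; apply/asboolP; exists [::]. Qed.

Lemma within_trans e L L' y x z : within e L x y -> within e L' y z ->
  within e (L + L') x z.
Proof.
move=> /asboolP [p [pp lp wp]] /asboolP [q [pq lq wq]]; apply/asboolP.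
exists (p ++ q); rewrite cat_path last_cat walk_length_cat lp pp pq; split=> //.
by rewrite lerD.
Qed.

Lemma within_sub (e e' : rel V) L L' x y : subrel e e' -> L <= L' -> within e L x y ->
  within e' L' x y.
Proof.
move=> ee LL /asboolP [p [pp lp wp]]; apply/asboolP; exists p.
by split; rewrite ?(sub_path ee) ?(le_trans wp).
Qed.

Lemma within_sym e L x y : symmetric e -> within e L x y -> within e L y x.
Proof.
move=> es /asboolP [p [pp lp wp]]; apply/asboolP; exists (rev (belast x p)); split.
- by rewrite -lp rev_path (eq_path (e' := e)) // => a b; exact: es.
- by rewrite -lp; case: p {pp lp wp} => [|z p] //=; rewrite rev_cons last_rcons.
- by rewrite -lp walk_length_rev.
Qed.

(** The bound [rho] on weights loses no walk of length at most [rho], and it makes every certificate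
    edge cheap to cross. *)
Definition local_adj (Y : {set V}) (rho : R) : rel V :=
  fun x y => [&& adj G x y, wt G x y <= rho, x \in Y & y \in Y].

Lemma local_adj_sym Y rho : symmetric (local_adj Y rho).
Proof. by move=> x y; rewrite /local_adj adj_sym wt_sym [(x \in Y) && _]andbC. Qed.

Lemma local_adj_adj Y rho : subrel (local_adj Y rho) (adj G).
Proof. by move=> x y /and4P []. Qed.

Lemma local_adj_path (Y : {set V}) rho x p : path (adj G) x p -> wl x p <= rho ->
  {subset x :: p <= Y} -> path (local_adj Y rho) x p.
Proof.
elim: p x => [|y p IH] x //= /andP [xy yp] wp sY.
have wy := walk_length_ge0 yp; have xy1 := wt_ge1 xy.
rewrite /local_adj xy !sY ?inE ?eqxx ?orbT //= andbT; apply/andP; split; first by lra.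
apply: IH => //; first by lra.
by move=> z zp; apply: sY; rewrite inE zp orbT.
Qed.

Definition gball (rho : R) (u : V) : {set V} := [set v | within (adj G) rho u v].

Lemma gball_walk rho u p : path (adj G) u p -> wl u p <= rho ->
  {subset u :: p <= gball rho u}.
Proof.
move=> pp wp z zp; rewrite inE; apply/asboolP.
case/splitPl: zp pp wp => a b lab; rewrite cat_path walk_length_cat => /andP [pa pb] w.
exists a; split=> //; apply: le_trans w; rewrite lerDl.
exact: walk_length_ge0 pb.
Qed.

Lemma gball_local rho u x (Y : {set V}) : 0 <= rho -> gball rho u \subset Y -> x \in gball rho u ->
  within (local_adj Y rho) rho u x.
Proof.
move=> r0 /subsetP sY; rewrite inE => /asboolP [p [pp lp wp]]; apply/asboolP.
exists p; split=> //; apply: local_adj_path => // z zp; apply: sY.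
exact: gball_walk zp.
Qed.

Lemma local_adjS (Y Y' : {set V}) rho : Y \subset Y' -> subrel (local_adj Y rho) (local_adj Y' rho).
Proof.
by move=> /subsetP s x y /and4P [a b c d]; apply/and4P; split=> //; apply: s.
Qed.

(** * Sparse covers by ball growing *)

Section Cover.
Variables (k : nat) (rho q : R).
Hypotheses (k0 : (0 < k)%N) (rho0 : 0 <= rho) (q0 : 0 <= q) (qk : q ^+ k = #|V|%:R).

Local Notation B := (gball rho).

Lemma gball_refl u : u \in B u.
Proof. by rewrite inE within_refl. Qed.

Definition touch (U K : {set V}) : {set V} := [set u in U | B u :&: K != set0].
Definition grow (U K : {set V}) : {set V} := \bigcup_(u in touch U K) B u.

Lemma growS (U K K' : {set V}) : K \subset K' -> grow U K \subset grow U K'.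
Proof.
move=> KK; apply/bigcupsP => u; rewrite inE => /andP [uU uK].
apply: bigcup_sup; rewrite inE uU; apply: contra uK => /eqP E.
by rewrite -subset0 -E setIS.
Qed.

Lemma iter_grow_subset (U : {set V}) v j : v \in U ->
  iter j (grow U) [set v] \subset iter j.+1 (grow U) [set v].
Proof.
move=> vU; elim: j => [|j IH] /=; last exact: growS.
rewrite sub1set; apply/bigcupP; exists v; last exact: gball_refl.
by rewrite inE vU /=; apply/set0Pn; exists v; rewrite in_setI gball_refl set11.
Qed.

Lemma iter_grow_center (U : {set V}) v j : v \in U -> v \in iter j (grow U) [set v].
Proof.
move=> vU; elim: j => [|j IH]; first by rewrite set11.
exact: (subsetP (iter_grow_subset j vU)).
Qed.

(** A ball absorbed in the next round meets the present kernel in some [y]; passing from [y] to the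
    centre of the ball and on to [x] adds twice [rho]. *)
Lemma iter_grow_within (U : {set V}) v j x : v \in U -> x \in iter j (grow U) [set v] ->
  within (local_adj (iter j (grow U) [set v]) rho) (2 * j%:R * rho) v x.
Proof.
move=> vU; elim: j x => [|j IH] x.
  by rewrite /= inE => /eqP ->; apply: within_refl; rewrite mulr0 mul0r.
rewrite [iter j.+1 _ _]/=; set K := iter j _ _ => /bigcupP [u ut xu].
have uK : B u \subset grow U K by exact: bigcup_sup.
move: ut; rewrite inE => /andP [uU /set0Pn [y]]; rewrite in_setI => /andP [yu yK].
have -> : 2 * j.+1%:R * rho = 2 * j%:R * rho + (rho + rho).
  by rewrite -natr1; ring.
apply: (within_trans (y := y)); last apply: (within_trans (y := u)).
- apply: within_sub (IH _ yK) => //; apply: local_adjS.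
  exact: (iter_grow_subset j vU).
- by apply: within_sym; [exact: local_adj_sym|exact: gball_local yu].
- exact: gball_local xu.
Qed.

(** Otherwise [k] rounds, starting from size 1, multiply the size by more than [q] each, and the
    last kernel would have more than [q ^ k = n] vertices. *)
Lemma exists_slow_growth (U : {set V}) v : v \in U -> exists2 j, (j < k)%N &
  #|iter j.+1 (grow U) [set v]|%:R <= q * #|iter j (grow U) [set v]|%:R.
Proof.
move=> vU; apply: contrapT => none.
have fast j : (j < k)%N ->
    q * #|iter j (grow U) [set v]|%:R < #|iter j.+1 (grow U) [set v]|%:R.
  by move=> jk; rewrite ltNge; apply/negP => H; apply: none; exists j.
have low j : (j <= k)%N -> q ^+ j <= #|iter j (grow U) [set v]|%:R.
  elim: j => [|j IH] jk; first by rewrite cards1.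
  by rewrite exprS; apply: le_trans (ltW (fast j jk)); rewrite ler_wpM2l // IH // ltnW.
case: k k0 qk fast low => // k' _ qk' fast low.
have := fast k' (ltnSn _); rewrite ltNge => /negP; apply.
have := low k' (leqnSn _) => H.
apply: (le_trans (y := #|V|%:R)); first by rewrite ler_nat max_card.
by rewrite -qk' exprS ler_wpM2l.
Qed.

(** A cluster is a kernel grown once more, of size at most [q] times the kernel. All balls meeting
    the kernel are then withdrawn, so the balls that remain are disjoint from it, and the kernel
    sizes add up to at most the size of the union. *)
Lemma exists_partial_cover m (U : {set V}) : (#|U| <= m)%N -> exists Y : V -> {set V},
  [/\ forall v, v \notin U -> Y v = set0,
      forall u, u \in U -> exists v, B u \subset Y v,
      forall v x, x \in Y v -> v \in Y v /\ within (local_adj (Y v) rho) (2 * k%:R * rho) v x &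
      (\sum_v #|Y v|)%N%:R <= q * #|\bigcup_(u in U) B u|%:R].
Proof.
elim: m U => [|m IH] U Um.
  have -> : U = set0 by apply/eqP; rewrite -cards_eq0 -leqn0.
  exists (fun=> set0); split=> //; try by move=> ?; rewrite ?inE.
    by move=> v x; rewrite inE.
  by rewrite big1 ?mulr_ge0 // => v _; rewrite cards0.
have [->|[v vU]] := set_0Vmem U.
  exists (fun=> set0); split=> //; try by move=> ?; rewrite ?inE.
    by move=> v x; rewrite inE.
  by rewrite big1 ?mulr_ge0 // => v _; rewrite cards0.
have [j jk slow] := exists_slow_growth vU.
set K := iter j (grow U) [set v] in slow.
pose S := touch U K.
have vS : v \in S.
  rewrite inE vU; apply/set0Pn; exists v; rewrite in_setI gball_refl.
  exact: iter_grow_center.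
have SU : S \subset U by apply/subsetP => u; rewrite inE => /andP [].
have [|Y [Y0 Yc Yr Ys]] := IH (U :\: S).
  have := cardsD1 v U; rewrite vU => E.
  have : U :\: S \subset U :\ v by apply: setDS; rewrite sub1set.
  by move/subset_leq_card; lia.
(* The centre [v] is itself withdrawn, so its slot is still free for the new cluster. *)
have Yv : Y v = set0 by apply: Y0; rewrite inE vS.
exists (fun w => if w == v then grow U K else Y w); split.
- move=> w wU; case: eqVneq => [wv|_]; first by rewrite wv vU in wU.
  by apply: Y0; rewrite inE (negPf wU) andbF.
- move=> u uU; case uS: (u \in S).
    by exists v; rewrite eqxx; exact: bigcup_sup.
  have [|w Hw] := Yc u; first by rewrite inE uS uU.
  exists w; case: eqVneq => // wv; move: Hw; rewrite wv Yv => /subsetP /(_ u).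
  by rewrite gball_refl inE => /(_ isT).
- move=> w x; case: eqVneq => [->|_]; last exact: Yr.
  move=> xK; split; first exact: (iter_grow_center j.+1 vU).
  apply: within_sub (iter_grow_within (j := j.+1) vU xK) => //.
  by rewrite ler_wpM2r // ler_wpM2l // ler_nat.
rewrite (bigD1 v) //= eqxx (eq_bigr (fun w => #|Y w|)); last first.
  by move=> w /negPf ->.
have E : (\sum_(i | i != v) #|Y i| = \sum_i #|Y i|)%N.
  by rewrite [RHS](bigD1 v) //= Yv cards0.
rewrite E natrD; apply: (le_trans (lerD slow Ys)); rewrite -mulrDr -natrD.
rewrite ler_wpM2l // ler_nat.
set D := \bigcup_(u in U :\: S) B u.
have KD : K :&: D = set0.
  apply/eqP; rewrite -subset0; apply/subsetP => x; rewrite in_setI => /andP [xK].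
  case/bigcupP => u uS xu; move: uS; rewrite !inE => /andP [+ uU]; rewrite uU /= negbK => /eqP E0.
  by move/setP: E0 => /(_ x); rewrite in_setI xu xK in_set0.
have := cardsUI K D; rewrite KD cards0 addn0 => <-; apply: subset_leq_card.
rewrite subUset; apply/andP; split; last first.
  apply/bigcupsP => u; rewrite inE => /andP [_ uU]; exact: bigcup_sup.
have KU i : iter i (grow U) [set v] \subset \bigcup_(u in U) B u.
  apply: (subset_trans (iter_grow_subset i vU)); apply/bigcupsP => u.
  by rewrite inE => /andP [uU _]; exact: bigcup_sup.
exact: KU.
Qed.

Lemma exists_sparse_cover : exists Y : V -> {set V},
  [/\ forall u, exists v, B u \subset Y v,
      forall v x, x \in Y v -> v \in Y v /\ within (local_adj (Y v) rho) (2 * k%:R * rho) v x &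
      (\sum_v #|Y v|)%N%:R <= q * #|V|%:R].
Proof.
have [Y [_ H1 H2 H3]] := exists_partial_cover (leqnn #|[set: V]|).
exists Y; split=> // [u|]; first by apply: H1; rewrite inE.
by apply: (le_trans H3); rewrite ler_wpM2l // ler_nat max_card.
Qed.

End Cover.

(** [d] is the distance from [v] along [e], a minimum over the finitely many walks of at most [#|V|]
    edges, which suffice because cycles can be cut out. The last edge of a shortest walk gives
    [p]. *)
Lemma exists_potential (e : rel V) D v : subrel e (adj G) -> exists d : V -> R,
  forall y, within e D v y -> 0 <= d y <= D /\
    (y != v -> exists p, [/\ within e D v p, e p y & d p + wt G p y <= d y]).
Proof.
move=> eG.
pose P y (t : #|V|.-bseq V) := path e v t && (last v t == y).
have small y : within e D v y -> exists t, P y t /\ wl v t <= D.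
  move=> /asboolP [p [pp lp wp]].
  have [q [pq lq uq wq]] := exists_uniq_walk eG pp.
  have sq : (size q <= #|V|)%N.
    by move: (card_uniqP uq) (max_card (mem (v :: q))) => -> /=; lia.
  by exists (Bseq sq); rewrite /P /= pq lq lp eqxx (le_trans wq).
have key y : exists t, within e D v y ->
    [/\ P y t, wl v t <= D & forall t', P y t' -> wl v t <= wl v t'].
  have [/small [t0 [Pt0 wt0]]|nw] := boolP (within e D v y); last first.
    by exists [bseq].
  case: (arg_minP (fun t : #|V|.-bseq V => wl v t) Pt0) => t Pt tmin.
  by exists t => _; split=> //; apply: le_trans (tmin _ Pt0) wt0.
have [t Ht] := choice key.
exists (fun y => wl v (t y)) => y wy; have [/andP [pt lt] wt tmin] := Ht y wy.
split; first by rewrite (walk_length_ge0 (sub_path eG pt)).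
move=> yv; move: pt lt wt; case: (t y) => s /= + ps ls ws.
case/lastP: s ps ls ws => [|s z]; first by rewrite /= eq_sym (negPf yv).
rewrite rcons_path last_rcons size_rcons -cats1 walk_length_cat /= addr0.
move=> /andP [ps es] /eqP Ez ws ss; rewrite {}Ez in es ws *.
have wy0 := wt_ge1 (eG _ _ es).
have wp : within e D v (last v s) by apply/asboolP; exists s; split=> //; lra.
exists (last v s); split=> //; rewrite lerD2r.
have ss' : (size s <= #|V|)%N := ltnW ss.
have [_ _ pmin] := Ht _ wp.
by apply: (pmin (Bseq ss')); rewrite /P /= ps eqxx.
Qed.

End Walks.

(** * Clusters with their trees, hubs and certificates *)

Record cluster (R : realType) (V : finType) := Cluster {
  csize : nat;
  cpar : nat -> nat;
  csz : nat -> nat;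
  cvtx : nat -> V;
  chubs : nat -> seq nat;
  ccert : rel nat;
  cdepth : nat -> R }.

Section Clusters.
Variables (R : realType) (V : finType) (G : wgraph R V) (W : R).
Hypothesis GW : weights_between G 1 W.


(** [cluster_closed] expresses connectivity as a closure property, the form in which an exhausted
    search uses it. [cluster_cert] keeps certificate edges apart from tree edges, so that no fault
    is counted under both kinds. *)
Record cluster_spec (f : nat) (rho D : R) (Y : {set V}) (C : cluster R V) : Prop :=
  ClusterSpec {
  cluster_tree : dfs_tree (csize C) (cpar C) (csz C);
  cluster_size : csize C = #|Y|;
  cluster_inj : {in gtn (csize C) &, injective (cvtx C)};
  cluster_mem : forall v, v \in Y <-> exists2 x, (x < csize C)%N & cvtx C x = v;
  cluster_edge : forall c, (0 < c < csize C)%N ->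
    local_adj G Y rho (cvtx C (cpar C c)) (cvtx C c);
  cluster_depth : forall c, (0 < c < csize C)%N ->
    cdepth C (cpar C c) + wt G (cvtx C (cpar C c)) (cvtx C c) <= cdepth C c;
  cluster_depth_bounds : forall x, (x < csize C)%N -> 0 <= cdepth C x <= D;
  cluster_hubs_size : forall v, (size (chubs C v) <= (trunc_log 2 #|Y|).+1)%N;
  cluster_hubs_lt : forall v z, z \in chubs C v -> (z < csize C)%N;
  cluster_hubs : forall P x, convex (csize C) (cpar C) (csz C) P ->
    (forall v, P v -> (v < csize C)%N) -> P x ->
    let z := head 0%N (filter P (chubs C x)) in
    P z /\ forall v, P v -> z \in chubs C v;
  cluster_cert_sym : symmetric (ccert C);
  cluster_cert : forall a b, ccert C a b -> [/\ (a < csize C)%N, (b < csize C)%N,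
    local_adj G Y rho (cvtx C a) (cvtx C b) &
    forall c, (0 < c < csize C)%N ->
      [set cvtx C a; cvtx C b] <> [set cvtx C (cpar C c); cvtx C c]];
  cluster_cert_size : (#|[set q : 'I_(csize C) * 'I_(csize C) | ccert C q.1 q.2]|
    <= f.+1.*2 * #|Y|)%N;
  cluster_closed : forall (F : {set {set V}}) (Z : pred nat), (#|F| <= f)%N ->
    (forall c, (0 < c < csize C)%N -> [set cvtx C (cpar C c); cvtx C c] \notin F ->
      Z c = Z (cpar C c)) ->
    (forall a b, ccert C a b -> [set cvtx C a; cvtx C b] \notin F -> Z a -> Z b) ->
    forall x y, (x < csize C)%N -> (y < csize C)%N ->
      connect (fun u v => local_adj G Y rho u v && ([set u; v] \notin F))
        (cvtx C x) (cvtx C y) -> Z x -> Z y }.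

Lemma exists_cluster f rho D (Y : {set V}) r : r \in Y ->
  (forall x, x \in Y -> within G (local_adj G Y rho) D r x) ->
  exists C : cluster R V, cluster_spec f rho D Y C.
Proof.
move=> rY HY; set e := local_adj G Y rho in HY *.
have es : symmetric e by apply: local_adj_sym.
have [d Hd] := exists_potential GW D r (@local_adj_adj _ _ G Y rho).
have [y yY yr|par [sz [vtx [T I S P0 P]]]] := exists_dfs_numbering (d := d)
    (Q := fun p y => e p y /\ d p + wt G p y <= d y) rY.
  have [_ /(_ yr) [p [_ epy dpy]]] := Hd y (HY y yY).
  exists p; first by case/and4P: epy.
  split=> //; apply: lt_le_trans dpy; rewrite ltrDl.
  by have := wt_ge1 GW (local_adj_adj epy); lra.
pose N := #|Y|.
have vY x : (x < N)%N -> vtx x \in Y by move=> xN; apply/S; exists x.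
have [hubs [h1 h2 h3]] := exists_hubs T.
pose te x y := `[< exists2 c, (0 < c < N)%N & [set x; y] = [set vtx (par c); vtx c] >].
have tes x y : te x y = te y x by rewrite /te setUC.
pose e' x y := e x y && ~~ te x y.
have es' : symmetric e' by move=> x y; rewrite /e' es tes.
have [|ce [ces cee cec cecon]] := exists_certificate (Y := Y) f.+1 es'.
  by move=> x y /andP [/and4P []].
have ceY a b : ce a b -> a \in Y /\ b \in Y.
  by move/cee/andP => [/and4P []].
exists (Cluster N par sz vtx hubs
  (fun a b => [&& (a < N)%N, (b < N)%N & ce (vtx a) (vtx b)]) (fun x => d (vtx x))).
split=> //=.
- by move=> c /P [].
- by move=> c /P [].
- by move=> x xN; have [] := Hd _ (HY _ (vY _ xN)).
- by move=> a b; rewrite ces; case: (a < N)%N; case: (b < N)%N.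
- move=> a b /and3P [aN bN /cee /andP [eab nt]]; split=> // c c0 E.
  by case/negP: nt; apply/asboolP; exists c.
- apply: leq_trans cec.
  rewrite -(card_imset (f := fun q : 'I_N * 'I_N => (vtx q.1, vtx q.2))); last first.
    move=> [a b] [a' b'] /= [Ea Eb].
    have := I _ _ _ _ Ea; have := I _ _ _ _ Eb; rewrite !inE !ltn_ord.
    by move=> /(_ isT isT) /ord_inj -> /(_ isT isT) /ord_inj ->.
  apply: subset_leq_card; apply/subsetP => _ /imsetP [[a b] + ->].
  by rewrite !inE /= => /and3P [].
move=> F Z Ff Zt Zc x y xN yN con Zx.
pose ZV u := `[< exists2 a, (a < N)%N & vtx a = u /\ Z a >].
have ZVP a : (a < N)%N -> ZV (vtx a) = Z a.
  move=> aN; apply/asboolP/idP => [[b bN [E Zb]]|Za]; last by exists a.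
  by rewrite -(I _ _ _ _ E).
have Zce u v : ce u v && ([set u; v] \notin F) -> ZV u -> ZV v.
  move=> /andP [cuv nF]; have [uY vY'] := ceY _ _ cuv.
  move/S: uY => [a aN Ea]; move/S: vY' => [b bN Eb].
  rewrite -{}Ea -{}Eb in cuv nF *; rewrite !ZVP //.
  by apply: Zc nF; rewrite aN bN.
have Zcon u v : connect (fun a b => ce a b && ([set a; b] \notin F)) u v -> ZV u -> ZV v.
  move=> /connectP [p pp ->]; elim: p u pp => [|w p IH] u //= /andP [uw pw] Zu.
  by apply: IH pw _; apply: Zce uw Zu.
have Ze u v : e u v && ([set u; v] \notin F) -> ZV u -> ZV v.
  move=> /andP [euv nF]; case tuv : (te u v); last first.
    by apply: Zcon; apply: cecon => //; rewrite /e' euv tuv.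
  move/asboolP: tuv => [c c0 E]; rewrite E in nF.
  have pN := par_lt T c0; have cN : (c < N)%N by case/andP: c0.
  have Z2 := Zt _ c0 nF.
  by case: (set2_eq E) => -[-> ->]; rewrite !ZVP // Z2.
rewrite -(ZVP y) //; move: con Zx; rewrite -(ZVP x) //.
move=> /connectP [p pp ->]; elim: p (vtx x) pp => [|w p IH] u //= /andP [uw pw] Zu.
by apply: IH pw _; apply: Ze uw Zu.
Qed.

End Clusters.

(** * Search in one cluster *)

Section TreeRun.
Variables (R : realType) (V : finType) (G : wgraph R V) (W : R) (port : V -> V -> nat).
Hypotheses (GW : weights_between G 1 W) (GP : port_numbering G port).
Variables (f : nat) (rho D : R) (Y : {set V}) (C : cluster R V).
Hypotheses (rho0 : 0 <= rho) (CS : cluster_spec G f rho D Y C).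
Variables (F : {set {set V}}).
Hypothesis Ff : (#|F| <= f)%N.

Local Notation N := (csize C).
Local Notation par := (cpar C).
Local Notation sz := (csz C).
Local Notation vtx := (cvtx C).
Local Notation T := (cluster_tree CS).
Local Notation below := (below sz).

(** The up port of number 0 is a dummy, because [par 0] is junk; every number of the tree lies below
    the root, so [next_hop] never climbs from there. *)
Definition table_at x := TreeTable x (sz x)
  (if x == 0%N then 0%N else port (vtx x) (vtx (par x)))
  [seq (d, sz d, port (vtx x) (vtx d)) | d <- iota 1 N.-1 & par d == x]
  (chubs C x)
  [seq (q.1, q.2, port (vtx q.1) (vtx q.2), port (vtx q.2) (vtx q.1))
    | q <- [seq (a, b) | a <- iota 0 N, b <- iota 0 N]
      & ccert C q.1 q.2 && (x \in chubs C q.1)].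

Variables (tn : nat) (fin : bool) (tau : R).
Hypotheses (tnN : (tn < N)%N) (tau0 : 0 <= tau).

Definition linked u v := connect (fun u v => local_adj G Y rho u v && ([set u; v] \notin F)) u v.

Definition tree_edge c : {set V} := [set vtx (par c); vtx c].

Definition known_faults st :=
  [seq tree_edge q.1 | q <- tfaults st] ++ [seq [set vtx q.1; vtx q.2] | q <- cfaults st].

(** The part of the invariant that survives a restart. [fin] marks a scale at which [s] and [t] are
    linked inside the cluster; there the search for [s] never starts. *)
Record base_inv (x : nat) (st : state) : Prop := BaseInv {
  inv_num : (x < N)%N;
  inv_source : (source st < N)%N;
  inv_tree_faults : tree_faults N sz (tfaults st);
  inv_cert_faults : forall q, q \in cfaults st -> ccert C q.1 q.2;
  inv_uniq_faults : uniq (known_faults st);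
  inv_faults : {subset known_faults st <= F};
  inv_linked : linked (vtx x) (vtx (source st));
  inv_fin : fin -> ~~ returning st /\ linked (vtx (source st)) (vtx tn) }.

Definition item_ok st (it : item) :=
  [/\ ccert C (tail_of it.2) (head_of it.2),
      usable (cfaults st) (tail_of it.2) (head_of it.2),
      tail_port it.2 = port (vtx (tail_of it.2)) (vtx (head_of it.2)),
      head_port it.2 = port (vtx (head_of it.2)) (vtx (tail_of it.2)) &
      ~~ it.1 -> has (same_piece (tfaults st) (head_of it.2)) (visited st)].

(** Visited pieces whose exits are not pushed yet, which [inv_explored] must excuse. Under
    [GoTarget] the exits no longer matter, so every piece is excused. *)
Definition exploring x st v :=
  match task st with
  | Enter | GoHub _ => same_piece (tfaults st) x v
  | GoTarget => true
  | Cross (true, e) => same_piece (tfaults st) (head_of e) v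
  | _ => false
  end.

(** As [exploring], but a piece drops out earlier, once [Enter] has found that the target is
    elsewhere. *)
Definition entering x st v :=
  match task st with
  | Enter => same_piece (tfaults st) x v
  | GoTarget => true
  | Cross (true, e) => same_piece (tfaults st) (head_of e) v
  | _ => false
  end.

(** Agenda entries reserved for the piece being entered: its exits, at most one per piece, and one
    more for the way back while the edge is not yet crossed. *)
Definition pending st :=
  match task st with
  | Enter | GoHub _ => (size (tfaults st)).+1
  | Cross (true, _) => (size (tfaults st)).+2
  | _ => 0%N
  end.

Definition task_ok x st :=
  match task st with
  | NewScale => False
  | Enter | Pop => agenda_from (tfaults st) x (agenda st) /\
      has (same_piece (tfaults st) x) (visited st)
  | GoHub g => [/\ agenda_from (tfaults st) x (agenda st),
      has (same_piece (tfaults st) x) (visited st), same_piece (tfaults st) x g, (g < N)%N &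
      forall v, (v < N)%N -> same_piece (tfaults st) x v -> g \in chubs C v]
  | GoTarget => same_piece (tfaults st) x (target_of tn st)
  | Cross it => [/\ item_ok st it, same_piece (tfaults st) x (tail_of it.2),
      agenda_from (tfaults st) (if it.1 then x else head_of it.2) (agenda st),
      has (same_piece (tfaults st) x) (visited st) &
      has (same_piece (tfaults st) (head_of it.2)) (visited st)]
  end.

Record search_inv (x : nat) (st : state) : Prop := SearchInv {
  inv_visited : forall v, v \in visited st -> (v < N)%N;
  inv_visited_uniq : uniq (visited st);
  inv_separated : {in visited st &, forall v w, same_piece (tfaults st) v w -> v = w};
  inv_items : forall it, it \in agenda st -> item_ok st it;
  inv_task : task_ok x st;
  inv_explored : forall v, v \in visited st -> exploring x st v \/
    forall a b, ccert C a b -> usable (cfaults st) a b -> same_piece (tfaults st) v a ->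
      has (same_piece (tfaults st) b) (visited st) \/
      exists2 e, (true, e) \in agenda st & same_piece (tfaults st) b (head_of e);
  inv_target : forall v, v \in visited st -> same_piece (tfaults st) v (target_of tn st) ->
    entering x st v;
  inv_agenda_size : (size (agenda st) + pending st
    <= size (visited st) * (size (tfaults st)).+2)%N }.

Definition tree_inv x st := base_inv x st /\ search_inv x st.

Lemma size_known_faults st :
  size (known_faults st) = (size (tfaults st) + size (cfaults st))%N.
Proof. by rewrite size_cat !size_map. Qed.

Lemma known_faults_le x st : base_inv x st ->
  (size (tfaults st) + size (cfaults st) <= #|F|)%N.
Proof.
move=> B; rewrite -size_known_faults cardE; apply: uniq_leq_size.
  exact: inv_uniq_faults B.
by move=> q /(inv_faults B); rewrite mem_enum.
Qed.

Lemma visited_le x st : tree_inv x st -> (size (visited st) <= (size (tfaults st)).+1)%N.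
Proof.
move=> [B S]; apply: (separated_size T (inv_tree_faults B) (inv_visited S)).
  exact: inv_visited_uniq S.
exact: inv_separated S.
Qed.

Lemma start_inv x st : base_inv x st ->
  tree_inv x (start_state x (scale st) (source st) (returning st) (tfaults st) (cfaults st)).
Proof.
move=> B; split; first by case: B => *; split.
split=> //=.
- by move=> v; rewrite inE => /eqP ->; exact: inv_num B.
- by move=> v w; rewrite !inE => /eqP -> /eqP ->.
- by rewrite /task_ok /= same_piece_refl.
- by move=> v; rewrite inE => /eqP ->; left; rewrite /exploring /= same_piece_refl.
- by move=> v; rewrite inE => /eqP -> _; rewrite /entering /= same_piece_refl.
by rewrite /= mul1n.
Qed.

(* Potential: an upper bound on the remaining length of the walk in this
   cluster, plus [tau] for every remaining step of the algorithm. *)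
Definition depth c : R := cdepth C c + tau * c%:R.

(** Unless [g] is below [x], the way is charged as if through the root. The message may turn around
    earlier, but the bound still drops at each hop by the weight of the edge and [tau]. *)
Definition remaining x g : R := if below x g then depth g - depth x else depth x + depth g.

Definition diam : R := 2 * (D + tau * N%:R).
Definition enter_cost : R := tau + diam + tau * (#|F|%:R + 2).
Definition back_cost : R := diam + rho + 2 * tau.
(** Crossing to a new piece, coming back later, and exploring it. For [tau = 0] and [D = 2 k rho]
    this is [12 k rho + 2 rho]. *)
Definition piece_cost : R := (diam + rho + tau) + back_cost + enter_cost.
Definition attempt_cost (j : nat) : R := 2 * tau + enter_cost + j%:R * piece_cost.

Definition item_cost (it : item) : R := if it.1 then tau else back_cost.
Definition agenda_cost (ag : seq item) : R := \sum_(it <- ag) item_cost it.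

Definition task_cost x st : R :=
  match task st with
  | NewScale | Pop => 0
  | Enter => enter_cost
  | GoHub g => remaining x g + tau * (#|F|%:R + 2)
  | GoTarget => remaining x (target_of tn st) + tau
  | Cross (true, e) => remaining x (tail_of e) + rho + tau + back_cost + enter_cost
  | Cross (false, e) => remaining x (tail_of e) + rho + tau
  end.

(** Savings for restarts: the search that starts with [j] known faults is paid by the summand [j],
    so each new fault releases one summand. *)
Definition future (m : nat) : R := \sum_(m.+1 <= j < #|F|.+1) attempt_cost j.

(** There are at most [size (tfaults st) + 1] pieces, hence the multiple of [piece_cost] for those
    not yet visited. The last summand is saved for the one search for [s], whose number of known
    faults is at most [#|F|]. *)
Definition potential x st : R :=
  tau + task_cost x st + agenda_cost (agenda st)
  + ((size (tfaults st))%:R + 1 - (size (visited st))%:R) * piece_cost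
  + future (size (tfaults st) + size (cfaults st))
  + (if ~~ returning st && ~~ fin then attempt_cost #|F| else 0).

Lemma depth_edge c : (0 < c < N)%N ->
  depth (par c) + wt G (vtx (par c)) (vtx c) + tau <= depth c.
Proof.
move=> c0; have := cluster_depth CS c0; have := dfs_par T c0.
rewrite -(ler_nat R) -natr1 /depth => H1 H2.
have : tau * ((par c)%:R + 1) <= tau * c%:R by rewrite ler_wpM2l.
by lra.
Qed.

Lemma depth_bounds x : (x < N)%N -> 0 <= depth x <= D + tau * N%:R.
Proof.
move=> xN; have /andP [d0 dD] := cluster_depth_bounds CS xN.
have : 0 <= tau * x%:R by rewrite mulr_ge0.
have : tau * x%:R <= tau * N%:R by rewrite ler_wpM2l // ler_nat ltnW.
by rewrite /depth; lra.
Qed.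

Lemma depth_below c x : (c < N)%N -> (x < N)%N -> below c x -> depth c <= depth x.
Proof.
move=> cN; elim/ltn_ind: x => x IH xN cx.
case: (eqVneq c x) => [-> //|nx].
have x0 : (0 < x < N)%N by have := below_le cx; lia.
rewrite (below_edge T x0 cN nx) in cx.
have := IH _ (dfs_par T x0) (par_lt T x0) cx; have := depth_edge x0.
have := wt_ge1 GW (local_adj_adj (cluster_edge CS x0)).
by move: tau0; lra.
Qed.

Lemma remaining_bounds x g : (x < N)%N -> (g < N)%N -> 0 <= remaining x g <= diam.
Proof.
move=> xN gN; have := depth_bounds xN; have := depth_bounds gN.
rewrite /remaining /diam; case: ifP => [/(depth_below xN gN)|_]; lra.
Qed.

Lemma remaining_refl x : (x < N)%N -> remaining x x = 0.
Proof. by move=> xN; rewrite /remaining (below_refl T) // subrr. Qed.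

Lemma costs_ge0 : 0 <= diam /\ 0 <= enter_cost /\ 0 <= back_cost /\ 0 <= piece_cost.
Proof.
have := remaining_bounds (dfs_pos T) (dfs_pos T) => H.
have d0 : 0 <= diam by lra.
have t0 : 0 <= tau * (#|F|%:R + 2) by rewrite mulr_ge0 // addr_ge0.
by move: tau0 rho0; rewrite /piece_cost /back_cost /enter_cost; do ![split]; lra.
Qed.

(** A known fault on the tree path would separate [x] from [g], which share a piece. Hence a failure
    met on the way is always new. *)
Lemma next_hop_spec tf x g : (x < N)%N -> (g < N)%N -> x != g ->
  tree_faults N sz tf -> same_piece tf x g ->
  exists y c, [/\ (y < N)%N, (0 < c < N)%N,
    next_hop (table_at x) g = (c, sz c, port (vtx x) (vtx y)) &
    [/\ [set vtx x; vtx y] = tree_edge c, (c, sz c) \notin tf, same_piece tf x y,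
        local_adj G Y rho (vtx x) (vtx y) &
        remaining y g + wt G (vtx x) (vtx y) + tau <= remaining x g]].
Proof.
move=> xN gN xg TF xgs; rewrite /next_hop /=; case: ifP => [xbg|nxbg].
  have gx : g != x by rewrite eq_sym.
  have [d [d0 dx dg]] := exists_child T xN gN xbg gx.
  set l := [seq q <- _ | _].
  have dl : (d, sz d, port (vtx x) (vtx d)) \in l.
    rewrite mem_filter /= -/(below d g) dg /=; apply/mapP; exists d => //.
    by rewrite mem_filter dx eqxx mem_iota; lia.
  have lall : forall q, q \in l -> q = (d, sz d, port (vtx x) (vtx d)).
    move=> q; rewrite mem_filter => /andP [qg /mapP [e]].
    rewrite mem_filter mem_iota => /andP [/eqP ex eN] Eq; rewrite {}Eq /= in qg *.
    have e0 : (0 < e < N)%N by lia.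
    by rewrite (child_uniq T e0 d0 _ gN qg dg) ?ex ?dx.
  have -> : head (0, 0, 0)%N l = (d, sz d, port (vtx x) (vtx d)).
    by move: (l) dl lall => [//|q l'] _ H; rewrite -(H q) ?mem_head.
  have ndtf : (d, sz d) \notin tf.
    apply/negP => dtf; move/same_pieceP: xgs => /(_ _ dtf).
    by rewrite -/(below d x) -/(below d g) dg -dx (below_par T d0).
  exists d, d; split=> //; first by case/andP: d0.
  split=> //; rewrite -?dx //.
  - by rewrite same_piece_sym; exact (same_piece_par T TF d0 ndtf).
  - exact (cluster_edge CS d0).
  have := depth_edge d0; rewrite dx /remaining -/(below x g) in xbg *.
  by rewrite xbg dg; lra.
have x0 : (0 < x < N)%N.
  rewrite xN andbT lt0n; apply: contraFN nxbg => /eqP ->.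
  exact (below_root T gN).
have nxtf : (x, sz x) \notin tf.
  apply/negP => xtf; move/same_pieceP: xgs => /(_ _ xtf).
  by rewrite nxbg -/(below x x) (below_refl T).
exists (par x), x; split=> //; first exact (par_lt T x0).
  by case: eqVneq x0 => [->|].
split=> //.
- by rewrite /tree_edge setUC.
- exact (same_piece_par T TF x0 nxtf).
- by rewrite local_adj_sym; exact (cluster_edge CS x0).
have := depth_edge x0; rewrite /remaining -/(below x g) in nxbg *.
rewrite nxbg wt_sym; have := depth_bounds (par_lt T x0).
by case: ifP => _; lra.
Qed.

Lemma tree_edge_inj c d : (0 < c < N)%N -> (0 < d < N)%N -> tree_edge c = tree_edge d -> c = d.
Proof.
move=> c0 d0 E; have I := cluster_inj CS.
have [cN dN] : (c < N)%N /\ (d < N)%N by lia.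
have pc := par_lt T c0; have pd := par_lt T d0.
case: (set2_eq E) => -[E1 E2]; first by apply: I E2.
have := I _ _ pc dN E1; have := I _ _ cN pd E2.
by have := dfs_par T c0; have := dfs_par T d0; lia.
Qed.

Lemma base_tree_fault x i src ret tf cf vis ag j c :
  base_inv x (State i src ret tf cf vis ag j) -> (0 < c < N)%N ->
  (c, sz c) \notin tf -> tree_edge c \in F ->
  base_inv x (start_state x i src ret ((c, sz c) :: tf) cf).
Proof.
move=> [/= xN sN TF CF U KF L Fi] c0 nc cF; split=> //=.
- by move=> q; rewrite inE => /predU1P [->|/TF].
- rewrite U andbT mem_cat negb_or; apply/andP; split; apply/mapP => -[q qin E].
    have [q0 q2] := TF _ qin; have Eq := tree_edge_inj c0 q0 E.
    by case/negP: nc; rewrite Eq -q2 -surjective_pairing.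
  have [_ _ _ /(_ _ c0)] := cluster_cert CS (CF _ qin).
  by rewrite -E.
by move=> e; rewrite inE => /predU1P [->|/KF].
Qed.

Lemma base_cert_fault x i src ret tf cf vis ag j a b :
  base_inv x (State i src ret tf cf vis ag j) -> ccert C a b ->
  usable cf a b -> [set vtx a; vtx b] \in F ->
  base_inv x (start_state x i src ret tf ((a, b) :: cf)).
Proof.
move=> [/= xN sN TF CF U KF L Fi] cab /andP [ab ba] abF; split=> //=.
- by move=> q; rewrite inE => /predU1P [->|/CF].
- rewrite /known_faults uniq_catC /= uniq_catC U andbT mem_cat negb_or andbC.
  apply/andP; split; apply/mapP => -[q qin E].
    have [_ _ _ /(_ q.1)] := cluster_cert CS cab.
    by have [q0 _] := TF _ qin; move=> /(_ q0); rewrite -/(tree_edge _) -E.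
  have [aN bN _ _] := cluster_cert CS cab.
  have [qaN qbN _ _] := cluster_cert CS (CF _ qin).
  have I := cluster_inj CS.
  case: (set2_eq E) => -[/I Ea /I Eb]; move: (Ea aN) (Eb bN).
    by move=> /(_ qaN) E1 /(_ qbN) E2; rewrite E1 E2 -surjective_pairing qin in ab.
  by move=> /(_ qbN) E1 /(_ qaN) E2; rewrite E1 E2 -surjective_pairing qin in ba.
move=> e; rewrite mem_cat /= inE orbCA => /predU1P [->//|H].
by apply: KF; rewrite mem_cat.
Qed.

(** The search data mention the position only through its piece. *)
Lemma search_move x y st : (y < N)%N -> same_piece (tfaults st) x y ->
  search_inv x st -> search_inv y st.
Proof.
move=> yN xy [S1 S2 S3 S4 S5 S6 S7 S8].
have E z : same_piece (tfaults st) y z = same_piece (tfaults st) x z.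
  by rewrite (same_piecel _ xy).
have EH : has (same_piece (tfaults st) y) (visited st)
        = has (same_piece (tfaults st) x) (visited st) by apply: eq_has.
have EA ag : agenda_from (tfaults st) y ag = agenda_from (tfaults st) x ag.
  by rewrite (agenda_from_eq _ xy).
split=> //.
- move: S5; rewrite /task_ok; case: (task st) => //.
  + by rewrite EH EA.
  + move=> g [H1 H2 H3 H4 H5]; split; rewrite ?EH ?EA ?E // => v vN.
    by rewrite E; apply: H5.
  + by rewrite E.
  + by rewrite EH EA.
  by move=> [k e] /=; rewrite EH E; case: k; rewrite ?EA.
- by move=> v /S6; rewrite /exploring; case: (task st) => //; rewrite ?E.
by move=> v vv /(S7 _ vv); rewrite /entering; case: (task st); rewrite ?E.
Qed.

Definition step_ok x st (o : outcome) : Prop :=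
  match o with
  | Finish => ~~ returning st /\ x = tn
  | Internal st' =>
      [/\ st' = scale_state (scale st).+1, returning st, x = source st & tau <= potential x st]
      \/ [/\ tree_inv x st', scale st' = scale st, source st' = source st &
             potential x st' + tau <= potential x st]
  | Send p st' => exists y,
      [/\ adjF G F (vtx x) (vtx y), p = port (vtx x) (vtx y), tree_inv y st' &
       [/\ scale st' = scale st, source st' = source st &
        potential y st' + wt G (vtx x) (vtx y) + tau <= potential x st]]
  end.

Lemma target_lt x st : base_inv x st -> (target_of tn st < N)%N.
Proof. by move=> B; rewrite /target_of; case: ifP => // _; apply: inv_source B. Qed.

Lemma task_cost_ge0 x st : tree_inv x st -> 0 <= task_cost x st.
Proof.
move=> [B S]; have [d0 [e0 [b0 p0]]] := costs_ge0; have xN := inv_num B.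
have t0 : 0 <= tau * (#|F|%:R + 2) by rewrite mulr_ge0 // addr_ge0.
have := inv_task S; rewrite /task_ok /task_cost; case: (task st) => //.
- by move=> g [_ _ _ gN _]; have := remaining_bounds xN gN; lra.
- by have := remaining_bounds xN (target_lt B); move: tau0; lra.
by move=> [[] e] [[/(cluster_cert CS) [aN _ _ _] _ _ _ _] _ _ _ _];
  have := remaining_bounds xN aN; move: tau0 rho0 => /=; lra.
Qed.

Lemma agenda_cost_ge0 ag : 0 <= agenda_cost ag.
Proof.
have [d0 [e0 [b0 p0]]] := costs_ge0.
by apply: sumr_ge0 => -[[] e] _; rewrite /item_cost /=.
Qed.

Lemma attempt_cost_ge0 j : 0 <= attempt_cost j.
Proof.
have [d0 [e0 [b0 p0]]] := costs_ge0; rewrite /attempt_cost.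
have : 0 <= j%:R * piece_cost by rewrite mulr_ge0.
by move: tau0; lra.
Qed.

Lemma potential_ge x st : tree_inv x st ->
  tau + future (size (tfaults st) + size (cfaults st))
  + (if ~~ returning st && ~~ fin then attempt_cost #|F| else 0) <= potential x st.
Proof.
move=> I; have T0 := task_cost_ge0 I; have A0 := agenda_cost_ge0 (agenda st).
have [d0 [e0 [b0 p0]]] := costs_ge0.
have V1 : 0 <= ((size (tfaults st))%:R + 1 - (size (visited st))%:R) * piece_cost.
  by rewrite mulr_ge0 // subr_ge0 natr1 ler_nat (visited_le I).
by rewrite /potential; lra.
Qed.

Lemma start_potential x i src ret tf cf :
  potential x (start_state x i src ret tf cf)
  = tau + enter_cost + (size tf)%:R * piece_cost + future (size tf + size cf)
    + (if ~~ ret && ~~ fin then attempt_cost #|F| else 0).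
Proof.
by rewrite /potential /= /agenda_cost big_nil addr0 addrK.
Qed.

Lemma restart_potential x st tf cf :
  base_inv x (start_state x (scale st) (source st) (returning st) tf cf) ->
  tree_inv x st ->
  (size tf + size cf = (size (tfaults st) + size (cfaults st)).+1)%N ->
  potential x (start_state x (scale st) (source st) (returning st) tf cf) + tau
    <= potential x st.
Proof.
move=> B I E; apply: le_trans (potential_ge I).
have := known_faults_le B; rewrite start_potential /= E; set m := (_ + _)%N => mF.
rewrite {2}/future big_ltn // -/(future m.+1) /attempt_cost.
have [d0 [e0 [b0 p0]]] := costs_ge0.
have : (size tf)%:R * piece_cost <= m.+1%:R * piece_cost.
  by rewrite ler_wpM2r // ler_nat -E leq_addr.
by move: tau0; lra.
Qed.

Lemma move_to_ok x g st : tree_inv x st -> (g < N)%N ->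
  same_piece (tfaults st) x g -> x != g ->
  (forall y, task_cost y st - remaining y g = task_cost x st - remaining x g) ->
  step_ok x st (move_to (table_at x) (failed_ports G port F (vtx x)) g st).
Proof.
move=> I gN xg nxg Hc; have [B S] := I; have xN := inv_num B.
have [y [c [yN c0 nh [Ec nc xy xya ry]]]] := next_hop_spec xN gN nxg (inv_tree_faults B) xg.
have axy := local_adj_adj xya.
rewrite /move_to nh mem_failed_ports // Ec; case: ifP => cF.
  have B' : base_inv x (start_state x (scale st) (source st) (returning st)
      ((c, sz c) :: tfaults st) (cfaults st)).
    case: st B nc {I S xg Hc xy} => i src ret tf cf vis ag j B nc.
    exact: (base_tree_fault B c0 nc cF).
  right; split=> //; first exact: start_inv B'.
  exact: restart_potential.
exists y; split=> //; first by rewrite /adjF axy Ec cF.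
  split; last exact: search_move xy S.
  have Ls := inv_linked B; case: B => *; split=> //.
  apply: connect_trans Ls; apply: connect1.
  by rewrite local_adj_sym xya setUC Ec cF.
split=> //; have := Hc y; rewrite /potential.
by lra.
Qed.

Lemma item_ok_sub st st' it : tfaults st' = tfaults st -> cfaults st' = cfaults st ->
  {subset visited st <= visited st'} -> item_ok st it -> item_ok st' it.
Proof.
move=> Et Ec sv [H1 H2 H3 H4 H5]; split=> //; rewrite ?Et ?Ec // => /H5 /hasP [v vv vb].
by apply/hasP; exists v => //; apply: sv.
Qed.

(** * Each kind of step: invariants and decrease of the potential *)

Lemma tau_faults_ge0 : 0 <= tau * #|F|%:R.
Proof. by rewrite mulr_ge0. Qed.

Lemma enter_ok x i src ret tf cf vis ag :
  let st := State i src ret tf cf vis ag Enter in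
  tree_inv x st ->
  step_ok x st (tree_step (table_at x) tn (failed_ports G port F (vtx x)) st).
Proof.
move=> st I; have [B S] := I; have xN := inv_num B; have gN := target_lt B.
have [d0 [e0 [b0 p0]]] := costs_ge0; have tF := tau_faults_ge0.
case: (S) => S1 S2 S3 S4 S5 S6 S7 S8.
rewrite /tree_step [t_num _]/= [t_hubs _]/=; right; case: ifP => xt.
  split=> //; first split; first by case: B => *; split.
    split=> //; first by move=> v _; left.
    by apply: leq_trans S8; rewrite leq_add2l.
  have := remaining_bounds xN gN; rewrite /potential /task_cost /= /enter_cost.
  by move: tau0; lra.
(* The first hub of [x] inside its piece is, by [cluster_hubs], a hub of every vertex of the piece,
   so it stores all certificate edges leaving the piece. *)
have [z [Ez [zN [xz Hz]]]] : exists z,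
    head 0%N (filter (same_piece tf x) (chubs C x)) = z /\
    (z < N)%N /\ same_piece tf x z /\
    forall v, (v < N)%N -> same_piece tf x v -> z \in chubs C v.
  have cv := same_piece_convex T (inv_tree_faults B) xN.
  have := cluster_hubs CS cv (fun v H => proj1 (andP H)) (x := x).
  rewrite xN same_piece_refl => /(_ isT) /= [+ H].
  have -> : [seq y <- chubs C x | (y < N)%N && same_piece tf x y]
          = [seq y <- chubs C x | same_piece tf x y].
    by apply: eq_in_filter => y /(cluster_hubs_lt CS) ->.
  move=> /andP [zN xz]; eexists; split; first by [].
  split=> //; split=> // v vN xv; have := H v; rewrite vN xv => /(_ isT).
  rewrite (_ : [seq y <- chubs C x | (y < N)%N && same_piece tf x y]
          = [seq y <- chubs C x | same_piece tf x y]) //.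
  by apply: eq_in_filter => y /(cluster_hubs_lt CS) ->.
rewrite Ez; split=> //.
  split; first by case: B => *; split.
  split=> //.
  - by case: S5.
  - move=> v vv vt; have := S7 v vv vt; rewrite /entering /= => xv.
    by rewrite -(same_piecel _ xv) xt in vt.
have := remaining_bounds xN zN; rewrite /potential /task_cost /= /enter_cost.
by move: tau0; lra.
Qed.

Lemma mem_exits x st e : (x < N)%N -> e \in exits (table_at x) st ->
  item_ok st (true, e) /\ same_piece (tfaults st) x (tail_of e).
Proof.
move=> xN /one_per_piece_sub; rewrite mem_filter => /andP [/andP [xe ue] /mapP [q]].
rewrite mem_filter => /andP [/andP [cq _] _] E.
by move: xe ue; rewrite E /tail_of /head_of /=.
Qed.

Lemma size_exits x st : tree_inv x st ->
  (size (exits (table_at x) st) <= (size (tfaults st)).+1)%N.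
Proof.
move=> [B S]; have [U Sep] := one_per_piece_separated (tfaults st)
  [seq e <- t_cert (table_at x) | same_piece (tfaults st) x (tail_of e)
                         && usable (cfaults st) (tail_of e) (head_of e)].
rewrite -(size_map head_of); apply: (separated_size T (inv_tree_faults B)) => // v.
move=> /mapP [e /(mem_exits (inv_num B)) [[/(cluster_cert CS) [_ bN _ _] _ _ _ _] _] ->].
exact: bN.
Qed.

Lemma exits_cover x st a b : (x < N)%N -> ccert C a b -> usable (cfaults st) a b ->
  x \in chubs C a -> same_piece (tfaults st) x a ->
  exists2 e, e \in exits (table_at x) st & same_piece (tfaults st) b (head_of e).
Proof.
move=> xN cab uab xa sxa; have [aN bN _ _] := cluster_cert CS cab.
pose e : pedge := (a, b, port (vtx a) (vtx b), port (vtx b) (vtx a)).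
suff /one_per_piece_cover H : e \in [seq e <- t_cert (table_at x) |
     same_piece (tfaults st) x (tail_of e) && usable (cfaults st) (tail_of e) (head_of e)].
  by case/hasP: (H (tfaults st)) => e' He' se'; exists e'.
rewrite mem_filter /= sxa uab /=; apply/mapP; exists (a, b) => //.
rewrite mem_filter /= cab xa /=; apply/allpairsP; exists (a, b).
by rewrite !mem_iota !add0n aN bN.
Qed.

Lemma go_hub_ok x i src ret tf cf vis ag g :
  let st := State i src ret tf cf vis ag (GoHub g) in
  tree_inv x st ->
  step_ok x st (tree_step (table_at x) tn (failed_ports G port F (vtx x)) st).
Proof.
move=> st I; have [B S] := I; have xN := inv_num B.
have [d0 [e0 [b0 p0]]] := costs_ge0; have tF := tau_faults_ge0.
case: (S) => S1 S2 S3 S4 S5 S6 S7 S8.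
have [af hx xg gN hubs] := S5.
rewrite /tree_step /=; case: eqVneq => [Exg|nxg]; last first.
  by apply: move_to_ok => //= y; rewrite /task_cost /=; lra.
rewrite -Exg in hubs.
have SE := size_exits I; have KF := known_faults_le B.
right; split=> //.
  split; first by case: B => *; split.
  split=> //.
  - move=> it; rewrite mem_cat => /orP [/mapP [e He ->]|/S4]; last exact: item_ok_sub.
    by have [+ _] := mem_exits xN He; apply: item_ok_sub.
  - rewrite /task_ok /= agenda_from_cat // => e He.
    by have [_ +] := mem_exits xN He.
  (* For the current piece the hub supplies the exits; for other visited pieces the earlier
     guarantee persists, as the agenda only grows. *)
  - move=> v vv; right => a b cab uab va.
    case: (S6 v vv) => [|/(_ a b cab uab va) [|[e eag be]]]; last 2 first.
    + by left.
    + by right; exists e => //; rewrite mem_cat eag orbT.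
    rewrite /exploring /= => xv; right.
    have xa : same_piece tf x a by apply: same_piece_trans va.
    have [aN bN _ _] := cluster_cert CS cab.
    have [|e eex be] := exits_cover (st := st) xN cab uab _ xa; first exact: hubs.
    by exists e => //; rewrite mem_cat; apply/orP; left; apply/mapP; exists e.
  by apply: leq_trans S8; rewrite /= size_cat size_map addn0 addnC leq_add2l.
rewrite /potential /task_cost /= -Exg remaining_refl // /agenda_cost big_cat /=.
have -> : \sum_(it <- [seq (true, e) | e <- exits (table_at x) st]) item_cost it
   = tau * (size (exits (table_at x) st))%:R.
  by rewrite big_map big_const_seq count_predT iter_addr addr0 mulr_natr.
have : tau * (size (exits (table_at x) st))%:R <= tau * (#|F|%:R + 1).
  rewrite ler_wpM2l // natr1 ler_nat; apply: (leq_trans SE); rewrite ltnS.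
  by apply: leq_trans KF; rewrite leq_addr.
by lra.
Qed.

Lemma go_target_ok x i src ret tf cf vis ag :
  let st := State i src ret tf cf vis ag GoTarget in
  tree_inv x st ->
  step_ok x st (tree_step (table_at x) tn (failed_ports G port F (vtx x)) st).
Proof.
move=> st I; have [B S] := I; have xN := inv_num B; have xt := inv_task S.
have [d0 [e0 [b0 p0]]] := costs_ge0; have tF := tau_faults_ge0.
rewrite /tree_step /=; case: eqVneq => [Ex|nx]; last first.
  apply: move_to_ok => //; first exact: target_lt B.
  by move=> y; rewrite /task_cost /=; lra.
case Er: ret; last first.
  by split; rewrite /= ?Er //; move: Ex; rewrite /target_of /= Er.
left; split; rewrite /= ?Er //; first by move: Ex; rewrite /target_of /= Er.
apply: le_trans (potential_ge I); rewrite /= Er /= addr0 lerDl.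
by apply: sumr_ge0 => j _; apply: attempt_cost_ge0.
Qed.

(** With an empty agenda the visited pieces are closed under surviving tree and certificate edges,
    so they contain everything linked to [x]. None holds the target, since [inv_target] would make
    it [entering], which is impossible during [Pop]. *)
Lemma pop_closed x i src ret tf cf vis :
  let st := State i src ret tf cf vis [::] Pop in
  tree_inv x st -> forall w, (w < N)%N -> linked (vtx x) (vtx w) ->
  ~~ same_piece tf w (target_of tn st).
Proof.
move=> st [B S] w wN xw; have xN := inv_num B.
case: (S) => S1 S2 S3 S4 [_ hx] S6 S7 S8.
pose Z y := has (same_piece tf y) vis.
have kfF e : e \in known_faults st -> e \in F by apply: (inv_faults B).
have /hasP [v vv wv] : Z w.
  apply: (cluster_closed CS Ff (Z := Z)) xw hx => //.
    move=> c c0 cF; apply: eq_has => v; apply: same_piecel.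
    apply: (same_piece_par T (inv_tree_faults B) c0).
    apply: contra cF => ctf; apply: kfF; rewrite mem_cat; apply/orP; left.
    by apply/mapP; exists (c, sz c).
  move=> a b cab abF /hasP [v vv av].
  have uab : usable cf a b.
    apply/andP; split; apply: contra abF => abcf; apply: kfF; rewrite mem_cat;
      apply/orP; right; apply/mapP.
      by exists (a, b).
    by exists (b, a) => //=; rewrite setUC.
  case: (S6 v vv) => // /(_ a b cab uab) [|//|[e]]; last by [].
  by rewrite same_piece_sym.
apply/negP => wt; have := S7 v vv.
by rewrite -(same_piecel _ wv) wt => /(_ isT).
Qed.

(** The search for [s] cannot be exhausted, since the message stays linked to [s]; nor can the
    search for [t] if [fin] holds. What remains is the turn from [t] to [s], paid by the last
    summand of the potential. *)
Lemma pop_nil_ok x i src ret tf cf vis :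
  let st := State i src ret tf cf vis [::] Pop in
  tree_inv x st ->
  step_ok x st (tree_step (table_at x) tn (failed_ports G port F (vtx x)) st).
Proof.
move=> st I; have [B S] := I; have KF := known_faults_le B.
have [d0 [e0 [b0 p0]]] := costs_ge0; have t0 := tau0.
have pc := pop_closed I; have Ls := inv_linked B.
have sN := inv_source B.
rewrite /tree_step /=; case Er: ret.
  have := pc _ sN Ls; rewrite /target_of /= Er => /negP; case.
  exact: same_piece_refl.
have nfin : fin = false.
  apply/negP => /(inv_fin B) [_ Lt].
  have := pc _ tnN (connect_trans Ls Lt); rewrite /target_of /= Er => /negP; case.
  exact: same_piece_refl.
have B' : base_inv x (start_state x i src true tf cf).
  by case: B => *; split=> //; rewrite nfin.
right; split=> //; first exact: start_inv B'.
apply: le_trans (potential_ge I).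
rewrite start_potential nfin /= Er /= /attempt_cost.
have : (size tf)%:R * piece_cost <= #|F|%:R * piece_cost.
  rewrite ler_wpM2r // ler_nat; apply: leq_trans KF; exact: leq_addr.
by lra.
Qed.

Lemma pop_try_ok x i src ret tf cf vis e ag :
  let st := State i src ret tf cf vis ((true, e) :: ag) Pop in
  tree_inv x st ->
  step_ok x st (tree_step (table_at x) tn (failed_ports G port F (vtx x)) st).
Proof.
move=> st I; have [B S] := I; have xN := inv_num B.
have [d0 [e0 [b0 p0]]] := costs_ge0; have t0 := tau0.
case: (S) => S1 S2 S3 S4 [/= /andP [xe af] hx] S6 S7 S8.
have ie : item_ok st (true, e) by apply: S4; rewrite mem_head.
have S4' it : it \in ag -> item_ok st it.
  by move=> iag; apply: S4; rewrite inE iag orbT.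
have [/(cluster_cert CS) [aN bN _ _] _ _ _ _] := ie.
have P6 v a b : v \in vis -> ccert C a b -> usable cf a b -> same_piece tf v a ->
    has (same_piece tf b) vis \/ same_piece tf b (head_of e) \/
    exists2 e', (true, e') \in ag & same_piece tf b (head_of e').
  move=> vv cab uab va; case: (S6 v vv) => // /(_ a b cab uab va) [|[e' + be']]; first by left.
  rewrite inE => /predU1P [[Ee]|e'ag]; last by right; right; exists e'.
  by right; left; rewrite -Ee.
rewrite /tree_step /=; case: ifP => [eh|/negbT nh]; right; split=> //.
- split; first by case: B => *; split.
  split=> //.
  + move=> v vv; right=> a b cab uab va; case: (P6 v a b vv cab uab va) => [|[be|]].
    * by left.
    * by left; apply: sub_has eh => w; apply: same_piece_trans.
    * by right.
  by apply: leq_trans S8; rewrite leq_add2r leqnSn.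
- by rewrite /potential /task_cost /= /agenda_cost big_cons /item_cost /=; lra.
- split; first by case: B => *; split.
  have sv : {subset vis <= head_of e :: vis} by move=> v vv; rewrite inE vv orbT.
  split.
  + by move=> v /=; rewrite inE => /predU1P [->|/S1].
  + rewrite /= S2 andbT; apply: contra nh => /= ev; apply/hasP; exists (head_of e) => //.
    exact: same_piece_refl.
  + have nhv v : v \in vis -> same_piece tf (head_of e) v -> False.
      by move=> vv ev; case/negP: nh; apply/hasP; exists v.
    move=> v w /=; rewrite !inE => /predU1P [->|vv] /predU1P [->|wv] //.
    * by move/(nhv _ wv).
    * by rewrite same_piece_sym => /(nhv _ vv).
    * exact: S3.
  + by move=> it iag; apply: item_ok_sub (S4' it iag).
  + split=> //=.
    * exact: item_ok_sub ie.
    * by rewrite hx orbT.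
    * by rewrite same_piece_refl.
  + move=> v /=; rewrite inE => /predU1P [->|vv].
      by left; rewrite /exploring /= same_piece_refl.
    right=> a b cab uab va; case: (P6 v a b vv cab uab va) => [Hb|[be|]].
    * by left; rewrite /= Hb orbT.
    * by left; rewrite /= be.
    * by right.
  + move=> v /=; rewrite inE => /predU1P [-> _|vv vt].
      by rewrite /entering /= same_piece_refl.
    by have := S7 v vv vt.
  rewrite /pending /= addnC mulSn leq_add2l.
  by apply: leq_trans S8; rewrite /= addn0 leqnSn.
have RB := remaining_bounds xN aN.
rewrite /potential /task_cost /= /agenda_cost big_cons /item_cost /= -natr1.
rewrite -/(agenda_cost _).
(* The newly visited piece releases one [piece_cost], which pays for the crossing, the way back and
   the exploration. *)
have -> : ((size tf)%:R + 1 - ((size vis)%:R + 1)) * piece_cost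
        = ((size tf)%:R + 1 - (size vis)%:R) * piece_cost - piece_cost by ring.
have : piece_cost = (diam + rho + tau) + back_cost + enter_cost by [].
by lra.
Qed.

Lemma pop_back_ok x i src ret tf cf vis e ag :
  let st := State i src ret tf cf vis ((false, e) :: ag) Pop in
  tree_inv x st ->
  step_ok x st (tree_step (table_at x) tn (failed_ports G port F (vtx x)) st).
Proof.
move=> st I; have [B S] := I; have xN := inv_num B.
have [d0 [e0 [b0 p0]]] := costs_ge0; have t0 := tau0.
case: (S) => S1 S2 S3 S4 [/= /andP [xe af] hx] S6 S7 S8.
have ie : item_ok st (false, e) by apply: S4; rewrite mem_head.
have S4' it : it \in ag -> item_ok st it.
  by move=> iag; apply: S4; rewrite inE iag orbT.
have [/(cluster_cert CS) [aN bN _ _] _ _ _ eh] := ie.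
have RB := remaining_bounds xN aN.
right; split=> //.
  split; first by case: B => *; split.
  split=> //=.
  - by split=> //; exact: eh.
  by apply: leq_trans S8; rewrite leq_add2r leqnSn.
rewrite /potential /task_cost /= /agenda_cost big_cons /item_cost /=.
by rewrite /back_cost; lra.
Qed.

Lemma cross_ok x i src ret tf cf vis ag it :
  let st := State i src ret tf cf vis ag (Cross it) in
  tree_inv x st ->
  step_ok x st (tree_step (table_at x) tn (failed_ports G port F (vtx x)) st).
Proof.
case: it => k e st I; have [B S] := I; have xN := inv_num B.
have [d0 [e0 [b0 p0]]] := costs_ge0; have t0 := tau0.
case: (S) => S1 S2 S3 S4 [/= ie xe af hx he] S6 S7 S8.
have [cab uab pa pb bk] := ie.
have [aN bN lab nab] := cluster_cert CS cab.
rewrite /tree_step /=; case: eqVneq => [Ex|nx]; last first.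
  by apply: move_to_ok => // y; rewrite /task_cost /=; case: (k); lra.
have ab := local_adj_adj lab.
rewrite /= in cab uab pa pb lab nab ab.
rewrite -Ex in cab uab pa pb lab ab.
rewrite -Ex pa mem_failed_ports //; case: ifP => eF.
  have B' := base_cert_fault B cab uab eF.
  right; split=> //; first exact: start_inv B'.
  by apply: (restart_potential (st := st) B' I); rewrite /= addnS.
have B' st' : source st' = src -> returning st' = ret -> tfaults st' = tf ->
    cfaults st' = cf -> base_inv (head_of e) st'.
  case: st' => ? ? ? ? ? ? ? ? /= -> -> -> ->.
  have Ls := inv_linked B; case: B => *; split=> //.
  apply: connect_trans Ls; apply: connect1.
  by rewrite local_adj_sym lab setUC eF.
have wtr : wt G (vtx x) (vtx (head_of e)) <= rho by case/and4P: lab.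
have RB := remaining_refl xN.
exists (head_of e); split=> //; first by rewrite /adjF ab eF.
  split; first by case: (k); apply: B'.
  move: S6 S7 S8 af bk; rewrite /exploring /entering /pending /=.
  case: (k) => S6 S7 S8 af bk.
    split=> //=.
    - move=> it; rewrite inE => /predU1P [->|/S4]; last exact: item_ok_sub.
      split; rewrite /= /tail_of /head_of /= -/(head_of e) -/(tail_of e) -?Ex //.
      + by rewrite (cluster_cert_sym CS).
      + by rewrite /usable andbC.
    - by rewrite /task_ok /= /tail_of /head_of /= same_piece_refl -Ex.
    by apply: leq_trans S8; rewrite /pending /= addSnnS.
  by split.
split; [by case: (k)|by case: (k)|]; rewrite /st /potential /task_cost /=.
by case: (k); rewrite /= -?Ex ?/agenda_cost ?big_cons ?/item_cost /= RB; lra.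
Qed.

Lemma tree_step_ok x st : tree_inv x st ->
  step_ok x st (tree_step (table_at x) tn (failed_ports G port F (vtx x)) st).
Proof.
case: st => i src ret tf cf vis ag [|||||it] I.
- by case: I => _ /inv_task.
- exact: enter_ok.
- exact: go_hub_ok.
- exact: go_target_ok.
- case: ag I => [|[[] e] ag] I.
  + exact: pop_nil_ok.
  + exact: pop_try_ok.
  + exact: pop_back_ok.
exact: cross_ok.
Qed.

End TreeRun.

(** * Search over all scales *)

Section Scheme.
Variables (R : realType) (V : finType) (G : wgraph R V) (W : R) (port : V -> V -> nat).
Hypotheses (GW : weights_between G 1 W) (GP : port_numbering G port).
Variables (f ns : nat) (rho D : nat -> R) (Y : nat -> V -> {set V}) (home : nat -> V -> V).
Variable C : nat -> V -> cluster R V.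
Hypothesis rho0 : forall i, 0 <= rho i.
Hypothesis CS : forall i v, Y i v != set0 -> cluster_spec G f (rho i) (D i) (Y i v) (C i v).
Hypothesis home_mem : forall i t, t \in Y i (home i t).

Definition cnum i v u := index u [seq cvtx (C i v) x | x <- iota 0 (csize (C i v))].

Lemma mem_neq0 i v u : u \in Y i v -> Y i v != set0.
Proof. by move=> H; apply/set0Pn; exists u. Qed.

Lemma cnumP i v u : u \in Y i v ->
  (cnum i v u < csize (C i v))%N /\ cvtx (C i v) (cnum i v u) = u.
Proof.
move=> uY; have S := CS (mem_neq0 uY).
have [/(_ uY) [x xN Ex] _] := cluster_mem S u.
have us : u \in [seq cvtx (C i v) x | x <- iota 0 (csize (C i v))].
  by rewrite -Ex map_f // mem_iota.
have lt : (cnum i v u < csize (C i v))%N.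
  by move: us; rewrite -index_mem size_map size_iota.
split=> //; have := nth_index u us.
by rewrite (nth_map 0%N) ?size_iota // nth_iota.
Qed.

Lemma cnumK i v x : Y i v != set0 -> (x < csize (C i v))%N -> cnum i v (cvtx (C i v) x) = x.
Proof.
move=> Y0 xN; have S := CS Y0.
have uY : cvtx (C i v) x \in Y i v by apply/(cluster_mem S); exists x.
have [lt E] := cnumP uY.
exact: (cluster_inj S) E.
Qed.

Definition rank (u : V) : nat := enum_rank u.

Lemma rank_inj : injective rank.
Proof. by move=> u v /ord_inj /enum_rank_inj. Qed.

Definition scheme_clusters : seq (nat * V) := [seq (i, v) | i <- iota 0 ns, v <- enum V].

Definition scheme_table (u : V) : vertex_table :=
  (rank u, [seq (q.1, rank q.2, table_at port (C q.1 q.2) (cnum q.1 q.2 u))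
            | q <- scheme_clusters & u \in Y q.1 q.2]).

Definition scheme_label (t : V) : vertex_label :=
  (rank t, [seq (rank (home i t), cnum i (home i t) t) | i <- iota 0 ns]).

Lemma lookup_scheme u i v : (i < ns)%N ->
  lookup (scheme_table u) (i, rank v) =
  if u \in Y i v then Some (table_at port (C i v) (cnum i v u)) else None.
Proof.
move=> ins; rewrite /lookup /scheme_table /=.
rewrite filter_map -map_comp -filter_predI.
rewrite (eq_filter (a2 := fun q => (q == (i, v)) && (u \in Y i v))); last first.
  move=> [j w] /=; rewrite !xpair_eqE (inj_eq rank_inj).
  by case: eqP => [->|//]; case: eqP => [->|//].
case: ifP => uY; last first.
  rewrite (eq_filter (a2 := pred0)) ?filter_pred0 // => q.
  by rewrite andbF.
rewrite (eq_filter (a2 := pred1 (i, v))); last by move=> q; rewrite andbT.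
have U : uniq scheme_clusters.
  by apply: allpairs_uniq; rewrite ?iota_uniq ?enum_uniq // => -[a b] [c d].
have M : (i, v) \in scheme_clusters.
  by apply/allpairsP; exists (i, v); rewrite mem_iota mem_enum.
by rewrite (filter_pred1_uniq U M).
Qed.

Section Run.
Variables (F : {set {set V}}) (s t : V) (good : nat).
Hypothesis Ff : (#|F| <= f)%N.
Hypothesis Hgood : (good < ns)%N -> s \in Y good (home good t) /\
  linked G (rho good) (Y good (home good t)) F s t.

Local Notation Ch i := (C i (home i t)).
Local Notation Yh i := (Y i (home i t)).
Local Notation num i u := (cnum i (home i t) u).
Local Notation isgood i := ((i == good) && (good < ns)%N).
Local Notation vstep u st :=
  (vertex_step (scheme_table u) (scheme_label t) (failed_ports G port F u) st).

Definition run_inv (u : V) (st : state) : Prop :=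
  if task st is NewScale then
    [/\ st = scale_state (scale st), u = s & (scale st <= ns)%N]
  else let i := scale st in
    [/\ (i < ns)%N, s \in Yh i, u \in Yh i, source st = num i s &
        tree_inv G port (rho i) (Yh i) (Ch i) F (num i t) (isgood i) (num i u) st].

(** At the good scale no search for [s] takes place, so its cost is left out. *)
Definition scale_cost (tau : R) i : R :=
  2 * tau + enter_cost (D i) (Ch i) F tau + future (rho i) (D i) (Ch i) F tau 0
  + (if isgood i then 0 else attempt_cost (rho i) (D i) (Ch i) F tau #|F|).

Definition later tau i : R := \sum_(i <= j < good.+1) scale_cost tau j.

Definition run_potential tau u st : R :=
  if task st is NewScale then later tau (scale st)
  else let i := scale st in
    potential (rho i) (D i) (Ch i) F (num i t) (isgood i) tau (num i u) st + later tau i.+1.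

Lemma num_lt i u : u \in Yh i -> (num i u < csize (Ch i))%N.
Proof. by case/cnumP. Qed.

Lemma home_spec i : cluster_spec G f (rho i) (D i) (Yh i) (Ch i).
Proof. exact: CS (mem_neq0 (home_mem i t)). Qed.

Lemma scale_cost_ge0 tau i : 0 <= tau -> 0 <= scale_cost tau i.
Proof.
move=> t0; have tN := num_lt (home_mem i t).
have [_ [e0 _]] := costs_ge0 GW (rho0 i) (home_spec i) Ff tN t0.
have A0 := attempt_cost_ge0 GW (rho0 i) (home_spec i) Ff tN t0.
have F0 : 0 <= future (rho i) (D i) (Ch i) F tau 0 by apply: sumr_ge0.
by rewrite /scale_cost; case: ifP => _; have := A0 #|F|; lra.
Qed.

Lemma later_ge0 tau i : 0 <= tau -> 0 <= later tau i.
Proof. by move=> t0; apply: sumr_ge0 => j _; apply: scale_cost_ge0. Qed.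

Lemma run_potential_ge0 tau u st : 0 <= tau -> run_inv u st -> 0 <= run_potential tau u st.
Proof.
move=> t0; rewrite /run_inv /run_potential.
have tN i := num_lt (home_mem i t).
suff K : forall i, tree_inv G port (rho i) (Yh i) (Ch i) F (num i t) (isgood i) (num i u) st ->
   0 <= potential (rho i) (D i) (Ch i) F (num i t) (isgood i) tau (num i u) st + later tau i.+1.
  by case: (task st) => [_|[_ _ _ _ /K]|g [_ _ _ _ /K]|[_ _ _ _ /K]|[_ _ _ _ /K]|it [_ _ _ _ /K]] //;
     apply: later_ge0.
move=> i I; rewrite addr_ge0 ?later_ge0 //.
have A0 := attempt_cost_ge0 GW (rho0 i) (home_spec i) Ff (tN i) t0.
apply: le_trans (potential_ge GW (rho0 i) (home_spec i) Ff (tN i) t0 I).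
rewrite !addr_ge0 //; first by apply: sumr_ge0.
by case: ifP.
Qed.

Lemma nth_label i : (i < ns)%N ->
  nth (0%N, 0%N) (scheme_label t).2 i = (rank (home i t), num i t).
Proof. by move=> ins; rewrite (nth_map 0%N) ?size_iota // nth_iota. Qed.

Lemma later_step tau i : (i <= good)%N -> later tau i = scale_cost tau i + later tau i.+1.
Proof. by move=> ig; rewrite /later big_ltn. Qed.

Definition run_step_ok tau u st (o : outcome) : Prop :=
  match o with
  | Finish => (good < ns)%N -> (scale st <= good)%N -> u = t
  | Internal st' => run_inv u st' /\ ((good < ns)%N -> (scale st <= good)%N ->
      (scale st' <= good)%N /\ run_potential tau u st' + tau <= run_potential tau u st)
  | Send p st' => exists v, [/\ adjF G F u v, p = port u v, run_inv v st',
      scale st' = scale st &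
      run_potential tau v st' + wt G u v + tau <= run_potential tau u st]
  end.

Lemma run_inv_tree u st : task st <> NewScale -> run_inv u st =
  [/\ (scale st < ns)%N, s \in Yh (scale st), u \in Yh (scale st),
      source st = num (scale st) s &
      tree_inv G port (rho (scale st)) (Yh (scale st)) (Ch (scale st)) F
        (num (scale st) t) (isgood (scale st)) (num (scale st) u) st].
Proof. by rewrite /run_inv; case: (task st). Qed.

Lemma run_potential_tree tau u st : task st <> NewScale -> run_potential tau u st =
  potential (rho (scale st)) (D (scale st)) (Ch (scale st)) F (num (scale st) t)
    (isgood (scale st)) tau (num (scale st) u) st + later tau (scale st).+1.
Proof. by rewrite /run_potential; case: (task st). Qed.

Lemma tree_inv_task i fin x st :
  tree_inv G port (rho i) (Yh i) (Ch i) F (num i t) fin x st -> task st <> NewScale.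
Proof. by case=> _ /inv_task; rewrite /task_ok; case: (task st). Qed.

Lemma new_scale_ok tau i : 0 <= tau -> (i <= ns)%N ->
  run_step_ok tau s (scale_state i) (vstep s (scale_state i)).
Proof.
move=> t0 ins; rewrite /vertex_step [task _]/= [scale _]/=.
have tN := num_lt (home_mem i t).
case: eqP => [/rank_inj -> //|_].
rewrite [size _]size_map size_iota; case: leqP => [nsi|lt].
  by move=> gns /= ig; lia.
rewrite nth_label // lookup_scheme //; case: ifP => sY; last first.
  split; first by rewrite /run_inv /=.
  move=> gns /= ig.
  have ig' : (i < good)%N.
    rewrite ltn_neqAle ig andbT; apply: contraFN sY => /eqP ->.
    by case: (Hgood gns).
  split=> //; rewrite /run_potential /= (later_step _ ig) addrC.
  have tN' := tN; have [_ [e0 _]] := costs_ge0 GW (rho0 i) (home_spec i) Ff tN t0.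
  have A0 := attempt_cost_ge0 GW (rho0 i) (home_spec i) Ff tN t0.
  have F0 : 0 <= future (rho i) (D i) (Ch i) F tau 0 by apply: sumr_ge0.
  by rewrite lerD2r /scale_cost; case: ifP => _; have := A0 #|F|; lra.
have [sN sE] := cnumP sY; have [_ tE] := cnumP (home_mem i t).
rewrite [t_num _]/=.
have B : base_inv G (rho i) (Yh i) (Ch i) F (num i t) (isgood i) (num i s)
    (start_state (num i s) i (num i s) false [::] [::]).
  split=> //=; first exact: connect0.
  move=> /andP [/eqP E gns]; split=> //; rewrite sE tE.
  by move: E gns => ->; case/Hgood.
split.
  rewrite run_inv_tree //=; split=> //.
  exact: (start_inv port B).
move=> gns /= ig; split=> //.
rewrite run_potential_tree //= [run_potential _ _ (scale_state i)]/run_potential /=.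
rewrite (later_step _ ig) start_potential /= /scale_cost mul0r.
by case: (isgood i); rewrite /=; lra.
Qed.

Lemma vertex_step_tree u st : task st <> NewScale -> (scale st < ns)%N ->
  u \in Yh (scale st) ->
  vstep u st = tree_step (table_at port (Ch (scale st)) (num (scale st) u))
    (num (scale st) t) (failed_ports G port F u) st.
Proof.
move=> nt ins uY; rewrite /vertex_step nth_label // lookup_scheme // uY.
by case: (task st) nt.
Qed.

Lemma vertex_step_ok tau u st : 0 <= tau -> run_inv u st ->
  run_step_ok tau u st (vstep u st).
Proof.
move=> t0 I.
have [Ht|nt] : task st = NewScale \/ task st <> NewScale by case: (task st) => *; [left|right..].
  by move: I; rewrite /run_inv Ht => -[-> -> ins]; apply: new_scale_ok.
move: I; rewrite run_inv_tree // => -[ins sY uY Es I].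
have tN := num_lt (home_mem (scale st) t); have B := I.1.
have [xN Eu] := cnumP uY; have [_ tE] := cnumP (home_mem (scale st) t).
have := tree_step_ok GW GP (rho0 _) (home_spec (scale st)) Ff tN t0 I.
rewrite Eu vertex_step_tree //.
case: (tree_step _ _ _ _) => [|st'|p st'] /=.
- by case=> _ E _ _; rewrite -Eu E tE.
- case=> [[E ret Ex tP]|[I' Esc Eso pot]].
    have us : u = s by rewrite -Eu Ex Es; case: (cnumP sY).
    split; first by rewrite /run_inv E.
    move=> gns ig; have ng : scale st != good.
      apply/negP => /eqP E'; have [] := inv_fin B; first by rewrite E' eqxx.
      by rewrite ret.
    have ig' : (scale st < good)%N by rewrite ltn_neqAle ng.
    rewrite E (run_potential_tree tau u nt) /run_potential /=; split=> //.
    by lra.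
  have nt' := tree_inv_task I'.
  rewrite run_inv_tree // !run_potential_tree // Esc Eso.
  by split=> // _ ig; split=> //; lra.
case=> y [au Ep I' [Esc Eso pot]]; have nt' := tree_inv_task I'.
have yN := inv_num I'.1; have Y0 := mem_neq0 uY.
rewrite Eu in au Ep pot; exists (cvtx (Ch (scale st)) y).
have cK := cnumK Y0 yN; split=> //.
  rewrite run_inv_tree // Esc Eso cK; split=> //.
  have [_ H] := cluster_mem (home_spec (scale st)) (cvtx (Ch (scale st)) y).
  by apply: H; exists y.
by rewrite !run_potential_tree // Esc cK; lra.
Qed.

Local Notation table := (fun u => enc_table (scheme_table u)).
Local Notation lbl := (enc_label (scheme_label t)).

Lemma act_route u h : act G port route table F lbl u h =
  action_of (local_run (scheme_table u) (scheme_label t) (failed_ports G port F u)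
    (decode_state h)).
Proof.
by rewrite /act /route (decodeK _ enc_table_inj) (decodeK _ enc_label_inj).
Qed.

Lemma local_run_inv u st o : run_inv u st ->
  local_run (scheme_table u) (scheme_label t) (failed_ports G port F u) st o ->
  exists2 st', run_inv u st' & o = vstep u st'.
Proof.
move=> I Rn; elim: Rn I => {st o} [st _ I|st st' o E _ IH I]; first by exists st.
by have := vertex_step_ok (lexx 0) I; rewrite E => -[/IH].
Qed.

Lemma port_inj u v v' : adjF G F u v -> adjF G F u v' -> port u v = port u v' -> v = v'.
Proof. by move=> /andP [uv _] /andP [uv' _]; have [_] := GP u; apply. Qed.

Lemma occurs_run_inv u h : occurs G port route table F lbl s u h ->
  run_inv u (decode_state h).
Proof.
elim=> {u h} [|u h v h' _ I [uv]]; first by rewrite /run_inv.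
rewrite act_route /action_of; case: pselect => [H|//].
case: cid => o /= /(local_run_inv I) [st Ist ->].
have := vertex_step_ok (lexx 0) Ist; case: (vstep u st) => // p st' [w [uw Ep Iw _ _]].
case=> E <-; rewrite decode_stateK (port_inj uv uw) //.
by rewrite -E.
Qed.

Lemma routed_act_eq u h h' p :
  act G port route table F lbl u h = act G port route table F lbl u h' ->
  routed G port route table F lbl u h p -> routed G port route table F lbl u h' p.
Proof.
move=> E Rn; case: Rn E => {u h p} [u h E E'|u h v h1 p [uv E] Rn E'].
  by apply: routed_deliver; rewrite -E'.
by apply: routed_hop Rn; split; rewrite -?E'.
Qed.

Lemma act_stop u st : (forall st', vstep u st <> Internal st') ->
  act G port route table F lbl u (enc_state st)
  = if vstep u st is Send p st' then Forward p (enc_state st') else Deliver.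
Proof.
move=> H; rewrite act_route decode_stateK /action_of.
have L := local_stop H; case: pselect => [H'|[]]; last by eexists; exact: L.
by case: cid => o /= /(local_run_inj L) <-.
Qed.

(** An internal state, if written into the header, leads to the same action, so the induction over
    steps may treat it as if it had been transmitted. *)
Lemma act_internal u st st' : vstep u st = Internal st' ->
  act G port route table F lbl u (enc_state st')
  = act G port route table F lbl u (enc_state st).
Proof.
move=> E; rewrite !act_route !decode_stateK; congr action_of.
apply/funext => o; apply/propext; split; first exact: local_step E.
move=> Rn; case: Rn E => [{}st H|{}st st'' {}o E Rn]; first by move/H.
by rewrite E => -[<-].
Qed.

(** With [tau = 1] the potential drops by at least one per step and drives the induction; with
    [tau = 0] it drops by at least the weights and bounds the walk. *)
Lemma routed_potential N u st : (good < ns)%N -> run_inv u st -> (scale st <= good)%N ->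
  run_potential 1 u st < N%:R ->
  exists p, [/\ routed G port route table F lbl u (enc_state st) p, last u p = t &
                walk_length G u p <= run_potential 0 u st].
Proof.
move=> gns; elim: N u st => [|N IH] u st I ig.
  by rewrite ltNge (run_potential_ge0 ler01 I).
rewrite -natr1 => lt.
have K1 := vertex_step_ok ler01 I; have K0 := vertex_step_ok (lexx 0) I.
case E: (vstep u st) K1 K0 => [|st'|p st'] /=.
- move=> /(_ gns ig) ut _; exists [::]; split=> //; last exact: run_potential_ge0 I.
  by apply: routed_deliver; rewrite act_stop E.
- case=> I' /(_ gns ig) [ig' P1] [_ /(_ gns ig) [_ P0]].
  have [|p [Rn L Wp]] := IH u st' I' ig'; first by lra.
  exists p; split=> //; last by lra.
  exact: routed_act_eq (act_internal E) Rn.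
case=> v [uv Ep I' Es P1] [v' [uv' Ep' _ _ P0]].
have Ev : v' = v by apply: port_inj uv' uv _; rewrite -Ep -Ep'.
rewrite {}Ev in P0.
have w1 : 1 <= wt G u v by case/andP: uv => /(wt_ge1 GW).
have [||q [Rn L Wq]] := IH v st' I'; first by rewrite Es.
  by lra.
exists (v :: q); split=> //=; last by lra.
by apply: routed_hop Rn; split=> //; rewrite act_stop E // Ep.
Qed.

Lemma routed_scheme : (good < ns)%N ->
  exists p, [/\ routed G port route table F lbl s [::] p, last s p = t &
                walk_length G s p <= later 0 0].
Proof.
move=> gns; have I : run_inv s (scale_state 0) by [].
have P0 := run_potential_ge0 ler01 I.
have [|p [Rn L Wp]] := routed_potential
    (N := (Num.truncn (run_potential 1 s (scale_state 0))).+1) gns I isT.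
  by case/truncn_itv/andP: P0.
exists p; split=> //; apply: routed_act_eq Rn.
by rewrite !act_route decode_stateK.
Qed.

End Run.

(** * Bit lengths of headers, labels and tables *)

Section Sizes.

Local Notation n := #|V|.
(** Every number written is below [n + ns + 7]: vertex numbers, ranks, ports and subtree sizes are
    at most [n], scales at most [ns], task tags below 7. *)
Definition code_size : nat := (trunc_log 2 (n + ns + 7)).*2.+1.
Local Notation b := code_size.

Lemma size_code x : (x < n + ns + 7)%N -> (size (enc_nat x) <= b)%N.
Proof. exact: size_enc_nat. Qed.

Lemma csize_le i v : Y i v != set0 -> (csize (C i v) <= n)%N.
Proof. by move=> /CS S; rewrite (cluster_size S) max_card. Qed.

Lemma port_lt u v : adj G u v -> (port u v < n)%N.
Proof.
move=> uv; have [H _] := GP u; apply: leq_trans (H _ uv) _.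
exact: max_card.
Qed.

Lemma size_enc_pair S T (g : S -> bits) (h : T -> bits) x y :
  size (enc_pair g h (x, y)) = (size (g x) + size (h y))%N.
Proof. by rewrite size_cat. Qed.

Lemma size_enc_pair2 x y : (x < n + ns + 7)%N -> (y < n + ns + 7)%N ->
  (size (enc_pair2 (x, y)) <= b + b)%N.
Proof. by move=> /size_code Hx /size_code Hy; rewrite size_enc_pair leq_add. Qed.

Lemma size_enc_pair3 x y z : (x < n + ns + 7)%N -> (y < n + ns + 7)%N ->
  (z < n + ns + 7)%N -> (size (enc_pair3 (x, y, z)) <= b + b + b)%N.
Proof.
by move=> Hx Hy /size_code Hz; rewrite size_enc_pair leq_add // size_enc_pair2.
Qed.

Lemma size_enc_pedge (e : pedge) : (tail_of e < n + ns + 7)%N -> (head_of e < n + ns + 7)%N ->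
  (tail_port e < n + ns + 7)%N -> (head_port e < n + ns + 7)%N ->
  (size (enc_pedge e) <= b + b + b + b)%N.
Proof.
case: e => [[[x y] z] w] Hx Hy Hz /size_code Hw.
by rewrite size_enc_pair leq_add // size_enc_pair3.
Qed.

Lemma size_enc_item k (e : pedge) : (tail_of e < n + ns + 7)%N -> (head_of e < n + ns + 7)%N ->
  (tail_port e < n + ns + 7)%N -> (head_port e < n + ns + 7)%N ->
  (size (enc_item (k, e)) <= (b + b + b + b).+1)%N.
Proof.
move=> H1 H2 H3 H4; rewrite size_enc_pair add1n ltnS.
exact: size_enc_pedge.
Qed.

(** The agenda dominates, with at most [f.+1 * f.+2] items of four numbers each, by
    [inv_agenda_size] and [visited_le]; the other fields are at most linear in [f]. *)
Lemma size_header (F : {set {set V}}) s t good u st :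
  (#|F| <= f)%N -> run_inv F s t good u st ->
  (size (enc_state st) <= 21 * b.+1 * f.+1 ^ 2)%N.
Proof.
move=> Ff I.
have z7 x : (x <= n + ns)%N -> (x < n + ns + 7)%N by lia.
have c6 x : (x < 7)%N -> (x < n + ns + 7)%N by lia.
suff [S1 S2 S3 [S4 S5 S6 [S7 S8]]] : [/\ (scale st < n + ns + 7)%N,
    (source st < n + ns + 7)%N,
    (size (enc_seq enc_pair2 (tfaults st)) <= (f * (b + b).+1).+1)%N &
    [/\ (size (enc_seq enc_pair2 (cfaults st)) <= (f * (b + b).+1).+1)%N,
    (size (enc_seq enc_nat (visited st)) <= (f.+1 * b.+1).+1)%N,
    (size (enc_seq enc_item (agenda st)) <= (f.+1 * f.+2 * (b + b + b + b).+2).+1)%N &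
    (size (enc_pair2 (task_code (task st)).1) <= b + b)%N /\
    (size (enc_item (task_code (task st)).2) <= (b + b + b + b).+1)%N]].
  have -> : size (enc_state st) = (size (enc_nat (scale st)) + size (enc_nat (source st)) + 1
     + size (enc_seq enc_pair2 (tfaults st)) + size (enc_seq enc_pair2 (cfaults st))
     + size (enc_seq enc_nat (visited st)) + size (enc_seq enc_item (agenda st))
     + (size (enc_pair2 (task_code (task st)).1) + size (enc_item (task_code (task st)).2)))%N.
    by rewrite /enc_state /= /enc_pair /= !size_cat.
  have := size_code S1; have := size_code S2; move: S3 S4 S5 S6 S7 S8; rewrite -mulnn.
  have [P EP] : exists P, (P = b.+1 * f)%N by eexists.
  have [Q EQ] : exists Q, (Q = b.+1 * (f * f))%N by eexists.
  have E1 : (f * (b + b).+1 <= 2 * P)%N.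
    by rewrite EP mulnA mulnC leq_mul2r; apply/orP; right; lia.
  have E2 : (f.+1 * b.+1 = P + b.+1)%N by rewrite EP mulSn addnC mulnC.
  have E3 : (f.+1 * f.+2 * (b + b + b + b).+2 <= 4 * Q + 12 * P + 8 * b.+1)%N.
    apply: (@leq_trans (f.+1 * f.+2 * (4 * b.+1))); first by rewrite leq_mul2l; apply/orP; right; lia.
    by rewrite EP EQ; move: (b.+1) => B; nia.
  have E4 : (21 * b.+1 * (f.+1 * f.+1) = 21 * (Q + 2 * P + b.+1))%N.
    by rewrite EP EQ; move: (b.+1) => B; nia.
  by rewrite E4 E2; lia.
have it0 : (size (enc_item (true, (0, 0, 0, 0)%N)) <= (b + b + b + b).+1)%N.
  by apply: size_enc_item; apply: c6.
have [Ht|nt] : task st = NewScale \/ task st <> NewScale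
  by case: (task st) => *; [left|right..].
  move: I; rewrite /run_inv Ht => -[-> _ ins].
  split; [by apply: z7; apply: leq_trans ins (leq_addl _ _)|exact: (c6 0%N)|by []|].
  by split=> //; split=> //; apply: (@size_enc_pair2 0 0); apply: c6.
move: I; rewrite run_inv_tree // => -[ins sY uY Es I].
have [B S] := I; have CSi := CS (mem_neq0 uY).
have KF := leq_trans (known_faults_le B) Ff; have VL := visited_le CSi I.
have tff : ((size (tfaults st)).+1 <= f.+1)%N := leq_trans (leq_addr _ _) KF.
have cn := csize_le (mem_neq0 uY).
have cN x : (x < csize (C (scale st) (home (scale st) t)))%N -> (x < n + ns + 7)%N.
  by move=> xN; apply: z7; lia.
have item_size it : item_ok port (C (scale st) (home (scale st) t)) st it ->
    (size (enc_item it) <= (b + b + b + b).+1)%N.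
  case: it => k e [/(cluster_cert CSi) [aN bN lab _] _ Ep Ep' _].
  have ab := local_adj_adj lab; have ba := ab; rewrite adj_sym in ba.
  apply: size_enc_item.
  - exact: cN.
  - exact: cN.
  - by rewrite Ep; apply: z7; have := port_lt ab; lia.
  - by rewrite Ep'; apply: z7; have := port_lt ba; lia.
split.
- by apply: z7; lia.
- by apply: cN; apply: inv_source B.
- apply: leq_trans (size_enc_seq_le (c := b + b) _) _.
    move=> [c d] /(inv_tree_faults B) [c0 /= Ed]; have [_ c1] := andP c0.
    apply: size_enc_pair2; first exact: cN.
    have /andP [_ H] := dfs_size (cluster_tree CSi) c1; rewrite Ed; apply: z7.
    exact: leq_trans (leq_trans H (leq_subr _ _)) (leq_trans cn (leq_addr _ _)).
  by rewrite ltnS leq_mul2r; apply/orP; right; exact: leq_trans (leq_addr _ _) KF.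
split.
- apply: leq_trans (size_enc_seq_le (c := b + b) _) _.
    move=> [c d] /(inv_cert_faults B) /(cluster_cert CSi) [aN bN _ _].
    by apply: size_enc_pair2; apply: cN.
  by rewrite ltnS leq_mul2r; apply/orP; right; exact: leq_trans (leq_addl _ _) KF.
- apply: leq_trans (size_enc_seq_le (c := b) _) _.
    by move=> v /(inv_visited S) vN; apply: size_code; apply: cN.
  by rewrite ltnS leq_mul2r; apply/orP; right; exact: leq_trans VL tff.
- apply: leq_trans (size_enc_seq_le (c := (b + b + b + b).+1) _) _.
    by move=> it /(inv_items S); apply: item_size.
  rewrite ltnS leq_mul2r; apply/orP; right.
  apply: leq_trans (leq_trans (leq_addr _ _) (inv_agenda_size S)) _.
  by apply: leq_mul; [exact: leq_trans VL tff|].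
have := inv_task S; rewrite /task_ok; case: (task st) => [//|_|g [_ _ _ gN _]|_|_|it [iok _ _ _ _]];
  split; first [ exact: it0 | exact: item_size
    | apply: (@size_enc_pair2 _ _); [exact: c6|first [exact: c6|exact: cN]] ].
Qed.

Lemma size_label t : (size (enc_label (scheme_label t)) <= 4 * b.+1 * ns.+1)%N.
Proof.
have rn u : (rank u < n + ns + 7)%N.
  by apply: leq_trans (ltn_ord _) _; rewrite -addnA leq_addr.
rewrite /enc_label size_enc_pair.
have := size_code (rn t).
have : (size (enc_seq enc_pair2 [seq (rank (home i t), cnum i (home i t) t) | i <- iota 0 ns])
   <= (ns * (b + b).+1).+1)%N.
  rewrite -{2}(size_iota 0 ns) -(size_map (fun i => (rank (home i t), cnum i (home i t) t))).
  apply: size_enc_seq_le => _ /mapP [i _ ->]; apply: size_enc_pair2 => //.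
  have [lt _] := cnumP (home_mem i t).
  have := csize_le (mem_neq0 (home_mem i t)) => cn; apply: leq_trans lt _.
  by rewrite -addnA; apply: leq_trans cn (leq_addr _ _).
by nia.
Qed.

Local Notation tlog1 := ((trunc_log 2 n).+1).

Lemma size_tree_table i v x : Y i v != set0 -> (x < csize (C i v))%N ->
  (size (enc_tree_table (table_at port (C i v) x)) <=
     (b + b + b).+3 + size (t_kids (table_at port (C i v) x)) * (b + b + b).+1
     + size (chubs (C i v) x) * b.+1
     + size (t_cert (table_at port (C i v) x)) * (b + b + b + b).+1)%N.
Proof.
move=> Y0 xN; have S := CS Y0; have cn := csize_le Y0; have T := cluster_tree S.
have z7 y : (y <= n)%N -> (y < n + ns + 7)%N.
  by move=> yn; rewrite addnS ltnS -addnA; apply: leq_trans yn (leq_addr _ _).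
have cN y : (y < csize (C i v))%N -> (y < n + ns + 7)%N.
  by move=> yN; apply: z7; apply: leq_trans (ltnW yN) cn.
have pN u w : adj G u w -> (port u w < n + ns + 7)%N.
  by move=> uw; apply: z7; apply: ltnW; apply: port_lt.
have szN y : (y < csize (C i v))%N -> (csz (C i v) y < n + ns + 7)%N.
  move=> yN; have /andP [_ H] := dfs_size T yN.
  by apply: z7; apply: leq_trans H (leq_trans (leq_subr _ _) cn).
have -> : size (enc_tree_table (table_at port (C i v) x)) =
   (size (enc_pair3 (x, csz (C i v) x, t_up (table_at port (C i v) x)))
    + size (enc_seq enc_pair3 (t_kids (table_at port (C i v) x)))
    + size (enc_seq enc_nat (chubs (C i v) x))
    + size (enc_seq enc_pedge (t_cert (table_at port (C i v) x))))%N.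
  by rewrite /enc_tree_table /= /enc_pair /= !size_cat.
have H1 : (size (enc_pair3 (x, csz (C i v) x, t_up (table_at port (C i v) x))) <= b + b + b)%N.
  apply: size_enc_pair3; [exact: cN|exact: szN|].
  rewrite /=; case: eqVneq => [_|x0]; first exact: z7.
  apply: pN; have := cluster_edge S (c := x).
  by rewrite lt0n x0 xN local_adj_sym => /(_ isT) /local_adj_adj.
have H2 : (size (enc_seq enc_pair3 (t_kids (table_at port (C i v) x)))
    <= (size (t_kids (table_at port (C i v) x)) * (b + b + b).+1).+1)%N.
  apply: size_enc_seq_le => _ /mapP [d + ->]; rewrite mem_filter mem_iota => /andP [/eqP dx dN].
  have d0 : (0 < d < csize (C i v))%N by lia.
  have [_ dN'] := andP d0.
  apply: size_enc_pair3; [exact: cN|exact: szN|apply: pN].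
  by have := cluster_edge S d0; rewrite dx => /local_adj_adj.
have H3 : (size (enc_seq enc_nat (chubs (C i v) x)) <= (size (chubs (C i v) x) * b.+1).+1)%N.
  by apply: size_enc_seq_le => z /(cluster_hubs_lt S) zN; apply: size_code; apply: cN.
have H4 : (size (enc_seq enc_pedge (t_cert (table_at port (C i v) x)))
    <= (size (t_cert (table_at port (C i v) x)) * (b + b + b + b).+1).+1)%N.
  apply: size_enc_seq_le => _ /mapP [[a c] + ->]; rewrite mem_filter => /andP [/andP [cac _] _].
  have [aN cN' lac _] := cluster_cert S cac.
  have ac := local_adj_adj lac; have ca := ac; rewrite adj_sym in ca.
  by apply: size_enc_pedge; [exact: cN|exact: cN|exact: pN|exact: pN].
by move: H1 H2 H3 H4; move: (size (enc_pair3 _)) (size (enc_seq _ _)) (size (enc_seq _ _))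
  (size (enc_seq _ _)); lia.
Qed.

(** A single table may be large, but in the sum each vertex is the child of at most one parent and
    each certificate edge is stored only at the logarithmically many hubs of its first end. *)
Lemma size_cluster_tables i v : Y i v != set0 ->
  (\sum_(u in Y i v) size (enc_tree_table (table_at port (C i v) (cnum i v u)))
    <= 18 * f.+1 * tlog1 * b.+1 * #|Y i v|)%N.
Proof.
move=> Y0; have S := CS Y0; have T := cluster_tree S; set N := csize (C i v).
have EN : N = #|Y i v| := cluster_size S.
have -> : (\sum_(u in Y i v) size (enc_tree_table (table_at port (C i v) (cnum i v u)))
  = \sum_(0 <= x < N) size (enc_tree_table (table_at port (C i v) x)))%N.
  rewrite big_mkord.
  have EY : Y i v = [set cvtx (C i v) (x : 'I_N) | x : 'I_N].
    apply/setP => u; apply/idP/imsetP => [uY|[x _ ->]].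
      by have [lt E] := cnumP uY; exists (Ordinal lt).
    by have [_ H] := cluster_mem S (cvtx (C i v) x); apply: H; exists x.
  rewrite {1}EY big_imset /=; last first.
    move=> x y _ _ E; apply: val_inj; apply: (cluster_inj S) E; exact: ltn_ord.
  by apply: eq_bigr => x _; rewrite cnumK.
apply: (@leq_trans (\sum_(0 <= x < N) ((b + b + b).+3
     + size (t_kids (table_at port (C i v) x)) * (b + b + b).+1
     + size (chubs (C i v) x) * b.+1
     + size (t_cert (table_at port (C i v) x)) * (b + b + b + b).+1))).
  rewrite !big_mkord; apply: leq_sum => x _; exact: size_tree_table.
rewrite !big_split /= -!big_distrl /= sum_nat_const_nat subn0.
have K1 : (\sum_(0 <= x < N) size (t_kids (table_at port (C i v) x)) <= N)%N.
  apply: (@leq_trans (\sum_(0 <= x < N) count (fun d => true && (x \in [:: cpar (C i v) d]))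
    (iota 1 N.-1))).
    apply: eq_leq; apply: eq_bigr => x _; rewrite size_map size_filter; apply: eq_count => d.
    by rewrite /= inE eq_sym.
  apply: leq_trans (sum_count_mem_le _ _ _ _) _.
  by rewrite big_const_seq iter_addn count_predT size_iota mul1n addn0 leq_pred.
have K2 : (\sum_(0 <= x < N) size (chubs (C i v) x) <= N * tlog1)%N.
  rewrite -[X in (X * _)%N]subn0 -sum_nat_const_nat; apply: leq_sum => x _.
  apply: leq_trans (cluster_hubs_size S x) _; rewrite ltnS.
  by apply: leq_trunc_log; apply: max_card.
have K3 : (\sum_(0 <= x < N) size (t_cert (table_at port (C i v) x)) <= tlog1 * (f.+1.*2 * N))%N.
  pose s := [seq (a, c) | a <- iota 0 N, c <- iota 0 N].
  apply: (@leq_trans (\sum_(0 <= x < N) count (fun q => ccert (C i v) q.1 q.2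
      && (x \in chubs (C i v) q.1)) s)).
    by apply: eq_leq; apply: eq_bigr => x _; rewrite size_map size_filter.
  apply: leq_trans (sum_count_mem_le _ _ _ _) _.
  apply: (@leq_trans (\sum_(q <- s | ccert (C i v) q.1 q.2) tlog1)).
    apply: leq_sum => q _; apply: leq_trans (cluster_hubs_size S _) _; rewrite ltnS.
    by apply: leq_trunc_log; apply: max_card.
  rewrite big_const_seq iter_addn addn0 leq_mul2l; apply/orP; right.
  have := cluster_cert_size S; rewrite -EN; apply: leq_trans.
  rewrite -size_filter cardE.
  rewrite -(size_map (fun q : 'I_N * 'I_N => (val q.1, val q.2))).
  apply: uniq_leq_size.
    by rewrite filter_uniq // allpairs_uniq ?iota_uniq // => -[? ?] [? ?].
  move=> [a c]; rewrite mem_filter /= => /andP [cac _].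
  have [aN cN _ _] := cluster_cert S cac.
  by apply/mapP; exists (Ordinal aN, Ordinal cN); rewrite // mem_enum inE.
rewrite -EN; move: K1 K2 K3.
move: (\sum_(0 <= x < N) _)%N (\sum_(0 <= x < N) _)%N (\sum_(0 <= x < N) _)%N => k3 k2 k1 K1 K2 K3.
have Q1 : (N * (b + b + b).+3 <= 3 * (f.+1 * tlog1 * b.+1 * N))%N.
  by move: (b) => B; nia.
have Q2 : (k1 * (b + b + b).+1 <= 3 * (f.+1 * tlog1 * b.+1 * N))%N.
  apply: leq_trans (leq_mul K1 (leqnn _)) _; by move: (b) => B; nia.
have Q3 : (k2 * b.+1 <= f.+1 * tlog1 * b.+1 * N)%N.
  apply: leq_trans (leq_mul K2 (leqnn _)) _; by move: (b) => B; nia.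
have Q4 : (k3 * (b + b + b + b).+1 <= 8 * (f.+1 * tlog1 * b.+1 * N))%N.
  apply: leq_trans (leq_mul K3 (leqnn _)) _; by move: (b) => B; nia.
apply: (@leq_trans (15 * (f.+1 * tlog1 * b.+1 * N))); first by lia.
by rewrite !mulnA !leq_mul2r; apply/orP; right.
Qed.

Lemma size_tables :
  (\sum_u size (enc_table (scheme_table u))
    <= n * b.+2 + 21 * f.+1 * tlog1 * b.+1 * \sum_(i < ns) \sum_v #|Y i v|)%N.
Proof.
have rn u : (rank u < n + ns + 7)%N.
  by apply: leq_trans (ltn_ord _) _; rewrite -addnA leq_addr.
have E u : (size (enc_table (scheme_table u)) <= b.+1 +
   \sum_(q <- scheme_clusters | u \in Y q.1 q.2)
     ((b + b).+1 + size (enc_tree_table (table_at port (C q.1 q.2) (cnum q.1 q.2 u)))))%N.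
  rewrite size_enc_pair size_enc_seq addSnnS; apply: leq_add; first exact: size_code.
  rewrite ltnS big_map big_filter big_seq_cond [leqRHS]big_seq_cond.
  apply: leq_sum => -[i v] /andP [/allpairsP [[i' v'] [/= iN _ [-> ->]]] _].
  rewrite size_enc_pair ltn_add2r ltnS; apply: size_enc_pair2 => //.
  by move: iN; rewrite mem_iota => /andP [_ iN]; rewrite addnAC; apply: leq_trans iN (leq_addl _ _).
apply: (leq_trans (leq_sum _ (fun u _ => E u))).
rewrite big_split /= sum_nat_const; apply: leq_add.
  by rewrite leq_mul2l leqnSn orbT.
rewrite (exchange_big_dep predT) //=.
have -> : (\sum_(i < ns) \sum_v #|Y i v| = \sum_(q <- scheme_clusters) #|Y q.1 q.2|)%N.
  rewrite big_allpairs -(big_mkord xpredT (fun i => \sum_v #|Y i v|)%N) /index_iota subn0.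
  by apply: eq_bigr => i _; rewrite big_enum.
rewrite big_distrr /=; apply: leq_sum => -[i v] _ /=.
have [Y0|Y0] := eqVneq (Y i v) set0; first by rewrite big_pred0 // => u; rewrite Y0 inE.
rewrite big_split /= sum_nat_const.
have H : (#|Y i v| * (b + b).+1 <= 2 * (f.+1 * tlog1 * b.+1 * #|Y i v|))%N.
  by move: #|Y i v| (b) => m B; nia.
apply: (leq_trans (leq_add H (size_cluster_tables Y0))).
rewrite -!mulnA -mulnDl leq_mul2r; exact: orbT.
Qed.

End Sizes.

End Scheme.

(** * Scales and bounds *)

Lemma action_of_forward P p h : action_of P = Forward p h -> exists st, h = enc_state st.
Proof.
rewrite /action_of; case: pselect => // H; case: cid => -[|st|q st] //= _ [_ <-].
by exists st.
Qed.

Lemma path_andb (T : Type) (e e' : rel T) x p :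
  path e x p -> path e' x p -> path (fun u v => e u v && e' u v) x p.
Proof.
by elim: p x => [//|y p IH] x /= /andP [-> /IH H] /andP [-> /H ->].
Qed.

Section Scales.
Variables (R : realType) (V : finType) (G : wgraph R V) (W : R).
Hypothesis GW : weights_between G 1 W.

Local Notation n := #|V|.
Local Notation tlog := (trunc_log 2).

Lemma trunc_log_real (x : R) : 1 <= x ->
  2 ^+ tlog (Num.truncn x) <= x < 2 ^+ (tlog (Num.truncn x)).+1.
Proof.
move=> x1; have x0 : 0 <= x by lra.
have /andP [lo hi] := truncn_itv x0.
have t0 : (0 < Num.truncn x)%N by rewrite truncn_gt0.
have /andP [l1 l2] := trunc_log_bounds (isT : (1 < 2)%N) t0.
apply/andP; split; first by apply: le_trans lo; rewrite -natrX ler_nat.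
by apply: lt_le_trans hi _; rewrite -natrX ler_nat.
Qed.

Definition edge_scale u v : nat := tlog (Num.truncn (wt G u v)).

Definition max_scale : nat := (tlog (Num.truncn W) + tlog n + 3)%N.

(* The exponents within [log n] of the logarithm of some edge weight: a simple
   walk has length between its largest weight and [n] times that weight. *)
Definition scales : seq nat :=
  [seq i <- iota 0 max_scale | [exists u, exists v, adj G u v &&
      (edge_scale u v <= i <= edge_scale u v + tlog n + 2)%N]].

Lemma scales_sorted : sorted ltn scales.
Proof. by apply: sorted_filter; [exact: ltn_trans|exact: iota_ltn_sorted]. Qed.

Lemma size_scales_le_max : (size scales <= max_scale)%N.
Proof. by rewrite size_filter; apply: leq_trans (count_size _ _) _; rewrite size_iota. Qed.

(** An exponent is determined by an edge and an offset. As [W] does not enter, a scale takes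
    [O(log n)] bits; the bound by [max_scale] serves the label and the tables. *)
Lemma size_scales_poly : (size scales <= n * n * (tlog n + 3))%N.
Proof.
pose h (q : V * V * 'I_(tlog n + 3)) := (edge_scale q.1.1 q.1.2 + q.2)%N.
have -> : (n * n * (tlog n + 3))%N = size [seq h q | q : V * V * 'I_(tlog n + 3)].
  by rewrite size_image !card_prod card_ord.
apply: uniq_leq_size; first by rewrite filter_uniq ?iota_uniq.
move=> i; rewrite mem_filter => /andP [/existsP [u /existsP [v /andP [_ /andP [l1 l2]]]] _].
have lt : (i - edge_scale u v < tlog n + 3)%N by lia.
by apply/imageP; exists (u, v, Ordinal lt); rewrite // /h /=; lia.
Qed.

Lemma heavy_edge x p : path (adj G) x p -> p != [::] ->
  exists u v, [/\ adj G u v, wt G u v <= walk_length G x p &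
                  walk_length G x p <= (size p)%:R * wt G u v].
Proof.
elim: p x => [//|y p IH] x /= /andP [xy yp] _.
have [->|p0] := eqVneq p [::].
  by exists x, y; rewrite /= addr0 mul1r.
have [u [v [uv w1 w2]]] := IH y yp p0.
have x1 := wt_ge1 GW xy; have u1 := wt_ge1 GW uv; have s0 : 0 <= (size p)%:R :> R by [].
have [le|lt] := leP (wt G x y) (wt G u v).
  by exists u, v; split=> //; rewrite -?natr1; lra.
have w0 := walk_length_ge0 GW yp.
exists x, y; split=> //; first by lra.
rewrite -natr1 mulrDl mul1r addrC lerD2r; apply: (le_trans w2).
by rewrite ler_wpM2l // ltW.
Qed.

(** Take the least power of two above the length. The heaviest edge of a simple walk is within a
    factor [n] of the length, which places the exponent in [scales]. *)
Lemma exists_scale x p : path (adj G) x p -> uniq (x :: p) -> p != [::] ->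
  exists2 j, (j < size scales)%N &
    walk_length G x p <= 2 ^+ nth 0%N scales j <= 2 * walk_length G x p.
Proof.
move=> pp up p0; have [u [v [uv w1 w2]]] := heavy_edge pp p0.
move: (walk_length G x p) w1 w2 => d w1 w2.
have wt1 := wt_ge1 GW uv; have d1 : 1 <= d by apply: le_trans wt1 w1.
have /andP [lo hi] := trunc_log_real wt1; set l := edge_scale u v in lo hi.
have sp : (size p < n)%N.
  by move: (card_uniqP up) (max_card (mem (x :: p))) => -> /=.
have n0 : (0 < n)%N by apply: leq_ltn_trans sp.
have dub : d <= 2 ^+ (l + tlog n + 2).
  have /andP [_ nb] := trunc_log_bounds (isT : (1 < 2)%N) n0.
  apply: (le_trans w2); rewrite -addnA exprD addn2 exprS mulrA -exprSr mulrC.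
  apply: ler_pM => //; first by lra.
    exact: ltW.
  by rewrite -natrX ler_nat; apply: ltnW; apply: ltn_trans nb.
have ex : exists i, d <= 2 ^+ i by exists (l + tlog n + 2)%N.
case: (ex_minnP ex) => i di imin.
have li : (l <= i)%N.
  rewrite -(leq_exp2l (m := 2)) // -(ler_nat R) !natrX.
  by apply: le_trans lo (le_trans w1 di).
have iu : (i <= l + tlog n + 2)%N by apply: imin.
have lW : (l <= tlog (Num.truncn W))%N.
  by apply: leq_trunc_log; apply: le_truncn; case/andP: (GW uv).
have isc : i \in scales.
  rewrite mem_filter mem_iota /=; apply/andP; split; last first.
    by apply: leq_ltn_trans iu _; rewrite /max_scale add0n -addnS !leq_add2r.
  by apply/existsP; exists u; apply/existsP; exists v; rewrite uv li iu.
exists (index i scales); first by rewrite index_mem.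
rewrite nth_index // di /=.
(* For exponent 0 there is no smaller power to compare with; there the length is at least 1. *)
case: i {li iu isc} di imin => [|i] di imin; first by
  rewrite expr0 (le_trans d1) // ler_peMl ?ler1n // (le_trans ler01).
have : 2 ^+ i < d by rewrite ltNge; apply/negP => /imin; rewrite ltnn.
by move=> /ltW H; rewrite exprS ler_wpM2l.
Qed.

End Scales.

Lemma sum_pow2_sorted (R : realType) (s : seq nat) j : sorted ltn s -> (j < size s)%N ->
  \sum_(i < j) 2 ^+ nth 0%N s i <= 2 ^+ nth 0%N s j :> R.
Proof.
move=> so; elim: j => [|j IH] js; first by rewrite big_ord0 exprn_ge0.
rewrite big_ord_recr /=.
have lt : (nth 0 s j < nth 0 s j.+1)%N.
  by apply: (sorted_ltn_nth ltn_trans 0%N so); rewrite ?inE // ltnW.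
apply: (@le_trans _ _ (2 ^+ (nth 0%N s j).+1)).
  by rewrite exprS mulr2n mulrDl mul1r lerD2r IH // ltnW.
by rewrite ler_weXn2l // ler1n.
Qed.

Lemma sum_arith (R : realType) (A B : R) m :
  \sum_(1 <= j < m.+1) (A + j%:R * B) = m%:R * A + m%:R * (m%:R + 1) / 2 * B.
Proof.
elim: m => [|m IH]; first by rewrite big_geq //; ring.
by rewrite big_nat_recr //= IH -!natr1; field.
Qed.

(** * The stretch factor *)

Section Stretch.
Variables (R : realType) (V : finType) (ns k : nat) (rho : nat -> R) (home : nat -> V -> V).
Variables (C : nat -> V -> cluster R V) (F : {set {set V}}) (t : V).
Hypotheses (rho0 : forall i, 0 <= rho i) (k0 : (0 < k)%N).

Local Notation D := (fun i => 2 * k%:R * rho i).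
Local Notation m := (#|F|%:R : R).

(** In units of the radius: [4 k + j (12 k + 2)] summed over [j] from 0 to [|F|], one search for
    each number of known faults. *)
Definition search_cost : R :=
  4 * k%:R * (m + 1) + m * (m + 1) / 2 * (12 * k%:R + 2).

Lemma scale_cost0 good i : scale_cost ns rho D home C F t good 0 i =
  rho i * (search_cost + (if (i == good) && (good < ns)%N then 0
                          else 4 * k%:R + m * (12 * k%:R + 2))).
Proof.
have Ea j : attempt_cost (rho i) (D i) (C i (home i t)) F 0 j
   = 4 * k%:R * rho i + j%:R * (12 * k%:R * rho i + 2 * rho i).
  by rewrite /attempt_cost /piece_cost /back_cost /enter_cost /diam; ring.
have Ef : future (rho i) (D i) (C i (home i t)) F 0 0
   = \sum_(1 <= j < #|F|.+1) (4 * k%:R * rho i + j%:R * (12 * k%:R * rho i + 2 * rho i)).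
  by apply: eq_bigr => j _.
rewrite /scale_cost Ef sum_arith Ea /enter_cost /diam /search_cost.
by case: ifP => _; field.
Qed.

Lemma later0_le good d : (good < ns)%N ->
  \sum_(i < good) rho i <= rho good -> rho good <= 2 * d ->
  later ns rho D home C F t good 0 0 <= 32 * k%:R * (m + 1) ^+ 2 * d.
Proof.
move=> gns Hs Hd; rewrite /later big_mkord big_ord_recr /= scale_cost0 eqxx gns /= addr0.
have k1 : 1 <= k%:R :> R by rewrite ler1n.
have m0 : 0 <= m by [].
have s0 : 0 <= search_cost.
  by rewrite /search_cost; do ?[by []|apply: addr_ge0|apply: mulr_ge0]; rewrite invr_ge0.
set X := 4 * k%:R + m * (12 * k%:R + 2).
have X0 : 0 <= X by rewrite /X; do ?[by []|apply: addr_ge0|apply: mulr_ge0].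
have -> : \sum_(i < good) scale_cost ns rho D home C F t good 0 i
        = (\sum_(i < good) rho i) * (search_cost + X).
  rewrite big_distrl /=; apply: eq_bigr => i _; rewrite scale_cost0.
  by rewrite (ltn_eqF (ltn_ord i)).
have H1 : (\sum_(i < good) rho i) * (search_cost + X) <= rho good * (search_cost + X).
  by rewrite ler_wpM2r // addr_ge0.
have H2 : rho good * (search_cost + X + search_cost) <= 2 * d * (16 * k%:R * (m + 1) ^+ 2).
  apply: ler_pM => //; first by rewrite !addr_ge0.
  rewrite /X /search_cost -subr_ge0.
  (* The slack, visibly nonnegative for [k >= 1]. The constant 16 is the least integer that works:
     at [k = m = 1] the searches need 62 of the available 64. *)
  have -> : 16 * k%:R * (m + 1) ^+ 2 - (4 * k%:R * (m + 1) + m * (m + 1) / 2 * (12 * k%:R + 2) +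
    (4 * k%:R + m * (12 * k%:R + 2)) +
    (4 * k%:R * (m + 1) + m * (m + 1) / 2 * (12 * k%:R + 2)))
    = (k%:R - 1) * (4 * m ^+ 2 + 4) + 2 * ((m - 1) ^+ 2 + 1) by field.
  have A1 : 0 <= m ^+ 2 by exact: sqr_ge0.
  have A2 : 0 <= (m - 1) ^+ 2 by exact: sqr_ge0.
  have A3 : 0 <= (k%:R - 1) * (4 * m ^+ 2 + 4) by apply: mulr_ge0; lra.
  by lra.
have -> : 32 * k%:R * (m + 1) ^+ 2 * d = 2 * d * (16 * k%:R * (m + 1) ^+ 2) by ring.
apply: le_trans H2; rewrite [X in _ <= X]mulrDr; exact: lerD.
Qed.

End Stretch.

(** * Logarithmic estimates for the code length *)

Section Sizes.
Variable R : realType.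

Lemma trunc_log_ln (m : nat) (x : R) : (0 < m)%N -> m%:R <= x ->
  (trunc_log 2 m)%:R <= ln x / ln 2.
Proof.
move=> m0 mx; have ln2 : 0 < ln 2 :> R by rewrite ln_gt0 // ltr1n.
have x0 : 0 < x by apply: lt_le_trans mx; rewrite ltr0n.
rewrite ler_pdivlMr // mulr_natl -lnXn // ler_ln ?posrE ?exprn_gt0 //.
apply: le_trans mx; rewrite -natrX ler_nat.
by case/andP: (trunc_log_bounds (isT : (1 < 2)%N) m0).
Qed.

Lemma trunc_log_leq m : (trunc_log 2 m <= m)%N.
Proof.
case: m => [|m]; first by rewrite trunc_log0.
have /andP [H _] := trunc_log_bounds (isT : (1 < 2)%N) (ltn0Sn m).
by apply: leq_trans H; apply: ltnW; apply: ltn_expl.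
Qed.

(** Numbers to be coded are at most [16 n ^ 3], so a code has at most [2 (4 + 3 log n) + 1] bits;
    one bit more still fits into [10 lg n], as [lg] contains the summand 1. *)
Lemma code_size_le (V : finType) ns : (0 < #|V|)%N ->
  (ns <= #|V| * #|V| * (trunc_log 2 #|V| + 3))%N ->
  (code_size V ns).+1%:R <= 10 * lg (#|V|%:R : R).
Proof.
rewrite /code_size; move: #|V| => n n0 Hns.
have ln2 : 0 < ln 2 :> R by rewrite ln_gt0 // ltr1n.
have tn := trunc_log_leq n.
have n0' : 0 < n%:R :> R by rewrite ltr0n.
have big : (n + ns + 7 <= 2 ^ 4 * n ^ 3)%N.
  have H : (n * n * (trunc_log 2 n + 3) <= n * n * (n + 3))%N.
    by rewrite leq_mul2l leq_add2r tn orbT.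
  have := leq_trans Hns H; rewrite (_ : 2 ^ 4 = 16)%N // (_ : n ^ 3 = n * n * n)%N; 
    last by rewrite !expnS expn0 muln1 mulnA.
  by clear -n0; nia.
have := @trunc_log_ln (n + ns + 7) (2 ^+ 4 * n%:R ^+ 3); rewrite addnS => /(_ isT).
rewrite -addnS -!natrX -natrM ler_nat => /(_ big).
rewrite natrM !natrX lnM ?posrE ?exprn_gt0 // !lnXn // mulrDl.
have ln1 : 0 <= ln n%:R :> R by rewrite ln_ge0 // ler1n.
have a0 : 0 <= ln n%:R / ln 2 :> R by rewrite divr_ge0 // ltW.
rewrite -(mulr_natl (ln 2)) mulfK ?gt_eqF // -(mulr_natl (ln n%:R)) -mulrA.
have E T : (T.*2.+2)%:R = 2 * T%:R + 2 :> R by rewrite -addn2 natrD -muln2 natrM mulrC.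
by rewrite E /lg; lra.
Qed.

End Sizes.

(** * Determinism of the execution *)

Section Model.
Variables (R : realType) (V : finType) (G : wgraph R V) (port : V -> V -> nat).
Hypothesis GP : port_numbering G port.
Variables (alg : local_algorithm) (table : V -> bits) (F : {set {set V}}) (lt : bits).

Lemma routed_inj u h p p' : routed G port alg table F lt u h p ->
  routed G port alg table F lt u h p' -> p = p'.
Proof.
move=> Rn; elim: Rn p' => {u h p} [u h E|u h v h' p [uv E] _ IH] p' Rn'.
  by case: Rn' E => // {}u {}h v h' q [_ ->].
case: Rn' uv E IH => {u h p'} [u h -> //|u h w h2 q [uw Ew] Rq] uv E IH.
move: E; rewrite Ew => -[Ep Eh].
have vw : v = w.
  have [_ inj] := GP u; case/andP: uv => uv _; case/andP: uw => uw _.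
  by apply: inj uv uw _.
by rewrite -vw Eh in Rq *; rewrite (IH _ Rq).
Qed.

Lemma occurs_encoded s u h :
  occurs G port route table F lt s u h -> h = [::] \/ exists st, h = enc_state st.
Proof.
case=> [|{}u h0 v h' _ [_]]; first by left.
by move/action_of_forward => H; right.
Qed.

End Model.

Lemma prob1 (R : realType) (Omega : finType) (E : Omega -> Prop) : (0 < #|Omega|)%N ->
  (forall omega, E omega) -> prob R E = 1.
Proof.
move=> O0 H; rewrite /prob.
have -> : [set omega | `[< E omega >]] = [set: Omega].
  by apply/setP => w; rewrite !inE; apply/asboolP.
by rewrite cardsT divff // pnatr_eq0 -lt0n.
Qed.

Lemma powR_invn (R : realType) (x : R) k : 0 <= x -> (0 < k)%N -> (x `^ k%:R^-1) ^+ k = x.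
Proof.
move=> x0 k0; rewrite -powR_mulrn ?powR_ge0 // -powRrM mulVf ?powRr1 //.
by rewrite pnatr_eq0 -lt0n.
Qed.

(** * Assembly of the scheme and its bounds *)

Section Deterministic.
Variables (R : realType) (V : finType) (G : wgraph R V) (W : R) (port : V -> V -> nat).
Hypotheses (GW : weights_between G 1 W) (GP : port_numbering G port) (W1 : 1 <= W).
Variables (k f : nat).
Hypotheses (k0 : (0 < k)%N) (f0 : (0 < f)%N) (n0 : (0 < #|V|)%N).

Local Notation n := (#|V|%:R : R).
Local Notation ns := (size (scales G W)).

Definition radius j : R := 2 ^+ nth 0%N (scales G W) j.

Lemma radius_ge0 j : 0 <= radius j.
Proof. by rewrite exprn_ge0. Qed.

Lemma ball_linked (Y : {set V}) (F : {set {set V}}) s t d :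
  (forall v, v \in gball G d t -> v \in Y) ->
  forall p, path (adjF G F) s p -> last s p = t -> walk_length G s p <= d ->
  s \in Y /\ linked G d Y F s t.
Proof.
move=> BY p pp lp wp; have pa := adjF_adj pp.
have pY : {subset s :: p <= Y}.
  have E : (last s p :: rev (belast s p)) =i s :: p.
    by move=> v; rewrite (lastI s p) mem_rcons !in_cons mem_rev.
  move=> v; rewrite -E lp => vp; apply: BY; move: vp; apply: (gball_walk GW).
    rewrite -lp rev_path (eq_path (e' := adj G)) // => a b; exact: adj_sym.
  by rewrite -lp walk_length_rev.
split; first by apply: pY; rewrite mem_head.
apply/connectP; exists p => //; apply: path_andb.
  exact: (local_adj_path GW pa wp pY).
by apply: sub_path pp => u v /andP [].
Qed.

Lemma exists_scheme : exists (Y : nat -> V -> {set V}) (home : nat -> V -> V)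
    (C : nat -> V -> cluster R V),
  [/\ forall i v, Y i v != set0 ->
        cluster_spec G f (radius i) (2 * k%:R * radius i) (Y i v) (C i v),
      forall i t, gball G (radius i) t \subset Y i (home i t) &
      forall i, (\sum_v #|Y i v|)%N%:R <= n `^ k%:R^-1 * n].
Proof.
have cover i := exists_sparse_cover GW k0 (radius_ge0 i) (powR_ge0 n k%:R^-1)
  (powR_invn (ler0n R #|V|) k0).
have [Y HY] := choice cover.
have H1 i : exists h : V -> V, forall t, gball G (radius i) t \subset Y i (h t).
  by have [H _ _] := HY i; have [h Hh] := choice H; exists h.
have [home Hh] := choice H1.
have H2 i v : exists C : cluster R V, Y i v != set0 ->
    cluster_spec G f (radius i) (2 * k%:R * radius i) (Y i v) C.
  have [_ H _] := HY i.
  have [Y0|/set0Pn [x /H [vY _]]] := eqVneq (Y i v) set0.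
    by exists (Cluster 0 id id (fun=> v) (fun=> [::]) (fun _ _ => false) (fun=> 0)).
  have [C HC] := exists_cluster GW f vY (fun x xY => (H v x xY).2).
  by exists C.
have H3 i : exists C : V -> cluster R V, forall v, Y i v != set0 ->
    cluster_spec G f (radius i) (2 * k%:R * radius i) (Y i v) (C v).
  by have [c Hc] := choice (H2 i); exists c.
have [C HC] := choice H3.
by exists Y, home, C; split=> // i; have [_ _] := HY i.
Qed.

Section Bounds.
Variables (Y : nat -> V -> {set V}) (home : nat -> V -> V) (C : nat -> V -> cluster R V).
Hypothesis CS : forall i v, Y i v != set0 ->
  cluster_spec G f (radius i) (2 * k%:R * radius i) (Y i v) (C i v).
Hypothesis CB : forall i t, gball G (radius i) t \subset Y i (home i t).
Hypothesis CY : forall i, (\sum_v #|Y i v|)%N%:R <= n `^ k%:R^-1 * n.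

Local Notation table := (fun u => enc_table (scheme_table port ns Y C u)).
Local Notation label := (fun t => enc_label (scheme_label ns home C t)).

Lemma home_in i t : t \in Y i (home i t).
Proof. by apply: (fintype.subsetP (CB i t)); rewrite gball_refl ?radius_ge0. Qed.

(** [dist] is an infimum, so the bound is first proved against every surviving walk [p]. The good
    scale depends on [p], but by [routed_inj] the traversed walk does not. *)
Lemma scheme_routes (F : {set {set V}}) s t : (#|F| <= f)%N -> connect (adjF G F) s t ->
  routes_within G port route label table F s t (32 * k%:R * (#|F|%:R + 1) ^+ 2).
Proof.
move=> Ff con.
have k1 : 0 < k%:R :> R by rewrite ltr0n.
have c0 : 0 < 32 * k%:R * (#|F|%:R + 1) ^+ 2 :> R.
  by rewrite !mulr_gt0 // exprn_gt0 // ltr_wpDl.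
have K p : path (adjF G F) s p -> last s p = t -> exists q,
   [/\ routed G port route table F (label t) s [::] q, last s q = t &
      walk_length G s q <= 32 * k%:R * (#|F|%:R + 1) ^+ 2 * walk_length G s p].
  move=> pp lp.
  (* For [s = t] there may be no scale at all; the comparison of identifiers delivers at once. *)
  have [st|st] := eqVneq s t.
    have w0 := walk_length_ge0 GW (adjF_adj pp).
    exists [::]; split=> //; last by rewrite mulr_ge0 // ltW.
    apply: routed_deliver; rewrite act_route st.
    have H : vertex_step (scheme_table port ns Y C t) (scheme_label ns home C t)
       (failed_ports G port F t) (decode_state [::]) = Finish.
      by rewrite /vertex_step /= eqxx.
    rewrite /action_of; case: pselect => // H'; case: cid => o /= Ho.
    have := @local_stop (scheme_table port ns Y C t) (scheme_label ns home C t)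
      (failed_ports G port F t) (decode_state [::]).
    by rewrite H => L; rewrite -(local_run_inj (L _) Ho).
  have sub : subrel (adjF G F) (adj G) by move=> u v /andP [].
  have [q [pq lq uq wq]] := exists_uniq_walk GW sub pp.
  rewrite lp in lq.
  have q0 : q != [::] by apply: contra st => /eqP q0; rewrite -lq q0.
  have [g gns /andP [g1 g2]] := exists_scale GW (adjF_adj pq) uq q0.
  have BL : s \in Y g (home g t) /\ linked G (radius g) (Y g (home g t)) F s t.
    by apply: (ball_linked _ pq lq g1); exact: fintype.subsetP (CB g t).
  have [r [Rr lr wr]] := routed_scheme GW GP radius_ge0 CS home_in Ff (fun _ => BL) gns.
  exists r; split=> //; apply: (le_trans wr).
  apply: le_trans (later0_le home C F t radius_ge0 k0 gns _ g2) _.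
    exact: sum_pow2_sorted (scales_sorted G W) gns.
  by rewrite ler_wpM2l // ltW.
have [p0 pp0 lp0] := connectP con.
have [q [Rq lq _]] := K p0 pp0 (esym lp0).
exists q; split=> //.
set c := 32 * _ * _ in c0 K *.
have -> : walk_length G s q = c * (walk_length G s q / c).
  by rewrite mulrC mulfVK // gt_eqF.
rewrite EFinM lee_pmul2l ?lte_fin //; apply: le_ereal_inf_tmp => _ [p [pp lp] <-].
rewrite lee_fin ler_pdivrMr // mulrC.
have [q' [Rq' _ w]] := K p pp lp.
by rewrite (routed_inj GP Rq Rq').
Qed.

Lemma lg_bounds : [/\ 1 <= lg n, lg n <= lg (n * W) & ns.+1%:R <= 4 * lg (n * W)].
Proof.
have ln2 : 0 < ln 2 :> R by rewrite ln_gt0 // ltr1n.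
have n1 : 1 <= n by rewrite ler1n.
have W0 : 0 < W by apply: lt_le_trans W1.
have a0 : 0 <= ln n / ln 2 by rewrite divr_ge0 ?ln_ge0 ?ler1n.
have w0 : 0 <= ln W / ln 2 by rewrite divr_ge0 ?ln_ge0 ?ler1n.
have -> : lg (n * W) = 1 + ln n / ln 2 + ln W / ln 2.
  by rewrite /lg lnM ?posrE ?ltr0n // mulrDl addrA.
have Ta : (trunc_log 2 #|V|)%:R <= ln n / ln 2 by apply: trunc_log_ln.
have Tw : (trunc_log 2 (Num.truncn W))%:R <= ln W / ln 2.
  apply: trunc_log_ln; first by rewrite truncn_gt0.
  by case/andP: (truncn_itv (ltW W0)).
have : ns.+1%:R <= (trunc_log 2 (Num.truncn W))%:R + (trunc_log 2 #|V|)%:R + 4 :> R.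
  by rewrite -!natrD ler_nat addnS ltnS; apply: size_scales_le_max.
by rewrite /lg => H; split; lra.
Qed.

Lemma code_bound : (code_size V ns).+1%:R <= 10 * lg n.
Proof. by apply: code_size_le => //; apply: size_scales_poly. Qed.

(** One constant for all bounds, dictated by the tables: 11 for the identifiers, 21 from
    [size_tables], 2 from [f + 1 <= 2 f], 10 from [code_bound], 4 from the number of scales. *)
Definition size_const : R := 11 + 21 * (2 * (10 * 4)).

Lemma size_const_ge0 : 0 <= size_const.
Proof. by rewrite addr_ge0 // !mulr_ge0. Qed.

Lemma label_bound t : (size (label t))%:R <= size_const * lg (n * W) * lg n.
Proof.
have [l1 lW S] := lg_bounds; have cb := code_bound.
have := size_label ns CS home_in t; rewrite -(ler_nat R) !natrM => H.
apply: (le_trans H); apply: (@le_trans _ _ (4 * (10 * lg n) * (4 * lg (n * W)))).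
  by apply: ler_pM => //; rewrite ?mulr_ge0 // ler_wpM2l.
have : 0 <= lg n * lg (n * W) by rewrite mulr_ge0 //; lra.
by rewrite /size_const; lra.
Qed.

Lemma header_bound (F : {set {set V}}) s t u h : (#|F| <= f)%N ->
  occurs G port route table F (label t) s u h ->
  (size h)%:R <= size_const * f%:R ^+ 2 * lg n ^+ 2.
Proof.
move=> Ff oc; have [l1 _ _] := lg_bounds; have cb := code_bound.
have f1 : 1 <= f%:R :> R by rewrite ler1n.
have [->|[st Eh]] := occurs_encoded oc.
  by rewrite mulr_ge0 ?sqr_ge0 // mulr_ge0 ?sqr_ge0 // size_const_ge0.
(* With [good := ns] the hypothesis on the good scale is vacuous, so the header bound covers every
   message, also when [s] and [t] are disconnected. *)
have nlt P : (ns < ns)%N -> P by rewrite ltnn.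
have I := occurs_run_inv (good := ns) GW GP radius_ge0 CS home_in Ff (nlt _) oc.
rewrite Eh decode_stateK in I.
have := size_header GP CS Ff I; rewrite -Eh -(ler_nat R) natrM natrX natrM => H.
apply: (le_trans H); apply: (@le_trans _ _ (21 * (10 * lg n) * (2 * f%:R) ^+ 2)).
  apply: ler_pM; rewrite ?mulr_ge0 ?exprn_ge0 // ?ler_wpM2l //.
  by rewrite lerXn2r ?nnegrE ?mulr_ge0 // -natr1; lra.
have F0 : 0 <= f%:R ^+ 2 :> R by exact: sqr_ge0.
have L : lg n <= lg n ^+ 2 by rewrite expr2 ler_peMl //; lra.
have : f%:R ^+ 2 * lg n <= f%:R ^+ 2 * lg n ^+ 2 by rewrite ler_wpM2l.
have : 0 <= f%:R ^+ 2 * lg n by rewrite mulr_ge0 //; lra.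
rewrite exprMn /size_const; lra.
Qed.

Lemma table_bound : (\sum_u size (table u))%N%:R <=
  size_const * f%:R * n `^ (1 + k%:R^-1) * lg (n * W) * lg n ^+ 2.
Proof.
have [l1 lW S] := lg_bounds; have cb := code_bound.
have f1 : 1 <= f%:R :> R by rewrite ler1n.
have n1 : 1 <= n by rewrite ler1n.
set q := n `^ k%:R^-1.
have q0 : 0 <= q by apply: powR_ge0.
(* This absorbs the bits for the identifiers, linear in [n] up to a logarithm, into [n * q]. *)
have q1 : 1 <= q.
  rewrite leNgt; apply/negP => q1; have := powR_invn (ler0n R #|V|) k0.
  rewrite -/q => E; have : q ^+ k < 1 by rewrite exprn_ilt1 // -lt0n.
  by rewrite E ltNge n1.
have -> : n `^ (1 + k%:R^-1) = n * q.
  rewrite powRD ?powRr1 //; apply/implyP => _; by rewrite gt_eqF // ltr0n.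
have Y1 : (\sum_(i < ns) \sum_v #|Y i v|)%N%:R <= ns%:R * (q * n).
  rewrite natr_sum; apply: (@le_trans _ _ (\sum_(i < ns) q * n)).
    by apply: ler_sum => i _; apply: CY.
  by rewrite sumr_const card_ord mulr_natl.
have T1 : (trunc_log 2 #|V|).+1%:R <= lg n.
  by rewrite -natr1 /lg addrC lerD2l; apply: trunc_log_ln.
have := size_tables GP ns CS; rewrite -(ler_nat R) natrD !natrM => H.
apply: (le_trans H).
set x := lg n in l1 lW cb T1 *; set y := lg (n * W) in lW S *.
have c2 : (code_size V ns).+2%:R <= 11 * x by rewrite -natr1; lra.
have H1 : n * (code_size V ns).+2%:R <= n * (11 * x) by rewrite ler_wpM2l.
have H2 : 21 * f.+1%:R * (trunc_log 2 #|V|).+1%:R * (code_size V ns).+1%:R *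
     (\sum_(i < ns) \sum_v #|Y i v|)%N%:R
   <= 21 * (2 * f%:R) * x * (10 * x) * (4 * y * (q * n)).
  apply: ler_pM; rewrite ?mulr_ge0 //; last first.
    apply: (le_trans Y1); rewrite ler_wpM2r ?mulr_ge0 //.
    by apply: le_trans S; rewrite ler_nat.
  apply: ler_pM; rewrite ?mulr_ge0 //; apply: ler_pM; rewrite ?mulr_ge0 //.
  by rewrite ler_wpM2l // -natr1; lra.
have y1 : 1 <= y by lra.
have H3 : n * (11 * x) <= 11 * (f%:R * (n * q) * y * x ^+ 2).
  have -> : n * (11 * x) = 11 * (1 * (n * 1) * 1 * x) by ring.
  rewrite ler_wpM2l //; apply: ler_pM; rewrite ?mulr_ge0 //; try lra.
    apply: ler_pM; rewrite ?mulr_ge0 //.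
    by apply: ler_pM; rewrite ?mulr_ge0 // ler_wpM2l.
  by rewrite expr2 ler_peMl //; lra.
have P0 : 0 <= f%:R * (n * q) * y * x ^+ 2.
  by rewrite !mulr_ge0 ?sqr_ge0 //; lra.
have E1 : size_const * f%:R * (n * q) * y * x ^+ 2 = size_const * (f%:R * (n * q) * y * x ^+ 2).
  by rewrite !mulrA.
have E2 : 21 * (2 * f%:R) * x * (10 * x) * (4 * y * (q * n))
  = 21 * (2 * (10 * 4)) * (f%:R * (n * q) * y * x ^+ 2) by ring.
rewrite E1; apply: le_trans (lerD (le_trans H1 H3) H2) _.
by rewrite E2 -mulrDl.
Qed.

End Bounds.
End Deterministic.

(** The sample space is a single point, so success has probability 1 and any exponent [c] is met. *)
Theorem theorem5p5 (R : realType) (c : nat) :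
  exists (C : R) (e : nat) (alg : local_algorithm),
  forall (k f : nat) (V : finType) (W : R) (G : wgraph R V)
         (port : V -> V -> nat),
    (1 <= k)%N -> (1 <= f)%N -> 1 <= W ->
    weights_between G 1 W -> port_numbering G port ->
  exists (Omega : finType) (label table : Omega -> V -> bits),
    let n : R := #|V|%:R in
    [/\ (0 < #|Omega|)%N,
        forall omega : Omega,
          (\sum_(u : V) size (table omega u))%N%:R
            <= C * f%:R * n `^ (1 + k%:R^-1) * lg (n * W) * lg n ^+ e,
        forall (omega : Omega) (u : V),
          (size (label omega u))%:R <= C * lg (n * W) * lg n,
        forall (omega : Omega) (F : {set {set V}}) (s t u : V) (h : bits),
          F \subset edges G -> (#|F| <= f)%N ->
          occurs G port alg (table omega) F (label omega t) s u h ->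
          (size h)%:R <= C * f%:R ^+ 2 * lg n ^+ e &
        forall (F : {set {set V}}) (s t : V),
          F \subset edges G -> (#|F| <= f)%N -> connect (adjF G F) s t ->
          1 - (n ^+ c)^-1 <=
            prob R (fun omega : Omega =>
              routes_within G port alg (label omega) (table omega) F s t
                (32 * k%:R * (#|F|%:R + 1) ^+ 2))].
Proof.
exists (size_const R), 2%N, route => k f V W G port k0 f0 W1 GW GP.
have u0 : (0 < #|{: unit}|)%N by rewrite card_unit.
(* Without vertices only the table sum is left, and it is 0. Since [ln 0] is 0 by convention,
   [lg 0 = 1] and the right-hand side is nonnegative. *)
case: (posnP #|V|) => [V0|n0].
  have nV (v : V) : False by have := card0_eq V0 v; rewrite inE.
  exists unit, (fun _ _ => [::]), (fun _ _ => [::]); split=> //.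
  move=> _; rewrite big1 // V0 mul0r.
  have -> : lg 0 = 1 :> R by rewrite /lg ln0 // mul0r addr0.
  by rewrite !mulr_ge0 ?powR_ge0 ?sqr_ge0 ?size_const_ge0.
have [Y [home [C [CS CB CY]]]] := exists_scheme GW f k0.
exists unit, (fun _ t => enc_label (scheme_label (size (scales G W)) home C t)),
  (fun _ u => enc_table (scheme_table port (size (scales G W)) Y C u)).
split=> //.
- by move=> _; apply: (table_bound GP W1 k0 f0 n0 CS CY).
- by move=> _ u; apply: (label_bound W1 n0 CS CB).
- move=> _ F s t u h _ Ff; exact: (header_bound GW GP W1 f0 n0 CS CB Ff).
move=> F s t _ Ff con; rewrite prob1 // => _.
exact: (scheme_routes GW GP k0 CS CB Ff con).
Qed.
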